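(* Let $\varphi$ be a function analytic in $\mathbb{D}$ with $\varphi'\in H^\infty$ and let $\Phi$ be the function on $\mathbb{T}\times\mathbb{T}$ defined by $$ \Phi(\zeta,\tau)=\frac{\varphi(\zeta)-\varphi(\tau)}{\zeta-\tau}\quad\text{for }\zeta\ne\tau,\qquad \Phi(\zeta,\zeta)=0,\quad \zeta,\tau\in\mathbb{T}. $$ Suppose that $T$ is a contraction and $Q$ is a bounded linear operator on a Hilbert space such that $TQ-QT\in\boldsymbol{S}_2$. Then $$ \varphi(T)Q-Q\varphi(T)=\iint\limits_{\mathbb{T}\times\mathbb{T}}\Phi(\zeta,\tau)\,d\mathcal{E}_T(\zeta)\,(TQ-QT)\,d\mathcal{E}_T(\tau), $$ where $\mathcal{E}_T$ is a semi-spectral measure of $T$.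
   Context: $\mathbb{D}$ is the open unit disk, $\mathbb{T}$ the unit circle; $H^\infty$ is the space of bounded analytic functions in $\mathbb{D}$; $\boldsymbol{S}_2$ is the Hilbert–Schmidt class. A contraction is an operator of norm at most $1$. $C_A$ is the disk-algebra (functions analytic in $\mathbb{D}$ and continuous on the closed disk); if $\varphi'\in H^\infty$ then $\varphi\in C_A$. For $f\in C_A$ and a contraction $T$, $f(T)$ is defined by extending the polynomial calculus by continuity using von Neumann's inequality. Semi-spectral measures: for a measurable space $(\mathcal{X},\mathcal{B})$ and a Hilbert space $\mathcal{H}$, a semi-spectral measure is a map $\mathcal{E}$ from $\mathcal{B}$ to the bounded operators on $\mathcal{H}$ with $\mathcal{E}(\Delta)\ge0$, $\mathcal{E}(\varnothing)=0$, $\mathcal{E}(\mathcal{X})=I$, countably additive in the weak operator topology. By Naimark's theorem it has a spectral dilation, i.e., a spectral measure $E$ on a Hilbert space $\mathcal{K}\supset\mathcal{H}$ with $\mathcal{E}(\Delta)=P_{\mathcal{H}}E(\Delta)|\mathcal{H}$, and $\int f\,d\mathcal{E}:=P_{\mathcal{H}}\left(\int f\,dE\right)\big|\mathcal{H}$ for bounded measurable $f$ (independent of the dilation). A semi-spectral measure of a contraction $T$ on $\mathcal{H}$ is $\mathcal{E}_T(\Delta)=P_{\mathcal{H}}E_U(\Delta)|\mathcal{H}$, $\Delta\subset\mathbb{T}$ Borel, where $E_U$ is the spectral measure of a unitary dilation $U$ of $T$ (a unitary operator on some $\mathcal{K}\supset\mathcal{H}$ with $T^n=P_{\mathcal{H}}U^n|\mathcal{H}$,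 $n\ge0$); thus $T^n=\int_{\mathbb{T}}\zeta^n\,d\mathcal{E}_T(\zeta)$, $n\ge0$. Double operator integrals with a Hilbert–Schmidt operator $K$: for semi-spectral measures $\mathcal{E}_1,\mathcal{E}_2$ (on $\mathcal{X}_1,\mathcal{X}_2$) there is a semi-spectral measure $\mathcal{F}$ on $\mathcal{X}_1\times\mathcal{X}_2$, with values in the bounded operators on the Hilbert space of Hilbert–Schmidt operators, such that $\mathcal{F}(\Delta_1\times\Delta_2)K=\mathcal{E}_1(\Delta_1)K\,\mathcal{E}_2(\Delta_2)$; for bounded measurable $\Phi$ on $\mathcal{X}_1\times\mathcal{X}_2$ and $K\in\boldsymbol{S}_2$, $\iint\Phi\,d\mathcal{E}_1\,K\,d\mathcal{E}_2:=\left(\int\Phi\,d\mathcal{F}\right)K$. *)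

(* Defs.v *)
From HB Require Import structures.
From mathcomp Require Import all_boot all_order all_algebra.
From mathcomp Require Import complex ring lra.
From mathcomp Require Import all_classical all_reals all_analysis.

Set Implicit Arguments.
Unset Strict Implicit.
Unset Printing Implicit Defensive.

Import Order.TTheory GRing.Theory Num.Theory.
Import numFieldNormedType.Exports.

Local Open Scope classical_set_scope.
Local Open Scope ring_scope.

(* The library puts a topology on R[i]^o only. *)
HB.instance Definition _ (R : realType) := NormedModule.copy R[i] R[i]^o.

(* The inner product is linear in its first argument. *)
HB.mixin Record isHilbert (C : numClosedFieldType) V
    & CompleteNormedModule C V := {
  inner : V -> V -> C;
  innerDl : forall u v w, inner (u + v) w = inner u w + inner v w;
  innerZl : forall a u w, inner (a *: u) w = a * inner u w;
  inner_conj : forall u v, inner u v = (inner v u)^*;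
  normr_inner : forall u : V, `|u| ^+ 2 = inner u u }.

#[short(type="hilbertType")]
HB.structure Definition Hilbert (C : numClosedFieldType) :=
  {V of isHilbert C V & CompleteNormedModule C V}.

Section PreInner.
Variables (C : numClosedFieldType) (V : lmodType C) (f : V -> V -> C).
Hypothesis fD : forall u v w, f (u + v) w = f u w + f v w.
Hypothesis fZ : forall a u w, f (a *: u) w = a * f u w.
Hypothesis fC : forall u v, f u v = (f v u)^*.
Hypothesis f_ge0 : forall u, 0 <= f u u.
Hypothesis f_eq0 : forall u, f u u = 0 -> u = 0.

Lemma pre_Dr u v w : f u (v + w) = f u v + f u w.
Proof. by rewrite fC fD rmorphD/= -!fC. Qed.
Lemma pre_Zr a u w : f u (a *: w) = a^* * f u w.
Proof. by rewrite fC fZ rmorphM/= -fC. Qed.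
Lemma pre_0l u : f 0 u = 0.
Proof. by rewrite -(scale0r 0) fZ mul0r. Qed.

Lemma pre_CS u v : `|f u v| ^+ 2 <= f u u * f v v.
Proof.
have [->|v0] := eqVneq v 0.
  by rewrite fC pre_0l conjC0 normr0 expr0n/= mulr_ge0.
have fv0 : 0 < f v v.
  by rewrite lt_neqAle f_ge0 andbT eq_sym; apply: contra_neq v0; exact: f_eq0.
rewrite -ler_pdivrMr// -subr_ge0.
have := f_ge0 (u - (f u v / f v v) *: v).
rewrite -scaleNr fD !pre_Dr !fZ !pre_Zr.
have -> : f v u = (f u v)^* by rewrite -fC.
rewrite rmorphN rmorphM/= fmorphV/= -(fC v v) normCK.
set t := (f u v)^*; set s := f u v; set r := f v v.
suff -> : f u u + - (t / r) * s + (- (s / r) * t + - (s / r) * (- (t / r) * r))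
  = f u u - s * t / r by [].
by rewrite /r; field; exact: lt0r_neq0.
Qed.

Definition pre_norm u : C := sqrtC (f u u).

Lemma pre_normZ a u : pre_norm (a *: u) = `|a| * pre_norm u.
Proof.
rewrite /pre_norm fZ pre_Zr mulrA -normCK sqrtCM ?nnegrE ?exprn_ge0//.
by rewrite sqrCK.
Qed.

Lemma pre_norm_eq0 u : pre_norm u = 0 -> u = 0.
Proof. by move=> /eqP; rewrite sqrtC_eq0 => /eqP /f_eq0. Qed.

Lemma pre_normD u v : pre_norm (u + v) <= pre_norm u + pre_norm v.
Proof.
have p0 w : 0 <= pre_norm w by rewrite sqrtC_ge0.
rewrite -(@ler_pXn2r _ 2)// ?nnegrE ?addr_ge0//.
rewrite sqrrD !sqrtCK fD !pre_Dr.
have -> : f v u = (f u v)^* by rewrite -fC.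
rewrite addrA lerD2r -addrA lerD2l.
have CS : `|f u v| <= pre_norm u * pre_norm v.
  rewrite -(@ler_pXn2r _ 2)// ?nnegrE ?mulr_ge0//.
  by rewrite exprMn !sqrtCK pre_CS.
apply: (@le_trans _ _ (`|f u v| *+ 2)); last by rewrite lerMn2r.
apply: (@le_trans _ _ `|f u v + (f u v)^*|); last first.
  by rewrite (le_trans (ler_normD _ _))// norm_conjC mulr2n.
by rewrite real_ler_norm// CrealE rmorphD/= conjCK addrC.
Qed.
End PreInner.

Section HilbertTheory.
Variables (C : numClosedFieldType) (V : hilbertType C).
Implicit Types (u v w : V) (B : set V) (s t : seq V).

Lemma innerDr u v w : inner u (v + w) = inner u v + inner u w.
Proof. exact: (pre_Dr (@innerDl C V) (@inner_conj C V)). Qed.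

Lemma innerZr a u w : inner u (a *: w) = a^* * inner u w.
Proof. exact: (pre_Zr (@innerZl C V) (@inner_conj C V)). Qed.

Lemma inner0l u : inner 0 u = 0.
Proof. exact: (pre_0l (@innerZl C V)). Qed.

Lemma inner0r u : inner u 0 = 0.
Proof. by rewrite inner_conj inner0l conjC0. Qed.

Lemma innerNl u v : inner (- u) v = - inner u v.
Proof. by rewrite -scaleN1r innerZl mulN1r. Qed.

Lemma innerBl u v w : inner (u - v) w = inner u w - inner v w.
Proof. by rewrite innerDl innerNl. Qed.

Lemma inner_ge0 u : 0 <= inner u u.
Proof. by rewrite -normr_inner exprn_ge0. Qed.

Lemma inner_eq0 u : inner u u = 0 -> u = 0.
Proof. by rewrite -normr_inner => /eqP; rewrite expf_eq0/= normr_eq0 => /eqP. Qed.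

Lemma inner_CS u v : `|inner u v| <= `|u| * `|v|.
Proof.
rewrite -(@ler_pXn2r _ 2)// ?nnegrE ?mulr_ge0//.
rewrite exprMn !normr_inner.
exact: (pre_CS (@innerDl C V) (@innerZl C V) (@inner_conj C V) inner_ge0 inner_eq0).
Qed.

Lemma conj_normV u : `|u|^* = `|u|.
Proof. by rewrite conj_Creal// ger0_real. Qed.

Lemma inner_suml (I : Type) (r : seq I) (F : I -> V) w :
  inner (\sum_(i <- r) F i) w = \sum_(i <- r) inner (F i) w.
Proof.
elim: r => [|i r IH]; first by rewrite !big_nil inner0l.
by rewrite !big_cons innerDl IH.
Qed.

Definition orthonormal B :=
  forall e e', B e -> B e' -> inner e e' = (e == e')%:R.

Definition orthonormal_basis B :=
  orthonormal B /\ forall u, (forall e, B e -> inner u e = 0) -> u = 0.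

Lemma exists_orthonormal_basis : exists B, orthonormal_basis B.
Proof.
have [|B [oB maxB]] := @Zorn_bigcup V orthonormal.
  move=> F FP tot e e' [X FX Xe] [Y FY Ye'].
  have [XY|YX] := tot _ _ FX FY.
    by apply: (FP _ FY) => //; exact: XY.
  by apply: (FP _ FX) => //; exact: YX.
exists B; split => // u uB; apply: contrapT => /eqP u0.
have nu0 : `|u| != 0 by rewrite normr_eq0.
pose e0 := `|u|^-1 *: u.
have e0B e : B e -> inner e0 e = 0 by move=> Be; rewrite innerZl uB// mulr0.
have e01 : inner e0 e0 = 1.
  rewrite innerZl innerZr -normr_inner fmorphV/= conj_normV expr2.
  by rewrite mulKf// mulVf.
have Be0 : ~ B e0 by move=> /e0B; rewrite e01 => /eqP; rewrite oner_eq0.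
apply: (maxB (B `|` [set e0])).
  split; first by move=> x; left.
  by move=> /(_ e0 (or_intror erefl)).
move=> e e' [Be|->] [Be'|->]; first exact: oB.
- rewrite inner_conj e0B// conjC0; case: eqP => // ee0.
  by rewrite ee0 in Be.
- rewrite e0B//; case: eqP => // ee0.
  by rewrite -ee0 in Be'.
- by rewrite e01 eqxx.
Qed.

(* The Hilbert-Schmidt class and its inner product, defined below through this
   chosen basis, do not depend on the choice. *)
Definition onb : set V := projT1 (cid exists_orthonormal_basis).

Lemma onbP : orthonormal_basis onb.
Proof. exact: projT2 (cid exists_orthonormal_basis). Qed.

Definition fourier s u := \sum_(e <- s) inner u e *: e.

Definition sub_onb s := uniq s /\ forall e, e \in s -> onb e.

Lemma inner_fourier s u e : sub_onb s -> onb e ->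
  inner (fourier s u) e = (e \in s)%:R * inner u e.
Proof.
move=> [us sB] Be; rewrite /fourier inner_suml.
under eq_big_seq => x xs do rewrite innerZl (onbP.1 _ _ (sB _ xs) Be).
have [es|es] := boolP (e \in s); last first.
  rewrite mul0r big_seq big1// => x xs; case: eqP => [xe|]; last by rewrite mulr0.
  by rewrite xe (negbTE es) in xs.
rewrite (bigD1_seq e)//= eqxx mulr1 mul1r big1 ?addr0// => x /negbTE ->.
by rewrite mulr0.
Qed.

Lemma norm_fourier s u : sub_onb s ->
  `|fourier s u| ^+ 2 = \sum_(e <- s) `|inner u e| ^+ 2.
Proof.
move=> sB; rewrite normr_inner {1}/fourier inner_suml.
apply: eq_big_seq => e es; rewrite innerZl (inner_conj e).
by rewrite inner_fourier//; [rewrite es mul1r normCK|exact: sB.2].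
Qed.

Lemma inner_fourier_self s u : sub_onb s ->
  inner u (fourier s u) = `|fourier s u| ^+ 2.
Proof.
move=> sB; rewrite norm_fourier// inner_conj /fourier inner_suml rmorph_sum/=.
apply: eq_bigr => e _; rewrite innerZl (inner_conj e u) -normCK.
by rewrite rmorphXn/= conj_normC.
Qed.

Lemma norm_sub_fourier s u : sub_onb s ->
  `|u - fourier s u| ^+ 2 = `|u| ^+ 2 - `|fourier s u| ^+ 2.
Proof.
move=> sB; rewrite !normr_inner innerBl -scaleN1r !innerDr !innerZr.
have h := inner_fourier_self u sB.
rewrite (inner_conj (fourier s u) u) h rmorphXn/= conj_normV normr_inner.
rewrite rmorphN1; ring.
Qed.

Lemma bessel s u : sub_onb s -> \sum_(e <- s) `|inner u e| ^+ 2 <= `|u| ^+ 2.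
Proof.
move=> sB; rewrite -norm_fourier// -subr_ge0 -norm_sub_fourier//.
Qed.

Lemma sub_onbU s t : sub_onb s -> sub_onb t -> sub_onb (undup (s ++ t)).
Proof.
move=> sB tB; split; first exact: undup_uniq.
by move=> e; rewrite mem_undup mem_cat => /orP[/sB.2|/tB.2].
Qed.

Lemma fourier_sub s t u : sub_onb s -> sub_onb t -> {subset s <= t} ->
  `|fourier t u - fourier s u| ^+ 2 =
  \sum_(e <- t) `|inner u e| ^+ 2 - \sum_(e <- s) `|inner u e| ^+ 2.
Proof.
move=> sB tB st; pose r := [seq x <- t | x \notin s].
have pr : perm_eq t (s ++ r).
  apply: uniq_perm; first exact: tB.1.
    rewrite cat_uniq sB.1 filter_uniq ?tB.1// andbT/=.
    by apply/hasPn => x; rewrite mem_filter => /andP[].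
  move=> x; rewrite mem_cat mem_filter; have [/st ->//|] := boolP (x \in s).
  by [].
have rB : sub_onb r.
  split; first by rewrite filter_uniq ?tB.1.
  by move=> e; rewrite mem_filter => /andP[_ /tB.2].
rewrite /fourier !(perm_big _ pr)/= !big_cat/= [X in X - _]addrC addrK.
rewrite -/(fourier r u) norm_fourier// [X in _ = X - _]addrC addrK//.
Qed.

End HilbertTheory.
Arguments onb {C} V.

Section RealNorm.
Variables (R : realType) (H : normedModType R[i]).
Implicit Types (u v : H).

Definition rnorm u : R := complex.Re `|u|.

Lemma rnormE u : (rnorm u)%:C%C = `|u|.
Proof. by rewrite RRe_real// ger0_real. Qed.

Lemma rnorm_ge0 u : 0 <= rnorm u.
Proof. by rewrite -ler0c rnormE. Qed.

Lemma rnormD u v : rnorm (u + v) <= rnorm u + rnorm v.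
Proof. by rewrite -lecR rmorphD/= !rnormE ler_normD. Qed.

Lemma rnormZ a u : rnorm (a *: u) = complex.Re `|a| * rnorm u.
Proof.
have aE : (complex.Re `|a|)%:C%C = `|a| by rewrite RRe_real// ger0_real.
by rewrite {1}/rnorm normrZ -rnormE -{1}aE -rmorphM.
Qed.

Lemma rnorm0 : rnorm 0 = 0.
Proof. by rewrite /rnorm normr0. Qed.

Lemma rnorm_eq0 u : rnorm u = 0 -> u = 0.
Proof. by move=> u0; apply/eqP; rewrite -normr_eq0 -rnormE u0. Qed.

Lemma rnormN u : rnorm (- u) = rnorm u.
Proof. by rewrite /rnorm normrN. Qed.

Lemma rnormB u v : rnorm (u - v) = rnorm (v - u).
Proof. by rewrite /rnorm distrC. Qed.

End RealNorm.

Section Density.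
Variables (R : realType) (H : hilbertType R[i]).
Implicit Types (u v : H).

Lemma fourier_dense u (e : R) : 0 < e ->
  exists s, sub_onb s /\ rnorm (u - fourier s u) < e.
Proof.
move=> e0.
pose g (s : seq H) := \sum_(x <- s) rnorm (inner u x) ^+ 2.
have gE s : (g s)%:C%C = \sum_(x <- s) `|inner u x| ^+ 2.
  by rewrite rmorph_sum/=; apply: eq_bigr => x _; rewrite rmorphXn/= rnormE.
pose S := [set g s | s in @sub_onb _ H].
have nil_ok : sub_onb ([::] : seq H) by split.
have supS : has_sup S.
  split; first by exists (g [::]); exists [::].
  exists (rnorm u ^+ 2) => _ [s sB <-].
  by rewrite -lecR gE rmorphXn/= rnormE bessel.
pose G (s : seq H) := [set fourier t u | t in [set t | sub_onb t /\ {subset s <= t}]].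
pose F := filter_from (@sub_onb _ H) G.
have FF : ProperFilter F.
  apply: filter_from_proper.
    apply: filter_from_filter; first by exists [::].
    move=> s t sB tB; exists (undup (s ++ t)); first exact: sub_onbU.
    by move=> _ [r [rB str] <-]; split; exists r => //; split => // x xs;
      apply: str; rewrite mem_undup mem_cat xs ?orbT.
  by move=> s sB; exists (fourier s u); exists s => //; split.
have near_sup (d : R) : 0 < d -> exists2 s, sub_onb s & forall t, sub_onb t ->
    {subset s <= t} -> rnorm (fourier t u - fourier s u) < d.
  move=> d0; have d20 : 0 < d ^+ 2 by rewrite exprn_gt0.
  have [_ [s sB <-] gs] := sup_adherent d20 supS.
  exists s => // t tB st.
  rewrite -(@ltr_pXn2r _ 2)// ?nnegrE ?rnorm_ge0// ?ltW//.
  have -> : rnorm (fourier t u - fourier s u) ^+ 2 = g t - g s.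
    apply: (@complexI R); rewrite rmorphXn/= rnormE fourier_sub//.
    by rewrite rmorphB/= !gE.
  have : g t <= sup S by apply: ub_le_sup; [exact: supS.2|exists t].
  lra.
have cF : cvg F.
  apply: cauchy_cvg; apply: cauchy_exP => eps eps0.
  have epsE : (complex.Re eps)%:C%C = eps by rewrite RRe_real// gtr0_real.
  have [|s sB hs] := near_sup (complex.Re eps); first by rewrite -(ltcR 0) epsE.
  exists (fourier s u); exists s => // _ [t [tB st] <-].
  rewrite -ball_normE/= -rnormE rnormB -epsE ltcR; exact: hs.
have /cvg_ex [y Fy] := cF.
have near_y (d : R) s : 0 < d -> sub_onb s ->
    exists t, [/\ sub_onb t, {subset s <= t} & rnorm (y - fourier t u) < d].
  move=> d0 sB.
  have : F (ball y d%:C%C) by apply: Fy; apply: nbhsx_ballx; rewrite (ltcR 0).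
  move=> [s' s'B hs'].
  exists (undup (s ++ s')).
  have st : {subset s <= undup (s ++ s')} /\ {subset s' <= undup (s ++ s')}.
    by split => x xs; rewrite mem_undup mem_cat xs ?orbT.
  split; [exact: sub_onbU|exact: st.1|].
  have := hs' (fourier (undup (s ++ s')) u).
  rewrite -ball_normE/= -rnormE ltcR; apply.
  by exists (undup (s ++ s')) => //; split; [exact: sub_onbU|exact: st.2].
have yu : y = u.
  apply/eqP; rewrite -subr_eq0; apply/eqP; apply: (@onbP _ H).2 => x Bx.
  apply: rnorm_eq0; apply/eqP; rewrite eq_le rnorm_ge0 andbT.
  apply/ler_addgt0Pr => d d0; rewrite add0r.
  have xB : sub_onb [:: x] by split => // z; rewrite inE => /eqP ->.
  have [t [tB xt yt]] := near_y _ _ d0 xB.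
  have xt' : x \in t by apply: xt; rewrite inE.
  have -> : inner (y - u) x = inner (y - fourier t u) x.
    by rewrite !innerBl inner_fourier// xt' mul1r.
  apply: le_trans (ltW yt).
  rewrite -lecR !rnormE (le_trans (inner_CS _ _))//.
  suff -> : `|x| = 1 by rewrite mulr1.
  have : `|x| ^+ 2 = 1 by rewrite normr_inner (@onbP _ H).1// eqxx.
  by move=> /eqP; rewrite sqrp_eq1// => /eqP.
by have [t [tB _]] := near_y _ _ e0 nil_ok; rewrite yu; exists t.
Qed.

End Density.

Definition bounded_operator (C : numFieldType) (V W : normedModType C)
    (A : V -> W) :=
  linear A /\ exists M : C, forall u, `|A u| <= M * `|u|.

Section BoundedOperator.
Variables (C : numFieldType) (V W : normedModType C).
Implicit Types (A : V -> W).

Lemma bounded_operatorZD A (a : C) u v :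
  bounded_operator A -> A (a *: u + v) = a *: A u + A v.
Proof. by move=> [lA _]; exact: lA. Qed.

Lemma bounded_operator0 A : bounded_operator A -> A 0 = 0.
Proof.
move=> bA; have := bounded_operatorZD (-1) 0 0 bA.
by rewrite !scaleN1r oppr0 addr0 addNr.
Qed.

Lemma bounded_operatorD A u v : bounded_operator A -> A (u + v) = A u + A v.
Proof. by move=> /(bounded_operatorZD 1 u v); rewrite !scale1r. Qed.

Lemma bounded_operatorZ A (a : C) u : bounded_operator A -> A (a *: u) = a *: A u.
Proof.
move=> bA; have := bounded_operatorZD a u 0 bA.
by rewrite bounded_operator0// !addr0.
Qed.

Lemma bounded_operator_sum A (I : Type) (r : seq I) (F : I -> V) :
  bounded_operator A -> A (\sum_(i <- r) F i) = \sum_(i <- r) A (F i).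
Proof.
move=> bA; elim: r => [|i r IH]; first by rewrite !big_nil bounded_operator0.
by rewrite !big_cons bounded_operatorD// IH.
Qed.

End BoundedOperator.

Section RealSums.
Variables (R : realType).

Lemma sumCS (T : Type) (s : seq T) (a b : T -> R) :
  (\sum_(i <- s) a i * b i) ^+ 2 <=
  (\sum_(i <- s) a i ^+ 2) * (\sum_(i <- s) b i ^+ 2).
Proof.
elim: s => [|i s IH]; first by rewrite !big_nil expr0n/= mul0r.
rewrite !big_cons.
have X0 : 0 <= \sum_(j <- s) a j ^+ 2 by apply: sumr_ge0 => j _; rewrite sqr_ge0.
have Y0 : 0 <= \sum_(j <- s) b j ^+ 2 by apply: sumr_ge0 => j _; rewrite sqr_ge0.
move: IH X0 Y0.
set x := \sum_(j <- s) a j * b j; set X := \sum_(j <- s) a j ^+ 2.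
set Y := \sum_(j <- s) b j ^+ 2; move: (a i) (b i) => p q IH X0 Y0.
have z0 : 0 <= p ^+ 2 * Y + X * q ^+ 2 by rewrite addr_ge0// mulr_ge0// sqr_ge0.
suff : 2 * (p * q * x) <= p ^+ 2 * Y + X * q ^+ 2 by nra.
rewrite (le_trans (ler_norm _))// -(@ler_pXn2r _ 2)// ?nnegrE//.
rewrite real_normK ?num_real//.
have : 4 * (p ^+ 2 * q ^+ 2) * x ^+ 2 <= 4 * (p ^+ 2 * q ^+ 2) * (X * Y).
  by rewrite ler_wpM2l// mulr_ge0// mulr_ge0// sqr_ge0.
have := sqr_ge0 (p ^+ 2 * Y - X * q ^+ 2); nra.
Qed.

Variables (T : choiceType) (B : set T).
Implicit Types (f g h : T -> R).

(* The sum of f over B, for an absolutely summable f. *)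
Definition rsum f : R :=
  fine (\esum_(e in B) (Num.max (f e) 0)%:E)
  - fine (\esum_(e in B) (Num.max (- f e) 0)%:E).

Definition rsummable f := (\esum_(e in B) `|f e|%:E < +oo)%E.

Lemma esum_le_fin f g : (forall e, B e -> f e <= g e) ->
  (\esum_(e in B) (g e)%:E < +oo)%E -> (\esum_(e in B) (f e)%:E < +oo)%E.
Proof.
move=> fg; apply: le_lt_trans; apply: le_esum => e Be.
by rewrite lee_fin fg.
Qed.

Lemma esum_finD f g : (forall e, B e -> 0 <= f e) -> (forall e, B e -> 0 <= g e) ->
  (\esum_(e in B) (f e)%:E < +oo)%E -> (\esum_(e in B) (g e)%:E < +oo)%E ->
  (\esum_(e in B) (f e + g e)%:E < +oo)%E.
Proof.
move=> f0 g0 ff gf; under eq_esum do rewrite EFinD.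
by rewrite esumD ?lte_add_pinfty// => e Be; rewrite lee_fin ?f0 ?g0.
Qed.

Lemma esum_fin_num f : (forall e, B e -> 0 <= f e) ->
  (\esum_(e in B) (f e)%:E < +oo)%E -> (\esum_(e in B) (f e)%:E)%E \is a fin_num.
Proof.
move=> f0 ff; rewrite ge0_fin_numE//; apply: esum_ge0 => e Be.
by rewrite lee_fin f0.
Qed.

Lemma fine_esumD f g : (forall e, B e -> 0 <= f e) -> (forall e, B e -> 0 <= g e) ->
  (\esum_(e in B) (f e)%:E < +oo)%E -> (\esum_(e in B) (g e)%:E < +oo)%E ->
  fine (\esum_(e in B) (f e + g e)%:E) =
  fine (\esum_(e in B) (f e)%:E) + fine (\esum_(e in B) (g e)%:E).
Proof.
move=> f0 g0 ff gf; under eq_esum do rewrite EFinD.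
rewrite esumD ?fineD ?esum_fin_num// => e Be; rewrite lee_fin ?f0 ?g0//.
Qed.

Lemma esum_le_sum f (M : R) :
  (forall s : seq T, uniq s -> (forall e, e \in s -> B e) ->
     \sum_(e <- s) f e <= M) ->
  (\esum_(e in B) (f e)%:E <= M%:E)%E.
Proof.
move=> h; apply: ge_ereal_sup => _ [X [finX XB] <-].
rewrite fsbig_finite//= sumEFin lee_fin; apply: h => // e.
by rewrite in_fset_set// inE => /XB.
Qed.

Lemma sum_le_esum f (s : seq T) : uniq s -> (forall e, e \in s -> B e) ->
  ((\sum_(e <- s) f e)%:E <= \esum_(e in B) (f e)%:E)%E.
Proof.
move=> us sB; apply: esum_ge; exists [set` s].
  by split; [exact: finite_seq|move=> e /= /sB].
by rewrite -fsbig_seq// sumEFin.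
Qed.

Lemma sum_le_fine_esum f (s : seq T) : (forall e, B e -> 0 <= f e) ->
  (\esum_(e in B) (f e)%:E < +oo)%E ->
  uniq s -> (forall e, e \in s -> B e) ->
  \sum_(e <- s) f e <= fine (\esum_(e in B) (f e)%:E).
Proof.
by move=> f0 ff us sB; rewrite -lee_fin fineK ?esum_fin_num//; exact: sum_le_esum.
Qed.

Lemma fine_esum_ge0 f : (forall e, B e -> 0 <= f e) ->
  0 <= fine (\esum_(e in B) (f e)%:E).
Proof. by move=> f0; apply: fine_ge0; apply: esum_ge0 => e Be; rewrite lee_fin f0. Qed.

Lemma esum_finZ (a : R) f : 0 <= a -> (forall e, B e -> 0 <= f e) ->
  (\esum_(e in B) (f e)%:E < +oo)%E ->
  (\esum_(e in B) (a * f e)%:E <= (a * fine (\esum_(e in B) (f e)%:E))%:E)%E.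
Proof.
move=> a0 f0 ff; apply: esum_le_sum => s us sB.
by rewrite -mulr_sumr ler_wpM2l// sum_le_fine_esum.
Qed.

Lemma fine_esumZ (a : R) f : 0 <= a -> (forall e, B e -> 0 <= f e) ->
  (\esum_(e in B) (f e)%:E < +oo)%E ->
  fine (\esum_(e in B) (a * f e)%:E) = a * fine (\esum_(e in B) (f e)%:E).
Proof.
move=> a0 f0 ff.
have af0 e : B e -> 0 <= a * f e by move=> Be; rewrite mulr_ge0// f0.
have aff : (\esum_(e in B) (a * f e)%:E < +oo)%E.
  by rewrite (le_lt_trans (esum_finZ a0 f0 ff))// ltry.
apply/eqP; rewrite eq_le; apply/andP; split.
  by rewrite -lee_fin fineK ?esum_fin_num//; exact: esum_finZ.
have [->|an0] := eqVneq a 0; first by rewrite mul0r fine_esum_ge0// => e Be; rewrite mul0r.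
have agt0 : 0 < a by rewrite lt_neqAle eq_sym an0.
rewrite -ler_pdivlMl// -lee_fin fineK ?esum_fin_num//.
apply: esum_le_sum => s us sB.
by rewrite ler_pdivlMl// mulr_sumr sum_le_fine_esum.
Qed.

Lemma rsummable_pos f : rsummable f ->
  (\esum_(e in B) (Num.max (f e) 0)%:E < +oo)%E.
Proof. by apply: esum_le_fin => e _; rewrite ge_max ler_norm normr_ge0. Qed.

Lemma rsummable_neg f : rsummable f ->
  (\esum_(e in B) (Num.max (- f e) 0)%:E < +oo)%E.
Proof. by apply: esum_le_fin => e _; rewrite ge_max -normrN ler_norm normr_ge0. Qed.

Lemma max0_ge0 (x : R) : 0 <= Num.max x 0.
Proof. by rewrite le_max lexx orbT. Qed.
Hint Resolve max0_ge0 : core.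

Lemma max0B (x : R) : x = Num.max x 0 - Num.max (- x) 0.
Proof.
have /orP[x0|x0] := le_total 0 x.
  by rewrite max_l// max_r ?subr0// oppr_le0.
by rewrite max_r// max_l ?oppr_ge0// sub0r opprK.
Qed.

Lemma rsumE f g h : (forall e, B e -> 0 <= g e) -> (forall e, B e -> 0 <= h e) ->
  (\esum_(e in B) (g e)%:E < +oo)%E -> (\esum_(e in B) (h e)%:E < +oo)%E ->
  (forall e, B e -> f e = g e - h e) ->
  rsum f = fine (\esum_(e in B) (g e)%:E) - fine (\esum_(e in B) (h e)%:E).
Proof.
move=> g0 h0 gf hf fE.
have pf : (\esum_(e in B) (Num.max (f e) 0)%:E < +oo)%E.
  by apply: esum_le_fin gf => e Be; rewrite ge_max g0// fE// gerBl h0.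
have nf : (\esum_(e in B) (Num.max (- f e) 0)%:E < +oo)%E.
  by apply: esum_le_fin hf => e Be; rewrite ge_max h0// fE// opprB gerBl g0.
have : fine (\esum_(e in B) (Num.max (f e) 0 + h e)%:E) =
       fine (\esum_(e in B) (g e + Num.max (- f e) 0)%:E).
  congr fine; apply: eq_esum => e Be; congr EFin.
  by have := max0B (f e); rewrite {1}fE//; lra.
rewrite !fine_esumD// /rsum; lra.
Qed.

Lemma rsumD f g : rsummable f -> rsummable g ->
  rsum (fun e => f e + g e) = rsum f + rsum g.
Proof.
move=> sf sg.
have pf := rsummable_pos sf; have nf := rsummable_neg sf.
have pg := rsummable_pos sg; have ng := rsummable_neg sg.
rewrite (@rsumE _ (fun e => Num.max (f e) 0 + Num.max (g e) 0)
   (fun e => Num.max (- f e) 0 + Num.max (- g e) 0)).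
- rewrite !fine_esumD// /rsum; lra.
- by move=> e _; rewrite addr_ge0.
- by move=> e _; rewrite addr_ge0.
- exact: esum_finD.
- exact: esum_finD.
- move=> e _; have := max0B (f e); have := max0B (g e); lra.
Qed.

Lemma rsumN f : rsum (fun e => - f e) = - rsum f.
Proof.
rewrite /rsum opprB; congr (fine _ - _).
by congr (fine _); apply: eq_esum => e _; rewrite opprK.
Qed.

Lemma rsumZ a f : rsummable f -> rsum (fun e => a * f e) = a * rsum f.
Proof.
move=> sf.
have pf := rsummable_pos sf; have nf := rsummable_neg sf.
have pos (b : R) : 0 <= b -> rsum (fun e => b * f e) = b * rsum f.
  move=> b0; rewrite (@rsumE _ (fun e => b * Num.max (f e) 0)
    (fun e => b * Num.max (- f e) 0)).
  - by rewrite !fine_esumZ// -mulrBr.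
  - by move=> e _; rewrite mulr_ge0.
  - by move=> e _; rewrite mulr_ge0.
  - apply: (le_lt_trans (esum_finZ b0 _ pf)) => //.
    by rewrite ltry.
  - apply: (le_lt_trans (esum_finZ b0 _ nf)) => //.
    by rewrite ltry.
  - by move=> e _; rewrite -mulrBr -max0B.
have [/pos//|a0] := leP 0 a.
rewrite -[a]opprK -(opprK (- - a)) opprK mulNr -pos ?oppr_ge0 ?ltW//.
by rewrite -rsumN; congr rsum; apply: funext => e; rewrite mulNr.
Qed.

Lemma eq_rsum f g : (forall e, B e -> f e = g e) -> rsum f = rsum g.
Proof.
by move=> fg; rewrite /rsum; congr (fine _ - fine _); apply: eq_esum => e Be;
  rewrite fg.
Qed.

Lemma rsum_ge0E f : (forall e, B e -> 0 <= f e) ->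
  rsum f = fine (\esum_(e in B) (f e)%:E).
Proof.
move=> f0; rewrite /rsum [X in _ - fine X]esum1 ?subr0; last first.
  by move=> e Be; rewrite max_r// oppr_le0 f0.
by congr fine; apply: eq_esum => e Be; rewrite max_l// f0.
Qed.

End RealSums.

Section HilbertSchmidt.
Variables (R : realType) (H : hilbertType R[i]).
Implicit Types (A K L : H -> H) (u v e : H).

Definition hilbert_schmidt A :=
  bounded_operator A /\
  (\esum_(e in onb H) (rnorm (A e) ^+ 2)%:E < +oo)%E.

(* \sum_(e in onb H) inner (A e) (L e) *)
Definition hs_inner A L : R[i] :=
  Complex (rsum (onb H) (fun e => complex.Re (inner (A e) (L e))))
          (rsum (onb H) (fun e => complex.Im (inner (A e) (L e)))).

Definition hs_sq A : R := fine (\esum_(e in onb H) (rnorm (A e) ^+ 2)%:E).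

Let sq0 A e : onb H e -> 0 <= rnorm (A e) ^+ 2.
Proof. by move=> _; rewrite sqr_ge0. Qed.

Lemma hs_sq_ge0 A : 0 <= hs_sq A.
Proof. exact: fine_esum_ge0 (@sq0 A). Qed.

Lemma bounded_operator_hs A : bounded_operator A ->
  forall M : R, (forall s : seq H, sub_onb s -> \sum_(e <- s) rnorm (A e) ^+ 2 <= M) ->
  hilbert_schmidt A /\ hs_sq A <= M.
Proof.
move=> bA M h.
have le : (\esum_(e in onb H) (rnorm (A e) ^+ 2)%:E <= M%:E)%E.
  by apply: esum_le_sum => s us sB; apply: h; split.
have fin : (\esum_(e in onb H) (rnorm (A e) ^+ 2)%:E < +oo)%E.
  by rewrite (le_lt_trans le)// ltry.
by split=> //; rewrite -lee_fin /hs_sq fineK//; exact: esum_fin_num (@sq0 A) fin.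
Qed.

Lemma sum_le_hs_sq A s : hilbert_schmidt A -> sub_onb s ->
  \sum_(e <- s) rnorm (A e) ^+ 2 <= hs_sq A.
Proof. by move=> [_ fA] [us sB]; exact: sum_le_fine_esum (@sq0 A) fA us sB. Qed.

Lemma rnorm_sum (s : seq H) (F : H -> H) :
  rnorm (\sum_(e <- s) F e) <= \sum_(e <- s) rnorm (F e).
Proof.
elim: s => [|x s IH]; first by rewrite !big_nil rnorm0.
by rewrite !big_cons (le_trans (rnormD _ _))// lerD2l.
Qed.

Lemma hs_fourier A s u : hilbert_schmidt A -> sub_onb s ->
  rnorm (A (fourier s u)) <= rnorm u * Num.sqrt (hs_sq A).
Proof.
move=> hA sB; have [bA _] := hA.
rewrite /fourier bounded_operator_sum//.
apply: le_trans (rnorm_sum _ _) _.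
rewrite (eq_bigr (fun e => rnorm (inner u e) * rnorm (A e))); last first.
  by move=> e _; rewrite bounded_operatorZ// rnormZ.
rewrite -(@ler_pXn2r _ 2)// ?nnegrE ?mulr_ge0 ?rnorm_ge0 ?sqrtr_ge0//; last first.
  by apply: sumr_ge0 => e _; rewrite mulr_ge0 ?rnorm_ge0.
apply: le_trans (sumCS _ _ _) _.
rewrite exprMn sqr_sqrtr ?hs_sq_ge0//; apply: ler_pM.
- by apply: sumr_ge0 => e _; rewrite sqr_ge0.
- by apply: sumr_ge0 => e _; rewrite sqr_ge0.
- rewrite -lecR rmorph_sum/= rmorphXn/= rnormE.
  under eq_bigr => e _ do rewrite rmorphXn/= rnormE.
  exact: bessel.
- exact: sum_le_hs_sq.
Qed.

Lemma bounded_rnorm A : bounded_operator A ->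
  exists2 M : R, 0 <= M & forall u, rnorm (A u) <= M * rnorm u.
Proof.
move=> [_ [M hM]].
have [m m0 mE] : exists2 m : R, 0 <= m & m%:C%C = `|M|.
  by exists (rnorm (M : R[i])); [exact: rnorm_ge0|exact: rnormE].
exists m => // u; rewrite -lecR rmorphM/= !rnormE mE.
apply: le_trans (hM u) _.
have [/eqP ->|u0] := boolP (`|u| == 0); first by rewrite !mulr0.
have u_gt0 : 0 < `|u| by rewrite lt_neqAle eq_sym u0 normr_ge0.
rewrite ler_pM2r// real_ler_norm//.
have : 0 <= M * `|u| by exact: le_trans (normr_ge0 _) (hM u).
by rewrite pmulr_lge0// => /ger0_real.
Qed.

Lemma hs_norm_le A u : hilbert_schmidt A ->
  rnorm (A u) <= rnorm u * Num.sqrt (hs_sq A).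
Proof.
move=> hA; have [bA _] := hA; have [M M0 hM] := bounded_rnorm bA.
apply/ler_addgt0Pr => d d0.
have d'0 : 0 < d / (M + 1) by rewrite divr_gt0// ltr_wpDl.
have [s [sB hs]] := fourier_dense u d'0.
have -> : A u = A (fourier s u) + A (u - fourier s u).
  by rewrite -bounded_operatorD// addrC subrK.
apply: le_trans (rnormD _ _) _.
apply: lerD; first exact: hs_fourier.
apply: le_trans (hM _) _.
apply: (@le_trans _ _ (M * (d / (M + 1)))); first by rewrite ler_wpM2l// ltW.
rewrite mulrA ler_pdivrMr ?ltr_wpDl//; nra.
Qed.

Lemma hs_rsummable (P : R[i] -> R) A L : (forall z, `|P z| <= rnorm z) ->
  hilbert_schmidt A -> hilbert_schmidt L ->
  rsummable (onb H) (fun e => P (inner (A e) (L e))).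
Proof.
move=> hP [_ fA] [_ fL].
apply: esum_le_fin (esum_finD (@sq0 A) (@sq0 L) fA fL) => e _.
apply: le_trans (hP _) _.
have : rnorm (inner (A e) (L e)) <= rnorm (A e) * rnorm (L e).
  by rewrite -lecR rmorphM/= !rnormE inner_CS.
have := rnorm_ge0 (A e); have := rnorm_ge0 (L e); nra.
Qed.

Lemma Re_le (z : R[i]) : `|complex.Re z| <= rnorm z.
Proof. by rewrite -lecR rnormE normc_ge_Re. Qed.

Lemma Im_le (z : R[i]) : `|complex.Im z| <= rnorm z.
Proof.
rewrite -lecR rnormE; have -> : complex.Im z = complex.Re (- ('i%C * z)) by case: z => a b /=; ring.
apply: le_trans (normc_ge_Re _) _.
by rewrite normrN normrM complexiE normCi mul1r.
Qed.


Lemma conjCE (a b : R) : (Complex a b)^* = Complex a (- b).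
Proof. by []. Qed.

Lemma rnorm_sqD u v : rnorm (u + v) ^+ 2 <= 2 * rnorm u ^+ 2 + 2 * rnorm v ^+ 2.
Proof.
have := rnormD u v; have := rnorm_ge0 (u + v).
have := rnorm_ge0 u; have := rnorm_ge0 v.
have := sqr_ge0 (rnorm u - rnorm v); nra.
Qed.

Lemma bounded_operator_lin A L (a : R[i]) : bounded_operator A ->
  bounded_operator L -> bounded_operator (fun u => a *: A u + L u).
Proof.
move=> [lA [M hM]] [lL [N hN]]; split.
  move=> b u v /=; rewrite lA lL !scalerDr !scalerA (mulrC a) addrACA.
  by rewrite -!scalerA -scalerDr.
exists (`|a| * M + N) => u.
rewrite (le_trans (ler_normD _ _))// mulrDl lerD// normrZ -mulrA.
by rewrite ler_wpM2l.
Qed.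

Lemma hilbert_schmidt_lin A L (a : R[i]) : hilbert_schmidt A ->
  hilbert_schmidt L -> hilbert_schmidt (fun u => a *: A u + L u).
Proof.
move=> [bA fA] [bL fL]; split; first exact: bounded_operator_lin.
set c := complex.Re `|a|.
have c0 : 0 <= 2 * c ^+ 2 by rewrite mulr_ge0// sqr_ge0.
have f1 : (\esum_(e in onb H) (2 * c ^+ 2 * rnorm (A e) ^+ 2)%:E < +oo)%E.
  by rewrite (le_lt_trans (esum_finZ c0 (@sq0 A) fA))// ltry.
have f2 : (\esum_(e in onb H) (2 * rnorm (L e) ^+ 2)%:E < +oo)%E.
  by rewrite (le_lt_trans (esum_finZ _ (@sq0 L) fL))// ltry.
apply: esum_le_fin (esum_finD _ _ f1 f2) => e _.
- apply: le_trans (rnorm_sqD _ _) _.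
  by rewrite rnormZ exprMn mulrA.
- by rewrite mulr_ge0// sqr_ge0.
- by rewrite mulr_ge0// sqr_ge0.
Qed.

Lemma hilbert_schmidt0 : hilbert_schmidt (fun=> 0).
Proof.
split.
  split; first by move=> a u v; rewrite scaler0 addr0.
  by exists 0 => u; rewrite normr0 mul0r.
by under eq_esum do rewrite rnorm0 expr0n/=; rewrite esum1.
Qed.

Lemma hs_innerZDl (a : R[i]) A K L : hilbert_schmidt A -> hilbert_schmidt K ->
  hilbert_schmidt L ->
  hs_inner (fun u => a *: A u + K u) L = a * hs_inner A L + hs_inner K L.
Proof.
move=> hA hK hL; case: a => x y.
have rAL := hs_rsummable Re_le hA hL; have iAL := hs_rsummable Im_le hA hL.
have rKL := hs_rsummable Re_le hK hL; have iKL := hs_rsummable Im_le hK hL.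
have hxyA : hilbert_schmidt (fun u => Complex x y *: A u).
  have := hilbert_schmidt_lin (Complex x y) hA hilbert_schmidt0.
  by congr hilbert_schmidt; apply: funext => u; rewrite addr0.
have rxAL := hs_rsummable Re_le hxyA hL; have ixAL := hs_rsummable Im_le hxyA hL.
have sZ (f : H -> R) (b : R) : rsummable (onb H) f -> rsummable (onb H) (fun e => b * f e).
  move=> sf; apply: (@esum_le_fin _ _ _ _ (fun e => `|b| * `|f e|)).
    by move=> e _; rewrite normrM.
  by rewrite (le_lt_trans (esum_finZ _ _ sf))// ltry.
rewrite /hs_inner /=; apply/eqP; rewrite eq_complex/=; apply/andP; split; apply/eqP.
- rewrite (@eq_rsum _ _ _ _ (fun e =>
    (x * complex.Re (inner (A e) (L e)) + (- y) * complex.Im (inner (A e) (L e)))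
     + complex.Re (inner (K e) (L e)))); last first.
    move=> e _; rewrite innerDl innerZl.
    by case: (inner (A e) (L e)) => p q; case: (inner (K e) (L e)) => r t /=; ring.
  rewrite rsumD//; last first.
    have := rxAL; congr rsummable; apply: funext => e; rewrite innerZl.
    by case: (inner (A e) (L e)) => p q /=; ring.
  by rewrite rsumD ?sZ// !rsumZ// mulNr.
- rewrite (@eq_rsum _ _ _ _ (fun e =>
    (x * complex.Im (inner (A e) (L e)) + y * complex.Re (inner (A e) (L e)))
     + complex.Im (inner (K e) (L e)))); last first.
    move=> e _; rewrite innerDl innerZl.
    by case: (inner (A e) (L e)) => p q; case: (inner (K e) (L e)) => r t /=; ring.
  rewrite rsumD//; last first.
    have := ixAL; congr rsummable; apply: funext => e; rewrite innerZl.
    by case: (inner (A e) (L e)) => p q /=; ring.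
  by rewrite rsumD ?sZ// !rsumZ.
Qed.

Lemma hs_inner0l L : hs_inner (fun=> 0) L = 0.
Proof.
rewrite /hs_inner; congr Complex; rewrite rsum_ge0E ?esum1//;
  by move=> e _; rewrite inner0l.
Qed.

Lemma hs_inner_conj A L : hs_inner A L = (hs_inner L A)^*.
Proof.
rewrite /hs_inner conjCE -rsumN; congr Complex; apply: eq_rsum => e _;
  rewrite inner_conj; case: (inner (L e) (A e)) => a b //.
Qed.

Lemma hs_inner_self A : hs_inner A A = (hs_sq A)%:C%C.
Proof.
have h e : inner (A e) (A e) = (rnorm (A e) ^+ 2)%:C%C.
  by rewrite -normr_inner rmorphXn/= rnormE.
rewrite /hs_inner; congr Complex.
  rewrite rsum_ge0E; last by move=> e _; rewrite h sqr_ge0.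
  by congr fine; apply: eq_esum => e _; rewrite h.
rewrite rsum_ge0E; last by move=> e _; rewrite h.
by rewrite esum1// => e _; rewrite h.
Qed.

Lemma hs_sq_eq0 A : hilbert_schmidt A -> hs_sq A = 0 -> A = fun=> 0.
Proof.
move=> hA A0; apply: funext => u; apply: rnorm_eq0; apply/eqP.
rewrite eq_le rnorm_ge0 andbT; have := hs_norm_le u hA.
by rewrite A0 sqrtr0 mulr0.
Qed.

End HilbertSchmidt.

Definition hs_pred (R : realType) (H : hilbertType R[i]) : {pred H -> H} :=
  fun A => `[< hilbert_schmidt A >].

Record hsType (R : realType) (H : hilbertType R[i]) := HS {
  hs_val :> H -> H;
  hs_valP : hs_val \in @hs_pred R H }.

Section HsSpace.
Variables (R : realType) (H : hilbertType R[i]).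

HB.instance Definition _ := [isSub of hsType H for @hs_val R H].
HB.instance Definition _ := [Choice of hsType H by <:].

Lemma hs_submod_closed : GRing.submod_closed (@hs_pred R H).
Proof.
split; first exact/asboolP/hilbert_schmidt0.
by move=> a A L /asboolP hA /asboolP hL; exact/asboolP/hilbert_schmidt_lin.
Qed.

HB.instance Definition _ :=
  GRing.isSubmodClosed.Build R[i] (H -> H) (@hs_pred R H) hs_submod_closed.
HB.instance Definition _ := [SubChoice_isSubLmodule of hsType H by <:].

Lemma hsP (A : hsType H) : hilbert_schmidt A.
Proof. exact/asboolP/hs_valP. Qed.

Definition hs_of (A : H -> H) (hA : hilbert_schmidt A) : hsType H :=
  HS (asboolT hA).

Definition hs_dot (A L : hsType H) : R[i] := hs_inner A L.

Lemma hs_valD (A L : hsType H) : hs_val (A + L) = fun u => A u + L u.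
Proof. by []. Qed.

Lemma hs_valZ (a : R[i]) (A : hsType H) : hs_val (a *: A) = fun u => a *: A u.
Proof. by []. Qed.

Lemma hs_dotD A K L : hs_dot (A + K) L = hs_dot A L + hs_dot K L.
Proof.
have E : hs_val (A + K) = fun u => 1 *: A u + K u.
  by rewrite hs_valD; apply: funext => u; rewrite scale1r.
rewrite /hs_dot E.
apply: etrans (hs_innerZDl 1 (hsP A) (hsP K) (hsP L)) _.
exact: (congr1 (fun z => z + hs_inner K L) (mul1r _)).
Qed.

Lemma hs_dotZ (a : R[i]) A L : hs_dot (a *: A) L = a * hs_dot A L.
Proof.
have E : hs_val (a *: A) = fun u => a *: A u + 0.
  by rewrite hs_valZ; apply: funext => u; rewrite addr0.
rewrite /hs_dot E.
apply: etrans (hs_innerZDl a (hsP A) (@hilbert_schmidt0 R H) (hsP L)) _.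
apply: etrans (congr1 (fun z => _ + z) (hs_inner0l L)) _.
exact: addr0.
Qed.

Lemma hs_dot_conj A L : hs_dot A L = (hs_dot L A)^*.
Proof. exact: hs_inner_conj. Qed.

Lemma hs_dot_ge0 A : 0 <= hs_dot A A.
Proof. by rewrite /hs_dot hs_inner_self ler0c hs_sq_ge0. Qed.

Lemma hs_dot_eq0 A : hs_dot A A = 0 -> A = 0.
Proof.
rewrite /hs_dot hs_inner_self => /(@complexI R) /(hs_sq_eq0 (hsP A)) A0.
by apply: val_inj.
Qed.

HB.instance Definition _ := Lmodule_isNormed.Build R[i] (hsType H)
  (pre_normD hs_dotD hs_dotZ hs_dot_conj hs_dot_ge0 hs_dot_eq0)
  (pre_normZ hs_dotZ hs_dot_conj hs_dot_ge0)
  (pre_norm_eq0 hs_dot_eq0).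

Lemma hs_normE (A : hsType H) : `|A| ^+ 2 = hs_dot A A.
Proof. by rewrite -[LHS]/(pre_norm hs_dot A ^+ 2) sqrtCK. Qed.

Lemma hs_rnormE (A : hsType H) : rnorm A ^+ 2 = hs_sq A.
Proof.
by apply: (@complexI R); rewrite rmorphXn/= rnormE hs_normE -hs_inner_self.
Qed.

Lemma hs_op_norm (A : hsType H) u : rnorm (A u) <= rnorm A * rnorm u.
Proof.
have := hs_norm_le u (hsP A).
by rewrite -hs_rnormE sqrtr_sqr ger0_norm ?rnorm_ge0// mulrC.
Qed.

Lemma hs_complete (F : set_system (hsType H)) :
  ProperFilter F -> cauchy F -> cvg F.
Proof.
move=> FF Fc.
have re (eps : R[i]) : 0 < eps -> (complex.Re eps)%:C%C = eps.
  by move=> e0; rewrite RRe_real// gtr0_real.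
have Fe (d : R) : 0 < d -> exists A0, \forall A \near F, rnorm (A0 - A) < d.
  move=> d0; have /cauchyP Fex := Fc.
  have [|A0 hA0] := Fex d%:C%C; first by rewrite (ltcR 0).
  exists A0; apply: filterS hA0 => A.
  by rewrite -ball_normE/= -rnormE ltcR.
have cu u : cvg ((fun A : hsType H => A u) @ F).
  apply: cauchy_cvg; apply: cauchy_exP => eps eps0.
  have r0 : 0 < complex.Re eps by rewrite -ltcR re.
  have d0 : 0 < complex.Re eps / (rnorm u + 1).
    by rewrite divr_gt0// ltr_wpDl// rnorm_ge0.
  have [A0 hA0] := Fe _ d0.
  exists (A0 u); apply: filterS hA0 => A hA.
  rewrite -ball_normE/= -rnormE -(re eps)// ltcR.
  apply: le_lt_trans (hs_op_norm (A0 - A) u) _.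
  move: hA; rewrite ltr_pdivlMr ?ltr_wpDl ?rnorm_ge0//.
  by apply: le_lt_trans; rewrite ler_wpM2l ?rnorm_ge0// lerDl.
pose A u := lim ((fun A : hsType H => A u) @ F).
have Au u (d : R) : 0 < d -> \forall K \near F, rnorm (A u - hs_val K u) < d.
  move=> d0; have : F [set K | ball (A u) d%:C%C (K u)].
    by apply: (cu u); apply: nbhsx_ballx; rewrite (ltcR 0).
  by apply: filterS => K; rewrite -ball_normE/= -rnormE ltcR.
have eq0P (v : H) : (forall d : R, 0 < d -> rnorm v < d) -> v = 0.
  move=> h; apply: rnorm_eq0; apply/eqP; rewrite eq_le rnorm_ge0 andbT.
  by apply/ler_addgt0Pr => d d0; rewrite add0r ltW// h.
have linA : linear A.
  move=> a u v; apply/eqP; rewrite -subr_eq0; apply/eqP; apply: eq0P => d d0.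
  set c := complex.Re `|a|.
  have c0 : 0 <= c by rewrite /c -ler0c RRe_real// ger0_real.
  have e0 : 0 < d / (c + 2) by rewrite divr_gt0// ltr_wpDl.
  have : \forall K \near F, [/\ rnorm (A (a *: u + v) - hs_val K (a *: u + v)) < d / (c + 2),
     rnorm (A u - hs_val K u) < d / (c + 2) & rnorm (A v - hs_val K v) < d / (c + 2)].
    by near=> K; split; near: K; exact: Au.
  move=> /filter_ex [K [h1 h2 h3]].
  have -> : A (a *: u + v) - (a *: A u + A v) =
    (A (a *: u + v) - K (a *: u + v)) + (- (a *: (A u - K u)) + - (A v - K v)).
    have [[-> _] _] := hsP K.
    by rewrite scalerBr !opprB (addrACA (a *: K u)) -opprD addrA subrK.
  apply: le_lt_trans (rnormD _ _) _.
  apply: le_lt_trans (lerD (lexx _) (rnormD _ _)) _.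
  rewrite !rnormN rnormZ -/c.
  have -> : d = d / (c + 2) + (c * (d / (c + 2)) + d / (c + 2)).
    by field; rewrite gt_eqF// ltr_wpDl.
  by rewrite ltrD// ler_ltD// ler_wpM2l// ltW.
have close (d : R) : 0 < d -> exists A0 : hsType H,
    [/\ \forall K \near F, rnorm (A0 - K) < d,
     hilbert_schmidt (fun u => A u - A0 u) & hs_sq (fun u => A u - A0 u) <= d ^+ 2].
  move=> d0; have [A0 hA0] := Fe _ d0; exists A0.
  suff : hilbert_schmidt (fun u => A u - A0 u) /\ hs_sq (fun u => A u - A0 u) <= d ^+ 2.
    by case.
  have bA u : rnorm (A u - A0 u) <= d * rnorm u.
    apply/ler_addgt0Pr => x x0.
    have [K [h1 h2]] := filter_ex (@filterI _ F _ _ _ hA0 (Au u _ x0)).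
    have -> : A u - A0 u = - (A0 - K) u + (A u - K u).
      by rewrite -[(A0 - K) u]/(A0 u - K u) opprB [RHS]addrC addrA subrK.
    apply: le_trans (rnormD _ _) _; rewrite rnormN.
    apply: lerD; last exact: ltW.
    apply: le_trans (hs_op_norm _ _) _.
    by rewrite ler_wpM2r ?rnorm_ge0 ?ltW.
  apply: bounded_operator_hs.
    split; last first.
      by exists d%:C%C => u; rewrite -!rnormE -rmorphM lecR.
    have [[lA0 _] _] := hsP A0.
    by move=> a u v /=; rewrite linA lA0 scalerBr opprD addrACA.
  move=> s sB.
  have cvs : (fun K : hsType H => \sum_(e <- s) rnorm (K e - A0 e) ^+ 2) @ F -->
      \sum_(e <- s) rnorm (A e - A0 e) ^+ 2.
    elim: (s) => [|e r IH].
      by rewrite big_nil; under eq_fun do rewrite big_nil; exact: cvg_cst.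
    rewrite big_cons; under eq_fun do rewrite big_cons.
    apply: cvgD IH.
    suff h : (fun K : hsType H => rnorm (K e - A0 e)) @ F --> rnorm (A e - A0 e).
      by rewrite expr2; under eq_fun do rewrite expr2; exact: cvgM.
    apply/cvgrPdist_lt => x x0; apply: filterS (Au e _ x0) => K.
    apply: le_lt_trans.
    rewrite ler_norml; apply/andP; split.
      rewrite lerNl opprB lerBlDr -[in leLHS](subrK (A e) (K e)) -addrA.
      by apply: le_trans (rnormD _ _) _; rewrite rnormB.
    rewrite lerBlDr -[in leLHS](subrK (K e) (A e)) -addrA.
    exact: rnormD.
  apply: (cvgr_to_le cvs).
  apply: filterS hA0 => K hK.
  apply: (@le_trans _ _ (hs_sq (K - A0))).
    exact: (sum_le_hs_sq (hsP (K - A0)) sB).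
  by rewrite -hs_rnormE rnormB ler_pXn2r ?nnegrE ?rnorm_ge0 ?ltW.
have [A0 [_ hA0 _]] := close 1 ltr01.
have hA : hilbert_schmidt A.
  have := hilbert_schmidt_lin 1 hA0 (hsP A0).
  by congr hilbert_schmidt; apply: funext => u; rewrite scale1r subrK.
pose AA : hsType H := HS (asboolT hA).
apply: (cvgP AA).
apply/cvgrPdist_lt => eps eps0.
have r0 : 0 < complex.Re eps / 2.
  by rewrite divr_gt0// -ltcR re.
have [A1 [nA1 hA1 sA1]] := close _ r0.
apply: filterS nA1 => K hK.
rewrite -rnormE -(re eps)// ltcR.
rewrite -(subrK A1 AA) -addrA.
apply: le_lt_trans (rnormD _ _) _.
rewrite (splitr (complex.Re eps)) ler_ltD//.
rewrite -(@ler_pXn2r _ 2)// ?nnegrE ?rnorm_ge0 ?(ltW r0)//.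
by rewrite hs_rnormE.
Unshelve. all: by end_near.
Qed.

HB.instance Definition _ := Uniform_isComplete.Build (hsType H) hs_complete.

HB.instance Definition _ := isHilbert.Build R[i] (hsType H)
  hs_dotD hs_dotZ hs_dot_conj hs_normE.

End HsSpace.

Section Operators.
Variables (R : realType).
Implicit Types (H K : hilbertType R[i]).

Definition contraction_operator H (T : H -> H) :=
  bounded_operator T /\ forall u, `|T u| <= `|u|.

Definition isometric_embedding H K (V : H -> K) :=
  linear V /\ forall u v, inner (V u) (V v) = inner u v.

Definition unitary_operator K (U : K -> K) :=
  isometric_embedding U /\ forall v, exists u, U u = v.

(* With H identified with its image under V, this says A = P_H X | H:
   V (A u) is the orthogonal projection of X (V u) onto V(H). *)
Definition compression H K (V : H -> K) (X : K -> K) (A : H -> H) :=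
  forall u v, inner (X (V u) - V (A u)) (V v) = 0.

Definition unitary_dilation H (T : H -> H) K (V : H -> K) (U : K -> K) :=
  [/\ isometric_embedding V, unitary_operator U &
      forall n, compression V (iter n U) (iter n T)].

Definition poly_operator H (p : {poly R[i]}) (T : H -> H) : H -> H :=
  fun u => \sum_(i < size p) p`_i *: iter i T u.

End Operators.

Section SemispectralMeasures.
Context (R : realType) (d : measure_display) (X : measurableType d).
Implicit Types (H K : hilbertType R[i]) (D : set X) (f : X -> R[i]).

Definition semispectral_measure H (E : set X -> H -> H) :=
  [/\ forall D, measurable D ->
        bounded_operator (E D) /\ forall u, 0 <= inner (E D u) u,
      E set0 = (fun=> 0),
      E setT = id &
      forall D_ : (set X)^nat,
        (forall n, measurable (D_ n)) -> trivIset setT D_ ->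
        forall u v,
          (fun n => \sum_(k < n) inner (E (D_ k) u) v) @ \oo -->
          inner (E (\bigcup_k D_ k) u) v].

(* Positivity and multiplicativity make the values orthogonal projections. *)
Definition spectral_measure H (E : set X -> H -> H) :=
  semispectral_measure E /\
  forall D1 D2, measurable D1 -> measurable D2 ->
    E (D1 `&` D2) = E D1 \o E D2.

(* J = \int f dE, as the limit in operator norm of the integrals of simple
   functions converging to f uniformly on X. *)
Definition spectral_integral H (E : set X -> H -> H) f (J : H -> H) :=
  forall e : R[i], 0 < e ->
  exists (n : nat) (c : 'I_n -> R[i]) (D_ : 'I_n -> set X),
    [/\ forall i, measurable (D_ i),
        forall x, `|f x - \sum_(i < n) c i * \1_(D_ i) x| <= e &
        forall u, `|J u - \sum_(i < n) c i *: E (D_ i) u| <= e * `|u|].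

Definition spectral_dilation H (E : set X -> H -> H)
    K (V : H -> K) (G : set X -> K -> K) :=
  [/\ isometric_embedding V, spectral_measure G &
      forall D, measurable D -> compression V (G D) (E D)].

Definition semispectral_integral H (E : set X -> H -> H) f (I : H -> H) :=
  exists (K : hilbertType R[i]) (V : H -> K) (G : set X -> K -> K) (J : K -> K),
    [/\ spectral_dilation E V G, spectral_integral G f J & compression V J I].

End SemispectralMeasures.

Section DoubleOperatorIntegrals.
Context (R : realType) (H : hilbertType R[i]).
Context (d1 d2 : measure_display) (X1 : measurableType d1) (X2 : measurableType d2).

Definition double_semispectral_measure
    (E1 : set X1 -> H -> H) (E2 : set X2 -> H -> H)
    (F : set (X1 * X2) -> hsType H -> hsType H) :=
  semispectral_measure F /\
  forall D1 D2, measurable D1 -> measurable D2 -> forall K : hsType H,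
    F (D1 `*` D2) K = E1 D1 \o K \o E2 D2 :> (H -> H).

(* L = \iint Phi dE1 K dE2 *)
Definition double_operator_integral
    (E1 : set X1 -> H -> H) (E2 : set X2 -> H -> H)
    (Phi : X1 * X2 -> R[i]) (K L : hsType H) :=
  exists (F : set (X1 * X2) -> hsType H -> hsType H)
         (I : hsType H -> hsType H),
    [/\ double_semispectral_measure E1 E2 F,
        semispectral_integral F Phi I & L = I K].

End DoubleOperatorIntegrals.

Section DiskAndCircle.
Variable R : realType.

Definition unit_disk : set R[i] := [set z | `|z| < 1].

Definition analytic_in_disk (f : R[i] -> R[i]) :=
  forall z, unit_disk z -> derivable f z 1.

Definition Hinfty (f : R[i] -> R[i]) :=
  analytic_in_disk f /\ exists M, forall z, unit_disk z -> `|f z| <= M.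

(* The values of an element of the disk algebra on the closed unit disk,
   recovered from its values in the open disk. *)
Definition disk_closure (f : R[i] -> R[i]) (z : R[i]) : R[i] :=
  lim (f @ within unit_disk (nbhs z)).

Definition is_disk_calculus (H : hilbertType R[i]) (f : R[i] -> R[i])
    (T A : H -> H) :=
  forall e : R[i], 0 < e -> exists p : {poly R[i]},
    (forall z, `|z| <= 1 -> `|disk_closure f z - p.[z]| <= e) /\
    (forall u, `|A u - poly_operator p T u| <= e * `|u|).

(* f(T), the limit in operator norm of p_n(T) for polynomials p_n converging to
   f uniformly on the closed disk. *)
Definition disk_calculus (H : hilbertType R[i]) (f : R[i] -> R[i])
    (T : H -> H) : H -> H :=
  xget (fun=> 0) [set A | is_disk_calculus f T A].

Definition circle_set : set R[i] := [set z | `|z| = 1].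

Lemma circle_set1 : circle_set 1.
Proof. exact: normr1. Qed.

Definition circle0 : Type := set_type circle_set.

HB.instance Definition _ := Topological.on circle0.
HB.instance Definition _ :=
  isPointed.Build circle0 (exist _ 1 (mem_set circle_set1)).

(* The unit circle with its Borel sigma-algebra.  It is second countable, so
   the product sigma-algebra on circle * circle consists of the Borel sets. *)
Definition circle := g_sigma_algebraType (@open circle0).

Definition circle_val (z : circle) : R[i] := set_val z.

Definition divided_difference (f : R[i] -> R[i]) (p : circle * circle) : R[i] :=
  let z := circle_val p.1 in let t := circle_val p.2 in
  if z == t then 0 else (disk_closure f z - disk_closure f t) / (z - t).

Definition semispectral_measure_of (H : hilbertType R[i]) (T : H -> H)
    (E : set circle -> H -> H) :=
  exists (K : hilbertType R[i]) (V : H -> K) (U : K -> K)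
         (G : set circle -> K -> K),
    [/\ unitary_dilation T V U,
        spectral_measure G,
        spectral_integral G circle_val U &
        forall D, measurable D -> compression V (G D) (E D)].

End DiskAndCircle.

(* Main.v *)
Require Import Defs.
From mathcomp Require Import all_boot all_order all_algebra.
From mathcomp Require Import complex ring lra.
From mathcomp Require Import all_classical all_reals all_analysis.
Set Implicit Arguments.
Unset Strict Implicit.
Unset Printing Implicit Defensive.
Import Order.TTheory GRing.Theory Num.Theory.
Import numFieldNormedType.Exports.
Local Open Scope classical_set_scope.
Local Open Scope ring_scope.

(** The integrand is replaced by polynomials.  Averaging [phi (z w^k)] over the
    [N]-th roots of unity against a Fejer kernel and letting [N] tend to infinity
    along an ultrafilter yields polynomials [p], Lipschitz with the constant of
    [phi] and uniformly close to [phi] on the closed disk; that the limits of the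
    averages are monomials is the equation [z h' = n h].  For a polynomial [p],
    the integral of the divided difference of [p] with respect to
    [dE (TQ - QT) dE] telescopes to [p(T) Q - Q p(T)], but there the diagonal is
    included.  Off the diagonal the divided differences converge boundedly, and
    uniformly away from the diagonal.

    It remains to see that the diagonal contributes nothing: [F(diag) C = 0] for
    [C = TQ - QT].  The averages of [z^k conj(t)^k] tend to the indicator of
    the diagonal, so [F(diag) S] is the limit of the averages of
    [T^k S (T^* )^k]; hence [F(diag)] is an idempotent whose values commute with
    [T] and [T^*].  With [e] a basis vector, [S = F(diag)(e (x) e)] and
    [D = F(diag) C], the operator [CS = T(QS) - (QS)T] is a commutator inside the
    Hilbert-Schmidt class, so [DS = F(diag)(CS) = 0]; therefore
    [F(diag)(D (e (x) e)) = DS = 0], and pairing with [D] gives [D e = 0]. *)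

(** * Integration against semispectral measures *)

(** The commutator structure of [C] is essential: if [T] is a unimodular multiple of the identity,
    [F] is concentrated at one point of the diagonal and [F(diag)] is the identity, so for a general
    Hilbert-Schmidt operator the diagonal does contribute. At the diagonal the divided difference of
    [phi] may be discontinuous, and uniform approximation by continuous functions is out of reach. A
    Lipschitz constant common to all the polynomials controls a thin band around the diagonal, whose
    mass without the diagonal is small. The band is fixed first and the polynomial afterwards, since
    its error is divided by the width of the band.

    Integrals are handled through [has_integral], where one list of sets and coefficients
    approximates both the integrand uniformly and the operator in norm. This notion names no
    dilation, so operators computed on rectangles from [E] can be compared with the given integral
    against [F], whose dilation has no relation to that of [E]. Dilations enter through norm
    estimates, which rest on multiplicativity. *)

Section Norms.
Variable R : realType.
Implicit Types (a b z : R[i]).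

Lemma rnormM a b : rnorm (a * b) = rnorm a * rnorm b.
Proof. exact: (rnormZ a b). Qed.

Lemma rnorm_scale (V : normedModType R[i]) a (u : V) :
  rnorm (a *: u) = rnorm a * rnorm u.
Proof. exact: rnormZ. Qed.

Lemma rnorm1 : rnorm (1 : R[i]) = 1.
Proof. by rewrite /rnorm normr1. Qed.

Lemma rnormX a n : rnorm (a ^+ n) = rnorm a ^+ n.
Proof. by elim: n => [|n IH]; rewrite ?expr0 ?rnorm1// !exprS rnormM IH. Qed.

Lemma rnormV a : rnorm a^-1 = (rnorm a)^-1.
Proof.
have [->|a0] := eqVneq a 0; first by rewrite invr0 rnorm0 invr0.
have ra0 : rnorm a != 0 by apply: contra_neq a0; exact: rnorm_eq0.
by apply: (mulfI ra0); rewrite -rnormM divff// divff// rnorm1.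
Qed.

Lemma rnorm_conj a : rnorm a^* = rnorm a.
Proof. by rewrite /rnorm norm_conjC. Qed.

Lemma rnorm_real (x : R) : rnorm (x%:C%C : R[i]) = `|x|.
Proof.
apply: (@complexI R); rewrite rnormE.
have [x0|x0] := leP 0 x; first by rewrite !ger0_norm// ler0c.
by rewrite !ltr0_norm// ?ltcR -?rmorphN// (ltcR _ 0).
Qed.

Lemma rnormn (n : nat) : rnorm (n%:R : R[i]) = n%:R.
Proof. by rewrite -(rmorph_nat (real_complex R)) rnorm_real ger0_norm. Qed.

Lemma rnorm_sq (H : hilbertType R[i]) (u : H) :
  inner u u = (rnorm u ^+ 2)%:C%C.
Proof. by rewrite rmorphXn/= rnormE normr_inner. Qed.

Lemma rnorm_inner (H : hilbertType R[i]) (u v : H) :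
  rnorm (inner u v) <= rnorm u * rnorm v.
Proof. by rewrite -lecR rmorphM/= !rnormE inner_CS. Qed.

Lemma mul_conj_rnorm a : a * a^* = (rnorm a ^+ 2)%:C%C.
Proof. by rewrite -normCK rmorphXn/= rnormE. Qed.

Lemma rnorm_sum_le (V : normedModType R[i]) I (r : seq I) (F : I -> V) :
  rnorm (\sum_(i <- r) F i) <= \sum_(i <- r) rnorm (F i).
Proof.
elim: r => [|x s IH]; first by rewrite !big_nil rnorm0.
by rewrite !big_cons (le_trans (rnormD _ _))// lerD2l.
Qed.

(** The factor [c] lets an estimate end in the form [e * c], with all constants gathered at the end
    instead of dividing [e] beforehand; its sign follows from the case [e = 1]. *)
Lemma rnorm_small (V : normedModType R[i]) (u : V) (c : R) :
  (forall e : R, 0 < e -> rnorm u <= e * c) -> u = 0.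
Proof.
move=> h; apply: rnorm_eq0; apply/eqP; rewrite eq_le rnorm_ge0 andbT.
apply/ler_addgt0Pr => e e0; rewrite add0r.
have c0 : 0 <= c by have := h 1 ltr01; rewrite mul1r; exact: le_trans (rnorm_ge0 _).
have d0 : 0 < e / (c + 1) by rewrite divr_gt0// ltr_wpDl.
apply: le_trans (h _ d0) _; rewrite mulrAC ler_pdivrMr ?ltr_wpDl// ler_wpM2l ?ltW//; lra.
Qed.

Lemma inner_inj (H : hilbertType R[i]) (u v : H) :
  (forall w, inner u w = inner v w) -> u = v.
Proof.
move=> h; apply/eqP; rewrite -subr_eq0; apply/eqP; apply: inner_eq0.
by rewrite innerBl h subrr.
Qed.

Lemma innerBr (H : hilbertType R[i]) (u v w : H) :
  inner u (v - w) = inner u v - inner u w.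
Proof. by rewrite inner_conj innerBl rmorphB/= -!inner_conj. Qed.

Lemma inner_sumr (H : hilbertType R[i]) I (r : seq I) (F : I -> H) w :
  inner w (\sum_(i <- r) F i) = \sum_(i <- r) inner w (F i).
Proof.
rewrite inner_conj inner_suml rmorph_sum/=.
by apply: eq_bigr => i _; rewrite -inner_conj.
Qed.

Lemma rnorm_cvgP (V : normedModType R[i]) T (F : set_system T) (f : T -> V) (l : V) :
  Filter F ->
  (f @ F --> l) <-> (forall e : R, 0 < e -> \forall x \near F, rnorm (l - f x) < e).
Proof.
move=> FF; split=> [/cvgrPdist_lt h e e0|h].
  have := h e%:C%C; rewrite (ltcR 0) => /(_ e0); apply: filterS => x.
  by rewrite -rnormE ltcR.
apply/cvgrPdist_lt => e e0.
have re : (complex.Re e)%:C%C = e by rewrite RRe_real// gtr0_real.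
have := h (complex.Re e); rewrite -(ltcR 0) re => /(_ e0).
by apply: filterS => x hx; rewrite -rnormE -re ltcR.
Qed.

Lemma rnorm_cvg_unique (V : normedModType R[i]) T (F : set_system T) (f : T -> V) (l m : V) :
  ProperFilter F -> f @ F --> l -> f @ F --> m -> l = m.
Proof.
move=> FF /rnorm_cvgP hl /rnorm_cvgP hm; apply/eqP; rewrite -subr_eq0; apply/eqP.
apply: (@rnorm_small _ _ 2) => e e0.
have [x [hx hy]] := filter_ex (filterI (hl _ e0) (hm _ e0)).
rewrite -[l](subrK (f x)) -addrA mulr2n mulrDr mulr1.
by rewrite (le_trans (rnormD _ _))// lerD ?ltW// rnormB.
Qed.

End Norms.

Section SimpleFunctions.
Context (R : realType) (d : measure_display) (X : measurableType d).
Implicit Types (s t : seq (R[i] * set X)) (D : set X) (x : X).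

(* The list [(c_i, D_i)] encodes the simple function [\sum_i c_i \1_(D_i)]; the
   sets need not be disjoint. *)
Definition simple_fun s x : R[i] := \sum_(p <- s) p.1 * \1_(p.2) x.

Definition simple_op (H : lmodType R[i]) (E : set X -> H -> H) s (u : H) : H :=
  \sum_(p <- s) p.1 *: E p.2 u.

Definition simple_measurable s := forall p, p \in s -> measurable p.2.

Lemma indicE_bool D x : \1_D x = (x \in D)%:R :> R[i].
Proof. by rewrite indicE. Qed.

Lemma simple_measurable_cons p s : simple_measurable (p :: s) -> measurable p.2 /\
    simple_measurable s.
Proof.
by move=> h; split=> [|q qs]; apply: h; rewrite inE ?eqxx// qs orbT.
Qed.

Lemma simple_measurable_cat s t : simple_measurable s -> simple_measurable t ->
    simple_measurable (s ++ t).
Proof. by move=> hs ht p; rewrite mem_cat => /orP[/hs|/ht]. Qed.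

Lemma measurable_simple_fun s (P : R[i] -> Prop) : simple_measurable s ->
  measurable [set x | P (simple_fun s x)].
Proof.
elim: s P => [|p s IH] P hs.
  rewrite (_ : [set _ | _] = [set x | P 0]); last first.
    by apply/seteqP; split=> x /=; rewrite /simple_fun big_nil.
  by have [p0|p0] := pselect (P 0);
    [rewrite (_ : [set _ | _] = setT)|rewrite (_ : [set _ | _] = set0)];
    rewrite ?measurableT//; apply/seteqP; split.
have [mp ms] := simple_measurable_cons hs.
rewrite (_ : [set _ | _] = (p.2 `&` [set x | P (p.1 + simple_fun s x)]) `|`
                           (~` p.2 `&` [set x | P (simple_fun s x)])); last first.
  have E x : simple_fun (p :: s) x = p.1 * (x \in p.2)%:R + simple_fun s x.
    by rewrite /simple_fun big_cons indicE_bool.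
  apply/seteqP; split=> x /=; rewrite E.
    have [xp|xp] := pselect (p.2 x).
      by rewrite mem_set// mulr1; left.
    by rewrite memNset// mulr0 add0r; right.
  by case=> -[xp]; [rewrite mem_set// mulr1|rewrite memNset// mulr0 add0r].
apply: measurableU; apply: measurableI => //; last exact: IH.
- exact: IH (fun y => P (p.1 + y)) ms.
- exact: measurableC.
Qed.

Lemma simple_fun_bound s : exists2 M : R, 0 <= M & forall x, rnorm (simple_fun s x) <= M.
Proof.
exists (\sum_(p <- s) rnorm p.1); first by apply: sumr_ge0 => p _; exact: rnorm_ge0.
move=> x; apply: le_trans (rnorm_sum_le _ _) _.
apply: ler_sum => p _; rewrite rnormM indicE_bool rnormn.
by case: (x \in p.2); rewrite ?mulr1// mulr0 rnorm_ge0.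
Qed.

End SimpleFunctions.

Section Spectral.
Context (R : realType) (d : measure_display) (X : measurableType d).
Variables (H : hilbertType R[i]) (E : set X -> H -> H).
Hypothesis spE : semispectral_measure E.
Implicit Types (D A B : set X) (u v : H).

Lemma semispectral_bounded D : measurable D -> bounded_operator (E D).
Proof. by move=> mD; have [/(_ D mD)[]] := spE. Qed.

Lemma semispectral_ge0 D u : measurable D -> 0 <= inner (E D u) u.
Proof. by move=> mD; have [/(_ D mD)[]] := spE. Qed.

(** Positivity makes every [inner (E D w) w] real; polarization, with [w = u + v] and
    [w = u + 'i *: v], turns this into symmetry. *)
Lemma semispectral_selfadj D u v : measurable D -> inner (E D u) v = inner u (E D v).
Proof.
move=> mD; have bD := semispectral_bounded mD.
have re w : inner (E D w) w = inner w (E D w).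
  rewrite [RHS]inner_conj; apply/esym/CrealP; exact: ger0_real (semispectral_ge0 _ mD).
have h1 := re (u + v); have h2 := re (u + 'i%C *: v).
move: h1 h2; rewrite !(bounded_operatorD _ _ bD) (bounded_operatorZ _ _ bD).
rewrite !innerDl !innerDr !innerZl !innerZr (re u) (re v).
have ii : 'i%C * ('i%C)^* = 1 :> R[i] by rewrite /= mul_conj_rnorm; congr (_%:C)%C; rewrite
    /rnorm complexiE normCi expr1n.
set a := inner u (E D u); set b := inner v (E D v).
set x := inner (E D u) v; set y := inner u (E D v).
set x' := inner (E D v) u; set y' := inner v (E D u).
rewrite (_ : ('i%C)^* = - 'i%C); last by rewrite complexiE conjCi.
have i0 : 'i%C != 0 :> R[i] by rewrite complexiE neq0Ci.
move=> h1 h2.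
have k1 : x + x' = y + y'.
  apply: (addrI (a + b)); transitivity (a + x + (x' + b)); first by ring.
  by rewrite h1; ring.
have k2 : - x + x' = - y + y'.
  apply: (mulfI i0); apply: (addrI (a + 'i%C * (- 'i%C * b))).
  transitivity (a + - 'i%C * x + ('i%C * x' + 'i%C * (- 'i%C * b))); first by ring.
  by rewrite h2; ring.
have : 2 * x = 2 * y by transitivity (x + x' - (- x + x')); [ring|rewrite k1 k2; ring].
by apply: mulfI; rewrite pnatr_eq0.
Qed.

(** Countable additivity along the sequence [D1], [D2], empty, empty, and so on, whose partial sums
    are constant from index [2] on. *)
Lemma semispectralU D1 D2 u v : measurable D1 -> measurable D2 -> D1 `&` D2 = set0 ->
  inner (E (D1 `|` D2) u) v = inner (E D1 u) v + inner (E D2 u) v.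
Proof.
move=> m1 m2 D12.
pose F n := if n is n'.+1 then (if n' is _.+1 then set0 else D2) else D1.
have mF n : measurable (F n) by case: n => [|[|n]]; rewrite /F.
have tF : trivIset setT F.
  apply/trivIsetP => -[|[|i]] [|[|j]] _ _ //=; rewrite ?setI0 ?set0I//.
  by rewrite setIC.
have [_ E0 _ /(_ F mF tF u v)] := spE.
have -> : \bigcup_k F k = D1 `|` D2.
  apply/seteqP; split=> x.
    by move=> [[|[|n]] _] //= h; [left|right].
  by case=> h; [exists 0%N|exists 1%N].
move=> h; apply: (rnorm_cvg_unique _ h).
rewrite -(cvg_shiftn 2)/=.
rewrite (_ : (fun n => _) = (fun=> inner (E D1 u) v + inner (E D2 u) v)); first exact: cvg_cst.
apply: funext => n; rewrite addn2 !big_ord_recl/= big1 ?addr0// => i _.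
by rewrite E0 inner0l.
Qed.

Lemma semispectral_sum0 u v : inner (E set0 u) v = 0.
Proof. by have [_ -> _ _] := spE; rewrite inner0l. Qed.

(* Induction on the list, splitting [Y] along the first set. *)
Lemma semispectral_pos_on (s : seq (R[i] * set X)) (c : R[i]) Y u : simple_measurable s ->
    measurable Y ->
  (forall x, Y x -> 0 <= c + simple_fun s x) ->
  0 <= c * inner (E Y u) u + \sum_(p <- s) p.1 * inner (E (p.2 `&` Y) u) u.
Proof.
elim: s c Y => [|p s IH] c Y ms mY h.
  rewrite big_nil addr0; have [->|/set0P[x Yx]] := eqVneq Y set0.
    by rewrite semispectral_sum0 mulr0.
  by rewrite mulr_ge0 ?semispectral_ge0//; have := h _ Yx; rewrite /simple_fun big_nil addr0.
have [mp {}ms] := simple_measurable_cons ms.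
have h1 := IH (c + p.1) (p.2 `&` Y) ms (measurableI _ _ mp mY).
have h2 := IH c (~` p.2 `&` Y) ms (measurableI _ _ (measurableC mp) mY).
have sE x : simple_fun (p :: s) x = p.1 * (x \in p.2)%:R + simple_fun s x.
  by rewrite /simple_fun big_cons indicE_bool.
have split A : measurable A -> inner (E (A `&` Y) u) u =
    inner (E (A `&` (p.2 `&` Y)) u) u + inner (E (A `&` (~` p.2 `&` Y)) u) u.
  move=> mA; rewrite -semispectralU; first last.
  - by apply/seteqP; split=> x //= -[[_ [? _]] [_ [? _]]].
  - by do 2 (apply: measurableI => //); exact: measurableC.
  - by do 2 apply: measurableI => //.
  - congr (inner (E _ u) u); rewrite -setIUr -setIUl setUv setTI//.
have sY := split setT measurableT; rewrite !setTI in sY.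
rewrite sY big_cons (eq_big_seq (fun q => q.1 * inner (E (q.2 `&` (p.2 `&` Y)) u) u
   + q.1 * inner (E (q.2 `&` (~` p.2 `&` Y)) u) u)); last first.
  by move=> q qs /=; rewrite -mulrDr -split//; exact: ms.
rewrite big_split/=.
have {}h1 := h1 _; have {}h2 := h2 _.
rewrite [X in 0 <= X](_ : _ = ((c + p.1) * inner (E (p.2 `&` Y) u) u +
  \sum_(q <- s) q.1 * inner (E (q.2 `&` (p.2 `&` Y)) u) u) +
  (c * inner (E (~` p.2 `&` Y) u) u +
  \sum_(q <- s) q.1 * inner (E (q.2 `&` (~` p.2 `&` Y)) u) u)); last by ring.
rewrite addr_ge0//.
  apply: h1 => x [px Yx]; have := h _ Yx; rewrite sE mem_set// mulr1 addrA//.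
apply: h2 => x [px Yx]; have := h _ Yx; rewrite sE memNset// mulr0 add0r//.
Qed.

Lemma semispectral_pos (s : seq (R[i] * set X)) u : simple_measurable s -> (forall x, 0 <=
    simple_fun s x) ->
  0 <= \sum_(p <- s) p.1 * inner (E p.2 u) u.
Proof.
move=> ms h; have := @semispectral_pos_on s 0 setT u ms measurableT.
rewrite mul0r add0r; under eq_bigr do rewrite setIT.
by apply=> x _; rewrite add0r.
Qed.

(** The scalar measure attached to [u]. On measurable sets the discarded imaginary part is zero by
    positivity. *)
Definition mass D u : R := complex.Re (inner (E D u) u).

Lemma massE D u : measurable D -> inner (E D u) u = (mass D u)%:C%C.
Proof. by move=> mD; rewrite /mass RRe_real// ger0_real// semispectral_ge0. Qed.

Lemma mass_ge0 D u : measurable D -> 0 <= mass D u.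
Proof. by move=> mD; rewrite -ler0c -massE// semispectral_ge0. Qed.

Lemma massT u : mass setT u = rnorm u ^+ 2.
Proof. by rewrite /mass; have [_ _ -> _] := spE; rewrite rnorm_sq. Qed.

Lemma massU D1 D2 u : measurable D1 -> measurable D2 -> D1 `&` D2 = set0 ->
  mass (D1 `|` D2) u = mass D1 u + mass D2 u.
Proof. by move=> *; rewrite /mass semispectralU// raddfD. Qed.

(** Continuity from above at the empty set: the differences of consecutive sets partition [N 0], and
    their partial sums telescope to the mass of [N 0] minus that of [N n]. *)
Lemma mass_decr (N : nat -> set X) u : (forall n, measurable (N n)) ->
  (forall n, N n.+1 `<=` N n) -> \bigcap_n N n = set0 ->
  forall e : R, 0 < e -> exists n, mass (N n) u < e.
Proof.
move=> mN dN N0 e e0.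
pose F n := N n `\` N n.+1.
have mF n : measurable (F n) by exact: measurableD.
have dNn m k : N (m + k)%N `<=` N m.
  by elim: k => [|k IH]; rewrite ?addn0// addnS => x /dN /IH.
have tF : trivIset setT F.
  apply: ltn_trivIset => i j ij; rewrite -subset0 => x [[Nix NSi] [Nj _]].
  by apply: NSi; move: Nj; rewrite -(subnKC ij); exact: dNn.
have [_ _ _ /(_ F mF tF u u)] := spE.
have -> : \bigcup_k F k = N 0%N.
  apply/seteqP; split=> x; first by move=> [k _ [/(@dNn 0%N k)]].
  move=> N0x; apply: contrapT => nF.
  have : (\bigcap_n N n) x.
    move=> n _; elim: n => // n IH; apply: contrapT => h; apply: nF.
    by exists n.
  by rewrite N0.
have sum n : \sum_(k < n) inner (E (F k) u) u = (mass (N 0%N) u - mass (N n) u)%:C%C.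
  elim: n => [|n IH]; first by rewrite big_ord0 subrr.
  rewrite big_ord_recr/= IH massE// -rmorphD/=; congr (_%:C)%C.
  have -> : mass (N n) u = mass (F n) u + mass (N n.+1) u.
    rewrite -massU//; last by apply/seteqP; split=> x //= -[[]].
    by rewrite setUC setDUK.
  ring.
under eq_fun do rewrite sum.
rewrite massE// => /cvgrPdist_lt/(_ e%:C%C).
case; first by rewrite (ltcR 0).
move=> n _ /(_ n (leqnn n))/=; rewrite -rmorphB/= -rnormE rnorm_real ltcR.
by rewrite opprB addrC subrK ger0_norm ?mass_ge0// => ?; exists n.
Qed.

End Spectral.

Section Limits.
Variable R : realType.

Lemma ler_small (x y c : R) : 0 <= c -> (forall e, 0 < e -> x <= y + e * c) -> x <= y.
Proof.
move=> c0 h; apply/ler_addgt0Pr => e e0.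
have d0 : 0 < e / (c + 1) by rewrite divr_gt0// ltr_wpDl.
apply: le_trans (h _ d0) _; rewrite lerD2l mulrAC ler_pdivrMr ?ltr_wpDl//.
by rewrite ler_wpM2l ?ltW//; lra.
Qed.

Lemma inv_small (e : R) : 0 < e -> exists n0, forall n, (n0 <= n)%N -> n.+1%:R^-1 < e.
Proof.
move=> e0; exists (Num.bound e^-1) => n ln.
rewrite invf_plt ?posrE//; apply: lt_le_trans (archi_boundP _) _.
  by rewrite invr_ge0 ltW.
by rewrite ler_nat ltnW.
Qed.

(** The explicit rate is what both [has_integral] and [is_disk_calculus] require: an estimate in
    operator norm, not only convergence at each vector. *)
Lemma op_limit (V : normedModType R[i]) (H : completeNormedModType R[i]) (A : nat -> V -> H) :
  (forall n m u, rnorm (A n u - A m u) <= (n.+1%:R^-1 + m.+1%:R^-1) * rnorm u) ->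
  exists B : V -> H, forall n u, rnorm (B u - A n u) <= n.+1%:R^-1 * rnorm u.
Proof.
move=> h.
have cA u : cvg (A^~ u @ \oo).
  apply: cauchy_cvg; apply: cauchy_exP => eps eps0.
  have re : (complex.Re eps)%:C%C = eps by rewrite RRe_real// gtr0_real.
  have e0 : 0 < complex.Re eps by rewrite -(ltcR 0) re.
  have d0 : 0 < complex.Re eps / (2 * (rnorm u + 1)).
    by rewrite divr_gt0// mulr_gt0// ltr_wpDl// rnorm_ge0.
  have [n0 hn0] := inv_small d0.
  exists (A n0 u); exists n0 => // n /= ln.
  rewrite -ball_normE/= -rnormE -re ltcR.
  apply: le_lt_trans (h _ _ _) _.
  set q := complex.Re eps / _ in d0 hn0.
  apply: (@le_lt_trans _ _ ((q + q) * rnorm u)).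
    by rewrite ler_wpM2r ?rnorm_ge0// lerD// ltW// hn0.
  have -> : complex.Re eps = (q + q) * (rnorm u + 1).
    by rewrite /q; field; rewrite gt_eqF// ltr_wpDl// rnorm_ge0.
  by rewrite ltr_pM2l ?ltrDl// addr_gt0.
exists (fun u => lim (A^~ u @ \oo)) => n u.
apply: (@ler_small _ _ (1 + rnorm u)); first by rewrite addr_ge0// rnorm_ge0.
move=> e e0.
have /rnorm_cvgP/(_ _ e0) [m _ hm] := cA u.
have [n1 hn1] := inv_small e0.
have {}hm := hm (m + n1)%N (leq_addr _ _).
rewrite -[lim _](subrK (A (m + n1)%N u)) -addrA.
apply: le_trans (rnormD _ _) _.
have := h (m + n1)%N n u; have := hn1 _ (leq_addl m n1); have := rnorm_ge0 u.
set q := (m + n1).+1%:R^-1 => u0 hq; have : q * rnorm u <= e * rnorm u by rewrite ler_wpM2r// ltW.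
move: hm; set a := n.+1%:R^-1; lra.
Qed.

End Limits.

Section Integral.
Context (R : realType) (d : measure_display) (X : measurableType d).
Implicit Types (s t : seq (R[i] * set X)) (f g : X -> R[i]) (A D : set X).

(* [spectral_integral] with a real tolerance.  It is used for semispectral [E] as
   well, where it is the compression of the integral against a dilation. *)
Definition has_integral (H : hilbertType R[i]) (E : set X -> H -> H) f (I : H -> H) :=
  forall e : R, 0 < e -> exists s, [/\ simple_measurable s,
    forall x, rnorm (f x - simple_fun s x) <= e &
    forall u, rnorm (I u - simple_op E s u) <= e * rnorm u].

Lemma spectral_integral_has_integral (H : hilbertType R[i]) (E : set X -> H -> H) f I :
  spectral_integral E f I -> has_integral E f I.
Proof.
move=> h e e0; have [|n [c [D [mD h1 h2]]]] := h e%:C%C; first by rewrite (ltcR 0).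
exists [seq (c i, D i) | i <- enum 'I_n]; split.
- by move=> p /mapP[i _ ->]; exact: mD.
- move=> x; rewrite -lecR rnormE /simple_fun big_map big_enum; exact: h1.
- by move=> u; rewrite -lecR rmorphM/= !rnormE /simple_op big_map big_enum; exact: h2.
Qed.

Definition simple_scale (a : R[i]) s : seq (R[i] * set X) := [seq (a * p.1, p.2) | p <- s].

Lemma simple_measurable_scale a s : simple_measurable s -> simple_measurable (simple_scale a s).
Proof. by move=> ms p /mapP[q /ms ? ->]. Qed.

Lemma simple_fun_scale a s x : simple_fun (simple_scale a s) x = a * simple_fun s x.
Proof.
by rewrite /simple_fun big_map mulr_sumr; apply: eq_bigr => p _; rewrite mulrA.
Qed.

Lemma simple_op_scale (H : lmodType R[i]) (E : set X -> H -> H) a s u :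
  simple_op E (simple_scale a s) u = a *: simple_op E s u.
Proof.
by rewrite /simple_op big_map scaler_sumr; apply: eq_bigr => p _; rewrite scalerA.
Qed.

Lemma simple_fun_cat s t x : simple_fun (s ++ t) x = simple_fun s x + simple_fun t x.
Proof. by rewrite /simple_fun big_cat. Qed.

Lemma simple_op_cat (H : lmodType R[i]) (E : set X -> H -> H) s t u :
  simple_op E (s ++ t) u = simple_op E s u + simple_op E t u.
Proof. by rewrite /simple_op big_cat. Qed.

Lemma has_integral_lin (H : hilbertType R[i]) (E : set X -> H -> H) a f g I J :
  has_integral E f I -> has_integral E g J ->
  has_integral E (fun x => a * f x + g x) (fun u => a *: I u + J u).
Proof.
move=> hf hg e e0.
have a0 := rnorm_ge0 a.
have d0 : 0 < e / (rnorm a + 1) by rewrite divr_gt0// ltr_wpDl.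
set q := e / _ in d0.
have qe : e = rnorm a * q + q by rewrite /q; field; rewrite gt_eqF// ltr_wpDl.
have [s [ms s1 s2]] := hf _ d0; have [t [mt t1 t2]] := hg _ d0.
exists (simple_scale a s ++ t); split; first by apply: simple_measurable_cat => //; exact:
    simple_measurable_scale.
- move=> x; rewrite simple_fun_cat simple_fun_scale opprD addrACA -mulrBr qe.
  by rewrite (le_trans (rnormD _ _))// lerD// rnormM ler_wpM2l.
- move=> u; rewrite simple_op_cat simple_op_scale opprD addrACA -scalerBr qe mulrDl.
  by rewrite (le_trans (rnormD _ _))// lerD// rnorm_scale -mulrA ler_wpM2l.
Qed.

Lemma has_integral0 (H : hilbertType R[i]) (E : set X -> H -> H) : has_integral E (fun=> 0)
    (fun=> 0).
Proof.
move=> e e0; exists [::]; split => // [x|u].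
  by rewrite /simple_fun big_nil subrr rnorm0 ltW.
by rewrite /simple_op big_nil subrr rnorm0 mulr_ge0 ?rnorm_ge0// ltW.
Qed.

Lemma has_integral_sum (H : hilbertType R[i]) (E : set X -> H -> H) T (r : seq T)
    (a : T -> R[i]) (f : T -> X -> R[i]) (I : T -> H -> H) :
  (forall i, has_integral E (f i) (I i)) ->
  has_integral E (fun x => \sum_(i <- r) a i * f i x) (fun u => \sum_(i <- r) a i *: I i u).
Proof.
move=> h; elim: r => [|i r IH].
  have -> : (fun x => \sum_(i <- [::]) a i * f i x) = fun=> 0 by apply: funext => x; rewrite
      big_nil.
  have -> : (fun u => \sum_(i <- [::]) a i *: I i u) = fun=> 0 by apply: funext => x; rewrite
      big_nil.
  exact: has_integral0.
have -> : (fun x => \sum_(j <- i :: r) a j * f j x) = fun x => a i * f i x + \sum_(j <- r) a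
    j * f j x.
  by apply: funext => x; rewrite big_cons.
have -> : (fun u => \sum_(j <- i :: r) a j *: I j u) = fun u => a i *: I i u + \sum_(j <- r)
    a j *: I j u.
  by apply: funext => u; rewrite big_cons.
exact: has_integral_lin.
Qed.

Lemma has_integral_indic (H : hilbertType R[i]) (E : set X -> H -> H) A :
  measurable A -> has_integral E (\1_A) (E A).
Proof.
move=> mA e e0; exists [:: (1, A)]; split => [p|x|u].
- by rewrite inE => /eqP ->.
- by rewrite /simple_fun big_seq1 mul1r subrr rnorm0 ltW.
- by rewrite /simple_op big_seq1 scale1r subrr rnorm0 mulr_ge0 ?rnorm_ge0// ltW.
Qed.

(** This is where the measurability of [diag] and of the bands around it comes from: an integrand is
    a uniform limit of simple functions, so a closed sublevel set is the intersection of those of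
    the approximants, relaxed by their errors. *)
Lemma measurable_has_integral_le (H : hilbertType R[i]) (E : set X -> H -> H) f I (e : R) :
  has_integral E f I -> measurable [set x | rnorm (f x) <= e].
Proof.
move=> h.
have h' n : {s | simple_measurable s /\ forall x, rnorm (f x - simple_fun s x) <= n.+1%:R^-1}.
  by apply: cid; have [|s [ms hs _]] := h n.+1%:R^-1; rewrite ?invr_gt0//; exists s.
pose s n := simple_fun (projT1 (h' n)).
rewrite (_ : [set _ | _] = \bigcap_n [set x | rnorm (s n x) <= e + n.+1%:R^-1]).
  apply: bigcapT_measurable => n.
  by apply: (measurable_simple_fun (fun z => rnorm z <= e + n.+1%:R^-1)); have [] := projT2 (h' n).
apply/seteqP; split=> x /=.
  move=> fx n _ /=; have [_ /(_ x)] := projT2 (h' n); rewrite -/(s n) => hx.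
  by rewrite -[s n x](subrK (f x)) (le_trans (rnormD _ _))// addrC lerD// rnormB.
move=> hx; apply: (@ler_small _ _ _ 2) => // q q0.
have [n /(_ n (leqnn n)) hn] := inv_small q0.
have [_ /(_ x)] := projT2 (h' n); rewrite -/(s n).
have /= := hx n Logic.I.
rewrite -[f x](subrK (s n x)) addrK => h1 h2.
apply: le_trans (rnormD _ _) _; move: hn h1 h2; set a := n.+1%:R^-1; lra.
Qed.

End Integral.

(** * Norm estimates from the multiplicativity of a spectral measure *)

Section SpectralBound.
Context (R : realType) (d : measure_display) (X : measurableType d).
Variables (K : hilbertType R[i]) (G : set X -> K -> K).
Hypothesis spG : spectral_measure G.
Implicit Types (s t : seq (R[i] * set X)) (f g : X -> R[i]) (A D Z : set X).

Definition simple_prod s t : seq (R[i] * set X) := [seq (p.1 * q.1, p.2 `&` q.2) | p <- s, q <- t].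

Lemma simple_measurable_prod s t : simple_measurable s -> simple_measurable t ->
    simple_measurable (simple_prod s t).
Proof.
move=> ms mt p /allpairsP[[q r] /= [qs rt ->]] /=.
by apply: measurableI; [exact: ms|exact: mt].
Qed.

Lemma simple_fun_prod s t x : simple_fun (simple_prod s t) x = simple_fun s x * simple_fun t x.
Proof.
rewrite /simple_fun big_allpairs_dep mulr_suml; apply: eq_bigr => p _.
rewrite mulr_sumr; apply: eq_bigr => q _ /=.
by rewrite !indicE_bool in_setI -mulnb natrM; ring.
Qed.

Lemma simple_op_prod s t u : simple_measurable s -> simple_measurable t ->
  simple_op G (simple_prod s t) u = simple_op G s (simple_op G t u).
Proof.
have [ssG mulG] := spG.
move=> ms mt; rewrite /simple_op big_allpairs_dep; apply: eq_big_seq => p ps.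
have bG := semispectral_bounded ssG (ms _ ps).
rewrite (bounded_operator_sum _ _ bG) scaler_sumr; apply: eq_big_seq => q qt /=.
by rewrite mulG/= ?(bounded_operatorZ _ _ bG) ?scalerA//; [exact: ms|exact: mt].
Qed.

Definition simple_conj s : seq (R[i] * set X) := [seq (p.1^*, p.2) | p <- s].

Lemma simple_measurable_conj s : simple_measurable s -> simple_measurable (simple_conj s).
Proof. by move=> ms p /mapP[q /ms ? ->]. Qed.

Lemma simple_fun_conj s x : simple_fun (simple_conj s) x = (simple_fun s x)^*.
Proof.
rewrite /simple_fun big_map rmorph_sum/=; apply: eq_bigr => p _.
by rewrite rmorphM/= indicE_bool rmorph_nat.
Qed.

Lemma simple_op_conj s u v : simple_measurable s -> inner (simple_op G s u) v = inner u
    (simple_op G (simple_conj s) v).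
Proof.
have [ssG _] := spG.
move=> ms; rewrite /simple_op big_map inner_suml inner_sumr; apply: eq_big_seq => p ps /=.
by rewrite innerZl innerZr conjCK (semispectral_selfadj ssG)//; exact: ms.
Qed.

(* [|simple_op G s u|^2] is the integral of [|s|^2] against the measure
   [<G(.) u, u>], so the bounds on [|s|^2] transfer by [semispectral_pos]. *)
Lemma simple_op_bound s A Z (C B e : R) u : simple_measurable s -> measurable A -> measurable Z ->
  (forall x, rnorm (simple_fun s x) ^+ 2 <=
     C ^+ 2 * (x \in A)%:R + B ^+ 2 * (x \in Z)%:R + e ^+ 2) ->
  rnorm (simple_op G s u) ^+ 2 <= C ^+ 2 * mass G A u + B ^+ 2 * mass G Z u + e ^+ 2 * rnorm u ^+ 2.
Proof.
have [ssG mulG] := spG => ms mA mZ h.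
have mcs := simple_measurable_conj ms; have mp := simple_measurable_prod mcs ms.
pose r : seq (R[i] * set X) := [:: ((C ^+ 2)%:C%C, A), ((B ^+ 2)%:C%C, Z), ((e ^+ 2)%:C%C, setT)
   & simple_scale (-1) (simple_prod (simple_conj s) s)].
have mr : simple_measurable r.
  move=> p; rewrite !inE => /or4P[/eqP->|/eqP->|/eqP->|] //.
    exact: measurableT.
  by move: p; exact: simple_measurable_scale.
have rE x : simple_fun r x = (C ^+ 2 * (x \in A)%:R + B ^+ 2 * (x \in Z)%:R + e ^+ 2
    - rnorm (simple_fun s x) ^+ 2)%:C%C.
  rewrite {1}/simple_fun !big_cons -/(simple_fun _ x) simple_fun_scale simple_fun_prod
      simple_fun_conj (mulrC _^*) mul_conj_rnorm.
  rewrite !indicE_bool in_setT mulr1 mulN1r !addrA.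
  by rewrite rmorphB !rmorphD !rmorphM/= !rmorph_nat.
have := @semispectral_pos _ _ _ _ _ ssG r u mr.
have r0 x : 0 <= simple_fun r x by rewrite rE ler0c subr_ge0.
move=> /(_ r0); rewrite !big_cons/=.
rewrite (_ : \sum_(_ <- _) _ = - (rnorm (simple_op G s u) ^+ 2)%:C%C); last first.
  rewrite -rnorm_sq (simple_op_conj _ _ ms) -simple_op_prod//.
  have -> : inner u (simple_op G (simple_prod (simple_conj s) s) u) = inner (simple_op G
      (simple_prod (simple_conj s) s) u) u.
    by rewrite [RHS]inner_conj simple_op_prod// -(simple_op_conj _ _ ms) rnorm_sq
        conj_Creal// ger0_real// ler0c sqr_ge0.
  rewrite -innerNl -[- simple_op _ _ _]scaleN1r -simple_op_scale /simple_op inner_suml.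
  by apply: eq_bigr => p _; rewrite innerZl.
rewrite !(massE ssG)// (massT ssG).
by rewrite -!rmorphM -rmorphN -!rmorphD/= ler0c !addrA subr_ge0.
Qed.

End SpectralBound.

Section Compression.
Context (R : realType) (H K : hilbertType R[i]) (V : H -> K).
Hypothesis isoV : isometric_embedding V.

Lemma compressionP X A : compression V X A <->
  forall u v, inner (X (V u)) (V v) = inner (A u) v.
Proof.
have [_ iV] := isoV; split=> h u v.
  by have /eqP := h u v; rewrite innerBl iV subr_eq0 => /eqP.
by rewrite innerBl iV h subrr.
Qed.

Lemma isometry_rnorm u : rnorm (V u) = rnorm u.
Proof.
have [_ iV] := isoV; apply/eqP; rewrite -(@eqrXn2 _ 2) ?rnorm_ge0//.
by apply/eqP/(@complexI R); rewrite -!rnorm_sq iV.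
Qed.

(** The orthogonal projection does not increase norms: [inner a a = inner b (V a)], then
    Cauchy-Schwarz. It is stated for a difference so that an integral can be compared with a simple
    operator. *)
Lemma compression_le X A X' A' u : compression V X A -> compression V X' A' ->
  rnorm (A u - A' u) <= rnorm (X (V u) - X' (V u)).
Proof.
move=> /compressionP h /compressionP h'.
set a := A u - A' u; set b := X (V u) - X' (V u).
have E : inner a a = inner b (V a) by rewrite /a {1}innerBl -h -h' -innerBl.
have : rnorm a ^+ 2 <= rnorm b * rnorm a.
  rewrite -[X in _ * X](isometry_rnorm a); apply: le_trans (rnorm_inner _ _).
  by rewrite -E rnorm_sq rnorm_real ger0_norm ?(isometry_rnorm a)// exprn_ge0// rnorm_ge0.
have := rnorm_ge0 a; have := rnorm_ge0 b.
have [->|a0] := eqVneq (rnorm a) 0; first by [].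
by move=> _ ha; rewrite expr2 ler_pM2r// lt_neqAle eq_sym a0.
Qed.

End Compression.

(** * Transfer of integrals and estimates along a dilation *)

Section Dilation.
Context (R : realType) (d : measure_display) (X : measurableType d).
Context (H K : hilbertType R[i]) (V : H -> K).
Variables (E : set X -> H -> H) (G : set X -> K -> K).
Hypothesis dil : spectral_dilation E V G.
Implicit Types (s t : seq (R[i] * set X)) (f g : X -> R[i]) (A D Z : set X).

Lemma dilE D u v : measurable D -> inner (E D u) v = inner (G D (V u)) (V v).
Proof. by have [iV _ h] := dil => /h/(compressionP iV). Qed.

Lemma massE_dil D u : measurable D -> mass E D u = mass G D (V u).
Proof. by move=> mD; rewrite /mass dilE. Qed.

Lemma dil_mass_ge0 D u : measurable D -> 0 <= mass E D u.
Proof. by have [_ [ssG _] _] := dil => mD; rewrite massE_dil// mass_ge0. Qed.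

Lemma simple_op_compression s : simple_measurable s -> compression V (simple_op G s)
    (simple_op E s).
Proof.
have [iV _ h] := dil => ms; apply/(compressionP iV) => u v.
rewrite /simple_op !inner_suml; apply: eq_big_seq => p ps.
by rewrite !innerZl dilE//; exact: ms.
Qed.

Lemma simple_op_rnorm s u : simple_measurable s -> rnorm (simple_op E s u) <= rnorm
    (simple_op G s (V u)).
Proof.
have [iV _ _] := dil => ms.
(* The empty list gives the zero operator, so the comparison becomes a bound on one operator. *)
have := compression_le iV u (simple_op_compression ms) (simple_op_compression (s := [::]) _).
by rewrite /simple_op !big_nil !subr0; apply => p; rewrite in_nil.
Qed.

Lemma has_integral_compression f J I : has_integral G f J -> compression V J I ->
    has_integral E f I.
Proof.
have [iV _ _] := dil => h c e e0; have [s [ms s1 s2]] := h _ e0.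
exists s; split=> // u; rewrite -(isometry_rnorm iV u); apply: le_trans (s2 _).
exact: (compression_le iV u c (simple_op_compression ms)).
Qed.

Lemma dil_simple_op_bound s A Z (C B e : R) u : simple_measurable s -> measurable A ->
    measurable Z ->
  0 <= C -> 0 <= B -> 0 <= e ->
  (forall x, A x -> rnorm (simple_fun s x) <= C) ->
  (forall x, ~ A x -> Z x -> rnorm (simple_fun s x) <= B) ->
  (forall x, ~ A x -> ~ Z x -> rnorm (simple_fun s x) <= e) ->
  rnorm (simple_op E s u) <= C * Num.sqrt (mass E A u) + B * Num.sqrt (mass E Z u) + e * rnorm u.
Proof.
have [iV spG _] := dil => ms mA mZ C0 B0 e0 h1 h2 h3.
apply: le_trans (simple_op_rnorm _ ms) _.
have a0 := sqrtr_ge0 (mass E A u); have b0 := sqrtr_ge0 (mass E Z u); have u0 := rnorm_ge0 u.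
rewrite -(@ler_pXn2r _ 2)// ?nnegrE ?rnorm_ge0//; last by rewrite !addr_ge0// mulr_ge0.
apply: le_trans (@simple_op_bound _ _ _ _ _ spG s A Z C B e (V u) ms mA mZ _) _; last first.
  rewrite -!massE_dil// (isometry_rnorm iV).
  rewrite -{1}(sqr_sqrtr (dil_mass_ge0 u mA)) -{1}(sqr_sqrtr (dil_mass_ge0 u mZ)) -!exprMn.
  move: (mulr_ge0 C0 a0) (mulr_ge0 B0 b0) (mulr_ge0 e0 u0); nra.
move=> x; have r0 := rnorm_ge0 (simple_fun s x).
have sq c : rnorm (simple_fun s x) <= c -> 0 <= c -> rnorm (simple_fun s x) ^+ 2 <= c ^+ 2.
  by move=> *; rewrite ler_pXn2r ?nnegrE.
have := sqr_ge0 B; have := sqr_ge0 e; have := sqr_ge0 C.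
have [xA|xA] := pselect (A x); have [xZ|xZ] := pselect (Z x).
- rewrite !mem_set// !mulr1; have := sq _ (h1 _ xA) C0; lra.
- rewrite mem_set// memNset// mulr1 mulr0; have := sq _ (h1 _ xA) C0; lra.
- rewrite memNset// mem_set// mulr1 mulr0; have := sq _ (h2 _ xA xZ) B0; lra.
- rewrite !memNset// !mulr0; have := sq _ (h3 _ xA xZ) e0; lra.
Qed.

(** Three zones with separate bounds on the integrand. Below, [A] is a set of small or zero mass,
    [Z] is empty or the diagonal, and the rest is charged to the whole mass of [u]; a zone without
    mass costs nothing, however large its bound. *)
Lemma has_integral_bound f I A Z (C B e : R) u : has_integral E f I -> measurable A ->
    measurable Z ->
  0 <= C -> 0 <= B -> 0 <= e ->
  (forall x, A x -> rnorm (f x) <= C) ->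
  (forall x, ~ A x -> Z x -> rnorm (f x) <= B) ->
  (forall x, ~ A x -> ~ Z x -> rnorm (f x) <= e) ->
  rnorm (I u) <= C * Num.sqrt (mass E A u) + B * Num.sqrt (mass E Z u) + e * rnorm u.
Proof.
move=> hf mA mZ C0 B0 e0 h1 h2 h3.
have a0 := sqrtr_ge0 (mass E A u); have b0 := sqrtr_ge0 (mass E Z u); have u0 := rnorm_ge0 u.
apply: (@ler_small _ _ _ (Num.sqrt (mass E A u) + Num.sqrt (mass E Z u) + rnorm u + rnorm u)).
  by rewrite !addr_ge0.
move=> q q0; have [s [ms s1 s2]] := hf _ q0.
have sq x c : rnorm (f x) <= c -> rnorm (simple_fun s x) <= c + q.
  move=> fc; rewrite -[simple_fun s x](subrK (f x)) addrC.
  by apply: le_trans (rnormD _ _) _; rewrite lerD// rnormB.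
have := @dil_simple_op_bound s A Z (C + q) (B + q) (e + q) u ms mA mZ.
have q0' := ltW q0; rewrite !addr_ge0// => /(_ isT isT isT) h.
have {}h := h (fun x xA => sq _ _ (h1 x xA)) (fun x xA xZ => sq _ _ (h2 x xA xZ))
  (fun x xA xZ => sq _ _ (h3 x xA xZ)).
rewrite -[I u](subrK (simple_op E s u)); apply: le_trans (rnormD _ _) _.
have := s2 u; lra.
Qed.

Lemma has_integral_le f I e u : has_integral E f I -> 0 <= e -> (forall x, rnorm (f x) <= e) ->
  rnorm (I u) <= e * rnorm u.
Proof.
move=> hf e0 h.
have := @has_integral_bound f I set0 set0 0 0 e u hf measurable0 measurable0 (lexx _) (lexx _) e0.
by rewrite !mul0r !add0r; apply.
Qed.

Lemma simple_op_le s e u : simple_measurable s -> 0 <= e -> (forall x, rnorm (simple_fun s x)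
    <= e) ->
  rnorm (simple_op E s u) <= e * rnorm u.
Proof.
move=> ms e0 h.
have := @dil_simple_op_bound s set0 set0 0 0 e u ms measurable0 measurable0 (lexx _) (lexx _) e0.
by rewrite !mul0r !add0r; apply.
Qed.

Lemma simple_op_sub_le s t e u : simple_measurable s -> simple_measurable t -> 0 <= e ->
  (forall x, rnorm (simple_fun s x - simple_fun t x) <= e) ->
  rnorm (simple_op E s u - simple_op E t u) <= e * rnorm u.
Proof.
move=> ms mt e0 h; rewrite -scaleN1r -simple_op_scale -simple_op_cat.
apply: simple_op_le => //; first by apply: simple_measurable_cat => //; exact:
    simple_measurable_scale.
by move=> x; rewrite simple_fun_cat simple_fun_scale mulN1r.
Qed.

Lemma has_integral_exists f :
  (forall e : R, 0 < e -> exists s, simple_measurable s /\ forall x, rnorm (f x - simple_fun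
      s x) <= e) ->
  exists I, has_integral E f I.
Proof.
move=> h.
have h' n : {s | simple_measurable s /\ forall x, rnorm (f x - simple_fun s x) <= n.+1%:R^-1}.
  by apply: cid; apply: h; rewrite invr_gt0.
pose s n := projT1 (h' n).
have ms n : simple_measurable (s n) by have [] := projT2 (h' n).
have hs n x : rnorm (f x - simple_fun (s n) x) <= n.+1%:R^-1 by have [_] := projT2 (h' n).
have [|I hI] := @op_limit _ H H (fun n => simple_op E (s n)).
  move=> n m u; apply: simple_op_sub_le => // x.
  rewrite -(subrK (f x) (simple_fun (s n) x)) -addrA.
  by apply: le_trans (rnormD _ _) _; rewrite lerD// rnormB.
exists I => e e0; have [n /(_ n (leqnn n)) hn] := inv_small e0.
exists (s n); split => // [x|u]; first exact: le_trans (hs _ _) (ltW hn).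
by apply: le_trans (hI _ _) _; rewrite ler_wpM2r ?rnorm_ge0// ltW.
Qed.

Lemma dil_selfadj D u v : measurable D -> inner (E D u) v = inner u (E D v).
Proof.
have [_ [ssG _] _] := dil => mD.
by rewrite dilE// (semispectral_selfadj ssG)// inner_conj -dilE// -inner_conj.
Qed.

Lemma simple_op_adj s u v : simple_measurable s -> inner (simple_op E s u) v = inner u
    (simple_op E (simple_conj s) v).
Proof.
move=> ms; rewrite /simple_op big_map inner_suml inner_sumr; apply: eq_big_seq => p ps /=.
by rewrite innerZl innerZr conjCK dil_selfadj//; exact: ms.
Qed.

Lemma has_integral_adj f I J u v : has_integral E f I -> has_integral E (fun x => (f x)^*) J ->
  inner (I u) v = inner u (J v).
Proof.
move=> hI hJ; apply/eqP; rewrite -subr_eq0; apply/eqP.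
(* [4 = 1 + 2 + 1]: an error [e] for each integral, and [2 * e] between [simple_conj s] and [t],
   which both approximate the conjugate of [f]. *)
apply: (@rnorm_small _ _ _ (4 * (rnorm u * rnorm v))) => e e0.
have [s [ms s1 s2]] := hI _ e0; have [t [mt t1 t2]] := hJ _ e0.
have h : rnorm (simple_op E (simple_conj s) v - simple_op E t v) <= (2 * e) * rnorm v.
  apply: simple_op_sub_le => //; first exact: simple_measurable_conj.
    by rewrite mulr_ge0// ltW.
  move=> x; rewrite simple_fun_conj -(subrK (f x)^* (simple_fun s x)^*) -addrA -rmorphB.
  apply: le_trans (rnormD _ _) _; rewrite rnorm_conj rnormB.
  have := s1 x; have := t1 x; lra.
have -> : inner (I u) v - inner u (J v) = inner (I u - simple_op E s u) v +
    (inner u (simple_op E (simple_conj s) v - simple_op E t v) - inner u (J v - simple_op E t v)).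
  by rewrite innerBl (simple_op_adj _ _ ms) !innerBr; ring.
set a := inner _ v; set b := inner u (simple_op _ _ _ - _); set g := inner u (_ - _).
have ha : rnorm a <= e * (rnorm u * rnorm v).
  by apply: le_trans (rnorm_inner _ _) _; rewrite mulrA ler_wpM2r ?rnorm_ge0.
have hb : rnorm b <= 2 * e * (rnorm u * rnorm v).
  apply: le_trans (rnorm_inner _ _) _; rewrite mulrCA ler_wpM2l ?rnorm_ge0//.
have hg : rnorm g <= e * (rnorm u * rnorm v).
  apply: le_trans (rnorm_inner _ _) _; rewrite mulrCA ler_wpM2l ?rnorm_ge0//.
apply: le_trans (rnormD _ _) _.
have := rnormD b (- g); rewrite rnormN; lra.
Qed.

End Dilation.

Section SpectralPower.
Context (R : realType) (d : measure_display) (X : measurableType d).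
Variables (K : hilbertType R[i]) (G : set X -> K -> K).
Hypothesis spG : spectral_measure G.

Lemma spectral_dilation_id : spectral_dilation G id G.
Proof.
split; [by split|exact: spG|by move=> D mD u v; rewrite subrr inner0l].
Qed.

Lemma has_integral_mul f g I J : (forall x, rnorm (f x) <= 1) -> (forall x, rnorm (g x) <= 1) ->
  has_integral G f I -> has_integral G g J -> has_integral G (fun x => f x * g x) (I \o J).
Proof.
move=> f1 g1 hf hg e e0.
(* [q <= 1] absorbs the quadratic error and bounds [simple_fun s] by [2]; the errors of the function
   and of the operator are then each at most [3 * q]. *)
pose q := Num.min 1 (e / 3).
have q0 : 0 < q by rewrite lt_min ltr01 divr_gt0.
have q1 : q <= 1 by rewrite ge_min lexx.
have qe : 3 * q <= e by have : q <= e / 3 by [rewrite ge_min lexx orbT]; lra.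
have [s [ms s1 s2]] := hf _ q0; have [t [mt t1 t2]] := hg _ q0.
exists (simple_prod s t); split; first exact: simple_measurable_prod.
- move=> x; rewrite simple_fun_prod.
  have -> : f x * g x - simple_fun s x * simple_fun t x =
    (f x - simple_fun s x) * g x + (f x * (g x - simple_fun t x) - (f x - simple_fun s x) *
        (g x - simple_fun t x)) by ring.
  apply: le_trans (rnormD _ _) _; apply: le_trans (lerD (lexx _) (rnormD _ _)) _.
  rewrite rnormN !rnormM; apply: le_trans qe.
  move: (s1 x) (t1 x) (f1 x) (g1 x) (rnorm_ge0 (f x)) (rnorm_ge0 (g x))
    (rnorm_ge0 (f x - simple_fun s x)) (rnorm_ge0 (g x - simple_fun t x)); nra.
- move=> u; rewrite /= (simple_op_prod spG)//.
  have bs : rnorm (simple_op G s (J u - simple_op G t u)) <= 2 * rnorm (J u - simple_op G t u).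
    apply: (simple_op_le spectral_dilation_id) => // x.
    rewrite -[simple_fun s x](subrK (f x)); apply: le_trans (rnormD _ _) _.
    rewrite rnormB; have := s1 x; have := f1 x; lra.
  have sB : simple_op G s (J u - simple_op G t u) = simple_op G s (J u) - simple_op G s
      (simple_op G t u).
    rewrite /simple_op -sumrB; apply: eq_big_seq => p ps; rewrite -scalerBr.
    have [ssG _] := spG; have [lG _] := semispectral_bounded ssG (ms _ ps).
    by rewrite -scaleN1r addrC lG scaleN1r addrC.
  rewrite -[I (J u)](subrK (simple_op G s (J u))) -addrA -sB.
  have J1 := has_integral_le spectral_dilation_id u hg ler01 g1.
  apply: le_trans (rnormD _ _) _.
  have := s2 (J u); have := t2 u; have := rnorm_ge0 u.
  move: J1 bs qe; rewrite mul1r; nra.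
Qed.

Lemma has_integral1 : has_integral G (fun=> 1) id.
Proof.
have := has_integral_indic G measurableT; have [[_ _ -> _] _] := spG.
by congr has_integral; apply: funext => x; rewrite indicE_bool in_setT.
Qed.

Lemma has_integral_pow f I n : (forall x, rnorm (f x) = 1) -> has_integral G f I ->
  has_integral G (fun x => f x ^+ n) (iter n I).
Proof.
move=> f1 hf; elim: n => [|n IH]; first exact: has_integral1.
have := has_integral_mul _ _ hf IH; have -> : (fun x => f x * f x ^+ n) = fun x => f x ^+ n.+1.
  by apply: funext => x; rewrite exprS.
by apply=> x; rewrite ?rnormX f1 ?expr1n.
Qed.

End SpectralPower.

(** * The diagonal part of a double operator integral *)

Section HilbertSchmidtOperators.
Context (R : realType) (H : hilbertType R[i]).

Lemma hs_ext (A B : hsType H) : (forall u, A u = B u) -> A = B.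
Proof. by move=> h; apply: val_inj; apply: funext. Qed.

Lemma hs_val_sum T (r : seq T) (a : T -> R[i]) (A : T -> hsType H) u :
  (\sum_(i <- r) a i *: A i) u = \sum_(i <- r) a i *: A i u.
Proof. by elim: r => [|i r IH]; rewrite ?big_nil// !big_cons -IH. Qed.

Lemma hs_comp (Q S : H -> H) : bounded_operator Q -> hilbert_schmidt S ->
  hilbert_schmidt (Q \o S).
Proof.
move=> bQ hS; have [bS _] := hS.
have [M M0 hM] := bounded_rnorm bQ; have [N N0 hN] := bounded_rnorm bS.
have bQS : bounded_operator (Q \o S).
  split=> [a u v|]; first by rewrite /= bounded_operatorZD// bounded_operatorZD.
  exists (M * N)%:C%C => u; rewrite -!rnormE -rmorphM lecR -mulrA.
  by apply: le_trans (hM _) _; rewrite ler_wpM2l.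
apply: (@proj1 _ _ (@bounded_operator_hs _ _ _ bQS (M ^+ 2 * hs_sq S) _)) => s sB.
apply: (@le_trans _ _ (\sum_(e <- s) M ^+ 2 * rnorm (S e) ^+ 2)).
  apply: ler_sum => e _; rewrite -exprMn.
  by rewrite ler_pXn2r ?nnegrE ?mulr_ge0 ?rnorm_ge0//=.
by rewrite -mulr_sumr ler_wpM2l ?sqr_ge0// sum_le_hs_sq.
Qed.

Lemma rank_one_hs (e : H) : hilbert_schmidt (fun u => inner u e *: e).
Proof.
have lin : bounded_operator (fun u => inner u e *: e).
  split=> [a u v|]; first by rewrite innerDl innerZl scalerDl scalerA.
  exists (`|e| * `|e|) => u; rewrite normrZ mulrAC ler_wpM2r//.
  by rewrite mulrC inner_CS.
apply: (@proj1 _ _ (@bounded_operator_hs _ _ _ lin (rnorm e ^+ 2 * rnorm e ^+ 2) _)) => s sB.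
rewrite (eq_bigr (fun x => rnorm e ^+ 2 * rnorm (inner e x) ^+ 2)); last first.
  by move=> x _; rewrite rnorm_scale exprMn mulrC inner_conj rnorm_conj.
rewrite -mulr_sumr ler_wpM2l ?sqr_ge0//.
rewrite -lecR rmorph_sum rmorphXn/= rnormE.
under eq_bigr do rewrite rmorphXn/= rnormE.
exact: bessel.
Qed.

Lemma hs_eq0_onb (A : hsType H) : (forall e, onb H e -> A e = 0) -> A = 0.
Proof.
move=> h; apply: hs_dot_eq0; rewrite /hs_dot hs_inner_self; congr (_%:C)%C.
by rewrite /hs_sq esum1// => e /h ->; rewrite rnorm0 expr0n.
Qed.

(** The sum defining [inner A B] reduces to one term, [rnorm (B e) ^+ 2]. The lemma serves with [A]
    the composition of [B] and the rank one projection onto [e]. *)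
Lemma hs_inner_single (A B : hsType H) (e : H) : onb H e ->
  (forall x, onb H x -> x != e -> A x = 0) -> A e = B e -> inner A B = 0 -> B e = 0.
Proof.
move=> oe h Ae /(congr1 (@complex.Re R)).
rewrite -[inner A B]/(hs_inner A B) /hs_inner /=.
have Ax x : onb H x -> x != e -> complex.Re (inner (A x) (B x)) = 0.
  by move=> ox xe; rewrite h// inner0l.
have Aee : complex.Re (inner (A e) (B e)) = rnorm (B e) ^+ 2 by rewrite Ae rnorm_sq.
have pos x : onb H x -> 0 <= complex.Re (inner (A x) (B x)).
  by move=> ox; have [->|xe] := eqVneq x e; [rewrite Aee sqr_ge0|rewrite Ax].
rewrite rsum_ge0E// => h0; apply: rnorm_eq0; apply/eqP.
rewrite -sqrf_eq0 eq_le sqr_ge0 andbT -h0 -Aee.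
rewrite -[leLHS](big_seq1 +%R e (fun x => complex.Re (inner (A x) (B x)))).
apply: sum_le_fine_esum => //; last by move=> x; rewrite inE => /eqP ->.
have := hs_rsummable (@Re_le R) (hsP A) (hsP B).
apply: esum_le_fin => x _; exact: ler_norm.
Qed.

End HilbertSchmidtOperators.

Section MoreIntegral.
Context (R : realType) (d : measure_display) (X : measurableType d).
Context (H K : hilbertType R[i]) (V : H -> K).
Variables (E : set X -> H -> H) (G : set X -> K -> K).
Hypothesis dil : spectral_dilation E V G.
Implicit Types (s t : seq (R[i] * set X)) (f g : X -> R[i]).

Lemma has_integral_simple s : simple_measurable s -> has_integral E (simple_fun s) (simple_op E s).
Proof.
move=> ms e e0; exists s; split=> // [x|u]; rewrite subrr rnorm0 ?(ltW e0)//.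
by rewrite mulr_ge0 ?rnorm_ge0// ltW.
Qed.

Lemma has_integral_approx f I s e u : has_integral E f I -> simple_measurable s -> 0 <= e ->
  (forall x, rnorm (f x - simple_fun s x) <= e) -> rnorm (I u - simple_op E s u) <= e * rnorm u.
Proof.
move=> hf ms e0 h.
have := has_integral_le dil u (has_integral_lin (-1) (has_integral_simple ms) hf) e0.
rewrite scaleN1r addrC; apply=> x.
by rewrite mulN1r addrC.
Qed.

Lemma has_integral_fbound f I : has_integral E f I -> exists2 C, 0 <= C & forall x, rnorm (f
    x) <= C.
Proof.
move=> hf; have [s [_ hs _]] := hf 1 ltr01; have [M M0 hM] := simple_fun_bound s.
exists (1 + M) => [|x]; first by rewrite addr_ge0.
rewrite -[f x](subrK (simple_fun s x)); apply: le_trans (rnormD _ _) _.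
by rewrite lerD.
Qed.

(** A dilation only prescribes the inner products of the values of [E D]; linearity follows because
    these make [E D] symmetric. *)
Lemma dil_linear D : measurable D -> linear (E D).
Proof.
have [_ [ssG _] _] := dil => mD a u v; apply: inner_inj => w.
by rewrite innerDl innerZl !(dil_selfadj dil)// innerDl innerZl.
Qed.

Lemma simple_op_linear s : simple_measurable s -> linear (simple_op E s).
Proof.
move=> ms a u v; rewrite /simple_op scaler_sumr -big_split; apply: eq_big_seq => p ps /=.
by rewrite dil_linear ?scalerDr ?scalerA 1?mulrC//; exact: ms.
Qed.

(** Applied to the integral of [z], this produces [Y], which [has_integral_adj] identifies as the
    adjoint of [T]. *)
Lemma has_integral_conj f I : has_integral E f I -> exists J, has_integral E (fun x => (f x)^*) J.
Proof.
move=> hf; apply: (has_integral_exists dil) => e e0; have [s [ms hs _]] := hf _ e0.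
exists (simple_conj s); split; first exact: simple_measurable_conj.
by move=> x; rewrite simple_fun_conj -rmorphB rnorm_conj.
Qed.

(** As [E] need not be multiplicative, the powers of [Y] are not integrals for an algebraic reason.
    Both [iter n Y] and the integral of the conjugate power are adjoint to [iter n T], which
    determines them. *)
Lemma has_integral_conj_pow (z : X -> R[i]) T Y :
  (forall n, has_integral E (fun x => z x ^+ n) (iter n T)) ->
  has_integral E (fun x => (z x)^*) Y ->
  forall n, has_integral E (fun x => (z x)^* ^+ n) (iter n Y).
Proof.
move=> hT hY n; have [J hJ] := has_integral_conj (hT n).
have {}hJ : has_integral E (fun x => (z x)^* ^+ n) J.
  by move: hJ; congr has_integral; apply: funext => x; rewrite rmorphXn.
suff -> : iter n Y = J by [].
apply: funext => u; apply: inner_inj => v.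
have hT' : has_integral E (fun x => ((z x)^* ^+ n)^*) (iter n T).
  have := hT n; congr has_integral; apply: funext => x.
  by rewrite rmorphXn/= conjCK.
rewrite (has_integral_adj dil u v hJ hT').
have hT1 : has_integral E (fun x => ((z x)^*)^*) T.
  by have := hT 1%N; congr has_integral; apply: funext => x; rewrite conjCK expr1.
elim: n u v {hJ J hT'} => // n IH u v.
by rewrite iterS iterSr (has_integral_adj dil _ _ hY hT1) IH.
Qed.

End MoreIntegral.

(** * Integrals over the product, and the projection onto the diagonal *)

Section Double.
Context (R : realType) (d : measure_display) (X : measurableType d).
Context (H K : hilbertType R[i]) (V : H -> K).
Variables (E : set X -> H -> H) (G : set X -> K -> K).
Hypothesis dil : spectral_dilation E V G.
Context (L : hilbertType R[i]) (W : hsType H -> L).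
Variables (F : set (X * X) -> hsType H -> hsType H) (G2 : set (X * X) -> L -> L).
Hypothesis dil2 : spectral_dilation F W G2.
Hypothesis dF : double_semispectral_measure E E F.
Variables (z : X -> R[i]) (T Y : H -> H).
Hypothesis z1 : forall x, rnorm (z x) = 1.
Hypothesis hT : forall n, has_integral E (fun x => z x ^+ n) (iter n T).
Hypothesis hY : has_integral E (fun x => (z x)^*) Y.
Hypothesis bT : bounded_operator T.
Implicit Types (s t : seq (R[i] * set X)) (S : hsType H).

Definition simple_tensor s t : seq (R[i] * set (X * X)) :=
  [seq (p.1 * q.1, p.2 `*` q.2) | p <- s, q <- t].

Lemma simple_measurable_tensor s t : simple_measurable s -> simple_measurable t ->
    simple_measurable (simple_tensor s t).
Proof.
move=> ms mt p /allpairsP[[q r] /= [qs rt ->]] /=.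
by apply: measurableX; [exact: ms|exact: mt].
Qed.

Lemma simple_fun_tensor s t p : simple_fun (simple_tensor s t) p = simple_fun s p.1 *
    simple_fun t p.2.
Proof.
rewrite /simple_fun big_allpairs_dep mulr_suml; apply: eq_bigr => a _.
rewrite mulr_sumr; apply: eq_bigr => b _ /=.
rewrite !indicE_bool.
have -> : (p \in a.2 `*` b.2) = (p.1 \in a.2) && (p.2 \in b.2) by case: p => x y; exact: in_setX.
by rewrite -mulnb natrM; ring.
Qed.

Lemma simple_op_tensor s t S u : simple_measurable s -> simple_measurable t ->
  (simple_op F (simple_tensor s t) S) u = simple_op E s (S (simple_op E t u)).
Proof.
move=> ms mt; rewrite /simple_op big_allpairs_dep.
have [_ hF] := dF; have [bS _] := hsP S.
rewrite (bounded_operator_sum _ _ bS).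
have -> : (\sum_(i <- s) \sum_(j <- t) (i.1 * j.1, i.2 `*` j.2).1 *: F (i.1 * j.1, i.2 `*`
    j.2).2 S) u
  = \sum_(i <- s) \sum_(j <- t) (i.1 * j.1) *: (F (i.2 `*` j.2) S) u.
  elim: (s) => [|i r IH]; first by rewrite !big_nil.
  by rewrite !big_cons -IH -hs_val_sum.
apply: eq_big_seq => p ps.
have lE := dil_linear dil (ms _ ps).
have lE0 : E p.2 0 = 0 by have := lE (-1) 0 0; rewrite scaleN1r addNr scaleN1r addNr.
have -> : E p.2 (\sum_(i <- t) S (i.1 *: E i.2 u)) = \sum_(i <- t) i.1 *: E p.2 (S (E i.2 u)).
  elim: (t) => [|i r IH]; first by rewrite !big_nil.
  by rewrite !big_cons (bounded_operatorZ _ _ bS) lE IH.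
rewrite scaler_sumr; apply: eq_big_seq => q qt.
by rewrite scalerA hF//; [exact: ms|exact: mt].
Qed.

(** A product integrand is approximated by tensor products of simple functions, whose integrals are
    known from the values of [F] on rectangles. The bounds by [1] keep the errors of the products
    linear in [e]. *)
Lemma has_integral_double a b A B : (forall x, rnorm (a x) <= 1) -> (forall x, rnorm (b x) <= 1) ->
  has_integral E a A -> has_integral E b B ->
  exists I, has_integral F (fun p => a p.1 * b p.2) I /\ forall S u, I S u = A (S (B u)).
Proof.
move=> a1 b1 hA hB.
have app e : 0 < e -> e <= 1 -> exists s t, [/\ simple_measurable s, simple_measurable t,
    forall u, rnorm (A u - simple_op E s u) <= e * rnorm u,
    forall u, rnorm (B u - simple_op E t u) <= e * rnorm u &
    (forall x, rnorm (simple_fun s x) <= 2) /\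
    forall p, rnorm (a p.1 * b p.2 - simple_fun (simple_tensor s t) p) <= 3 * e].
  move=> e0 e1; have [s [ms s1 s2]] := hA _ e0; have [t [mt t1 t2]] := hB _ e0.
  exists s, t; split=> //.
  have ss x : rnorm (simple_fun s x) <= 2.
    rewrite -[simple_fun s x](subrK (a x)); apply: le_trans (rnormD _ _) _.
    rewrite rnormB; have := s1 x; have := a1 x; lra.
  split=> // p; rewrite simple_fun_tensor.
  have -> : a p.1 * b p.2 - simple_fun s p.1 * simple_fun t p.2 =
    (a p.1 - simple_fun s p.1) * b p.2 + simple_fun s p.1 * (b p.2 - simple_fun t p.2) by ring.
  apply: le_trans (rnormD _ _) _; rewrite !rnormM.
  move: (s1 p.1) (t1 p.2) (b1 p.2) (ss p.1) (rnorm_ge0 (simple_fun s p.1)) (rnorm_ge0 (b p.2))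
    (rnorm_ge0 (a p.1 - simple_fun s p.1)) (rnorm_ge0 (b p.2 - simple_fun t p.2)); nra.
have [I hI] : exists I, has_integral F (fun p => a p.1 * b p.2) I.
  apply: (has_integral_exists dil2) => e e0.
  have q0 : 0 < Num.min 1 (e / 3) by rewrite lt_min ltr01 divr_gt0.
  have [|s [t [ms mt _ _ [_ h]]]] := app _ q0; first by rewrite ge_min lexx.
  exists (simple_tensor s t); split; first exact: simple_measurable_tensor.
  move=> p; apply: le_trans (h p) _.
  by rewrite mulrC -ler_pdivlMr// ge_min lexx orbT.
exists I; split=> // S u; apply/eqP; rewrite -subr_eq0; apply/eqP.
(* [6 = 3 + 1 + 2]: the approximation of [I], then that of [A], then that of [B] seen through a
   simple operator of norm at most [2]. *)
apply: (@rnorm_small _ _ _ (6 * (rnorm S * rnorm u))) => e e0.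
have [q [q0 q1 qe]] : exists q : R, [/\ 0 < q, q <= 1 & q <= e].
  by exists (Num.min 1 e); rewrite lt_min ltr01 e0 !ge_min !lexx orbT.
have [s [t [ms mt hs ht [ss h]]]] := app _ q0 q1.
have q3 : 0 <= 3 * q by rewrite mulr_ge0// ltW.
have := has_integral_approx dil2 S hI (simple_measurable_tensor ms mt) q3 h => h1.
have h2 : rnorm ((I S - simple_op F (simple_tensor s t) S) u) <= 3 * q * rnorm S * rnorm u.
  by apply: le_trans (hs_op_norm _ _) _; rewrite ler_wpM2r ?rnorm_ge0.
have bS := (hsP S).1.
have lS v w : S (v - w) = S v - S w.
  by have [lS _] := bS; rewrite -scaleN1r addrC lS scaleN1r addrC.
have ls v w : simple_op E s (v - w) = simple_op E s v - simple_op E s w.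
  by rewrite -scaleN1r addrC (simple_op_linear dil ms) scaleN1r addrC.
have -> : I S u - A (S (B u)) = (I S - simple_op F (simple_tensor s t) S) u
   - ((A (S (B u)) - simple_op E s (S (B u))) + simple_op E s (S (B u - simple_op E t u))).
  rewrite lS ls (_ : (I S - _) u = I S u - simple_op E s (S (simple_op E t u))); last first.
    by rewrite -simple_op_tensor.
  by rewrite [in RHS]addrA subrK opprB [RHS]addrA subrK.
have h3 : rnorm (A (S (B u)) - simple_op E s (S (B u))) <= q * (rnorm S * rnorm u).
  apply: le_trans (hs _) _; rewrite ler_wpM2l ?(ltW q0)//.
  apply: le_trans (hs_op_norm _ _) _; rewrite ler_wpM2l ?rnorm_ge0//.
  by have := has_integral_le dil u hB ler01 b1; rewrite mul1r.
have h4 : rnorm (simple_op E s (S (B u - simple_op E t u))) <= 2 * (q * (rnorm S * rnorm u)).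
  apply: le_trans (simple_op_le dil _ ms (ler0n _ 2) ss) _; rewrite ler_wpM2l//.
  apply: le_trans (hs_op_norm _ _) _; rewrite mulrCA ler_wpM2l ?rnorm_ge0//.
apply: le_trans (rnormD _ _) _; rewrite rnormN.
apply: le_trans (lerD h2 (rnormD _ _)) _.
have := mulr_ge0 (rnorm_ge0 S) (rnorm_ge0 u).
move: h3 h4; rewrite -mulrA; set w := rnorm S * rnorm u => h3 h4 w0.
have := ler_wpM2r w0 qe; lra.
Qed.

Let zc_pow n x : rnorm (z x ^+ n) <= 1.
Proof. by rewrite rnormX z1 expr1n. Qed.

Let zcj_pow n x : rnorm ((z x)^* ^+ n) <= 1.
Proof. by rewrite rnormX rnorm_conj z1 expr1n. Qed.

Let T_le n u : rnorm (iter n T u) <= rnorm u.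
Proof. by have := has_integral_le dil u (hT n) ler01 (zc_pow n); rewrite mul1r. Qed.

Let hYn := has_integral_conj_pow dil hT hY.

Let Y_le n u : rnorm (iter n Y u) <= rnorm u.
Proof. by have := has_integral_le dil u (hYn n) ler01 (zcj_pow n); rewrite mul1r. Qed.

Lemma has_integral_monomial i j : exists I,
  has_integral F (fun p => z p.1 ^+ i * z p.2 ^+ j) I /\
  forall S u, I S u = iter i T (S (iter j T u)).
Proof. exact: (has_integral_double (zc_pow i) (zc_pow j) (hT i) (hT j)). Qed.

Lemma has_integral_ratio : exists M : nat -> hsType H -> hsType H,
  forall n, has_integral F (fun p => (z p.1 * (z p.2)^*) ^+ n) (M n) /\
  forall S u, M n S u = iter n T (S (iter n Y u)).
Proof.
have h n : {I | has_integral F (fun p => (z p.1 * (z p.2)^*) ^+ n) I /\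
    forall S u, I S u = iter n T (S (iter n Y u))}.
  apply: cid.
  have [I [hI IE]] := has_integral_double (zc_pow n) (zcj_pow n) (hT n) (hYn n).
  exists I; split=> //; move: hI; congr has_integral; apply: funext => p.
  by rewrite exprMn.
by exists (fun n => projT1 (h n)) => n; exact: (projT2 (h n)).
Qed.

Variable ratio_op : nat -> hsType H -> hsType H.
Hypothesis ratioP : forall n, has_integral F (fun p => (z p.1 * (z p.2)^*) ^+ n) (ratio_op n) /\
  forall S u, ratio_op n S u = iter n T (S (iter n Y u)).

(** Cesaro mean of the operators [T^k S Y^k], that is, the integral of the Cesaro mean of the powers
    of [z p.1 * (z p.2)^*]. *)
Definition ergodic_mean n S : hsType H :=
  \sum_(k < n.+1) (n.+1%:R^-1 : R[i]) *: ratio_op k S.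

Lemma ergodic_meanE n S u :
  ergodic_mean n S u = \sum_(k < n.+1) (n.+1%:R^-1 : R[i]) *: iter k T (S (iter k Y u)).
Proof.
rewrite /ergodic_mean hs_val_sum; apply: eq_bigr => k _.
by have [_ ->] := ratioP k.
Qed.

Definition diag : set (X * X) := [set p | z p.1 = z p.2].
Definition near_diag (n : nat) : set (X * X) :=
  [set p | rnorm (z p.1 - z p.2) <= n.+1%:R^-1].

(** Integrating [z p.1 - z p.2] gives the commutator with [T]. A function vanishing on the diagonal
    thus governs commutation, and its sublevel sets are the bands [near_diag]. *)
Lemma has_integral_difference : exists I, has_integral F (fun p => z p.1 - z p.2) I /\
  forall S u, I S u = T (S u) - S (T u).
Proof.
have [I [hI IE]] := has_integral_monomial 1 0; have [J [hJ JE]] := has_integral_monomial 0 1.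
exists (fun S => (-1 : R[i]) *: J S + I S); split.
  have := has_integral_lin (-1) hJ hI; congr has_integral; apply: funext => p.
  by rewrite !expr0 !expr1 mul1r mulr1 mulN1r addrC.
move=> S u; rewrite -[LHS]/(-1 *: J S u + I S u) IE JE.
by rewrite scaleN1r addrC.
Qed.

Lemma has_integral_difference_conj : exists I, has_integral F (fun p => (z p.1)^* - (z p.2)^*) I /\
  forall S u, I S u = Y (S u) - S (Y u).
Proof.
have one : has_integral E (fun=> 1) id by have := hT 0; congr has_integral; apply: funext =>
    x; rewrite expr0.
have l1 (x : X) : rnorm (1 : R[i]) <= 1 by rewrite rnorm1.
have zc x : rnorm ((z x)^*) <= 1 by rewrite rnorm_conj z1.
have [I [hI IE]] := has_integral_double zc l1 hY one; have [J [hJ JE]] := has_integral_double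
    l1 zc one hY.
exists (fun S => (-1 : R[i]) *: J S + I S); split.
  have := has_integral_lin (-1) hJ hI; congr has_integral; apply: funext => p.
  by rewrite mul1r mulr1 mulN1r addrC.
move=> S u; rewrite -[LHS]/(-1 *: J S u + I S u) IE JE.
by rewrite scaleN1r addrC.
Qed.

Lemma measurable_near_diag n : measurable (near_diag n).
Proof. by have [I [hI _]] := has_integral_difference; exact: measurable_has_integral_le hI. Qed.

Lemma measurable_diag : measurable diag.
Proof.
have [I [hI _]] := has_integral_difference.
rewrite (_ : diag = [set p | rnorm (z p.1 - z p.2) <= 0]).
  exact: measurable_has_integral_le hI.
apply/seteqP; split=> p /=; first by rewrite /diag/= => ->; rewrite subrr rnorm0.
move=> h; apply/eqP; rewrite -subr_eq0; apply/eqP/rnorm_eq0/eqP.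
by rewrite eq_le h rnorm_ge0.
Qed.

(** The bands without the diagonal decrease to the empty set, so this is continuity from above. The
    square root is the form in which [has_integral_bound] uses the mass. *)
Lemma mass_near_diag S (e : R) : 0 < e ->
  exists n, Num.sqrt (mass F (near_diag n `\` diag) S) <= e.
Proof.
move=> e0; have [ssF _] := dF.
have [|n|||n hn] := @mass_decr _ _ _ _ _ ssF (fun n => near_diag n `\` diag) S _ _ _ (e ^+ 2).
- move=> n; apply: measurableD; [exact: measurable_near_diag|exact: measurable_diag].
- move=> p [np dp]; split=> //; apply: le_trans np _.
  by rewrite lef_pV2 ?posrE// ler_nat.
- rewrite -subset0 => p h; have [_ dp] := h 0 Logic.I; apply: dp.
  apply/eqP; rewrite -subr_eq0; apply/eqP; apply: (@rnorm_small _ _ _ 1) => q q0.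
  have [n /(_ n (leqnn n)) hn] := inv_small q0; rewrite mulr1.
  by have [nd _] := h n Logic.I; exact: le_trans nd (ltW hn).
- by rewrite exprn_gt0.
exists n; rewrite -(@ler_pXn2r _ 2)// ?nnegrE ?sqrtr_ge0 ?(ltW e0)//.
rewrite sqr_sqrtr ?(ltW hn)//.
apply: (dil_mass_ge0 dil2).
by apply: measurableD; [exact: measurable_near_diag|exact: measurable_diag].
Qed.

Let ratio (p : X * X) : R[i] := z p.1 * (z p.2)^*.

Let mean_fun n (p : X * X) : R[i] := \sum_(k < n.+1) n.+1%:R^-1 * ratio p ^+ k.

Lemma has_integral_mean n : has_integral F (mean_fun n) (ergodic_mean n).
Proof.
exact: (@has_integral_sum _ _ _ _ F _ (index_enum 'I_n.+1) (fun=> n.+1%:R^-1)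
  (fun k p => ratio p ^+ k) (fun k => ratio_op k) (fun k => (ratioP k).1)).
Qed.

Let rnorm_ratio p : rnorm (ratio p) = 1.
Proof. by rewrite /ratio rnormM rnorm_conj !z1 mulr1. Qed.

Let mean_fun_le1 n p : rnorm (mean_fun n p) <= 1.
Proof.
apply: le_trans (rnorm_sum_le _ _) _.
under eq_bigr do rewrite rnormM rnormX rnorm_ratio expr1n mulr1 rnormV rnormn.
by rewrite sumr_const card_ord -[_ *+ _]mulr_natr mulVf.
Qed.

Let mean_fun_diag n p : diag p -> mean_fun n p = 1.
Proof.
move=> dp; have r1 : ratio p = 1.
  by rewrite /ratio (dp : z p.1 = z p.2) mul_conj_rnorm z1 expr1n.
rewrite /mean_fun; under eq_bigr do rewrite r1 expr1n mulr1.
by rewrite sumr_const card_ord -[_ *+ _]mulr_natr mulVf// pnatr_eq0.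
Qed.

(** Geometric sum: times [ratio p - 1] it is [ratio p ^+ n.+1 - 1], of norm at most [2], while
    [ratio p - 1] and [z p.1 - z p.2] have the same norm since [z p.2] is unimodular. *)
Let mean_fun_off n k p : ~ near_diag k p -> rnorm (mean_fun n p) <= 2 * k.+1%:R / n.+1%:R.
Proof.
move=> /negP; rewrite -ltNge => np.
have rz : rnorm (ratio p - 1) = rnorm (z p.1 - z p.2).
  rewrite -[LHS]mulr1 -(z1 p.2) -rnormM mulrBl mul1r /ratio -mulrA (mulrC _^*).
  by rewrite mul_conj_rnorm z1 expr1n mulr1.
rewrite /mean_fun -mulr_sumr rnormM rnormV rnormn mulrC ler_wpM2r ?invr_ge0//.
have /(congr1 (@rnorm _ _)) := subrX1 (ratio p) n.+1.
rewrite rnormM rz => h.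
have : rnorm (ratio p ^+ n.+1 - 1) <= 2.
  by apply: le_trans (rnormD _ _) _; rewrite rnormN rnorm1 rnormX rnorm_ratio expr1n.
rewrite h => {}h.
have k0 : 0 < k.+1%:R^-1 :> R by rewrite invr_gt0.
have := ler_wpM2r (rnorm_ge0 (\sum_(i < n.+1) ratio p ^+ i)) (ltW np).
move=> /le_trans/(_ h); rewrite ler_pdivrMl// mulrC; exact.
Qed.

(** A mean ergodic theorem. The functions [mean_fun n] equal [1] on the diagonal, are small outside
    a band, and are bounded by [1] on the rest of the band, which has little mass. *)
Lemma ergodic_mean_lim S (e : R) : 0 < e ->
  exists n0, forall n, (n0 <= n)%N -> rnorm (F diag S - ergodic_mean n S) <= e.
Proof.
move=> e0; have e20 : 0 < e / 2 by rewrite divr_gt0.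
have [k hk] := mass_near_diag S e20.
(* With the band [k] fixed, [n] must make [2 * k.+1%:R / n.+1%:R] times [rnorm S] at most [e / 2];
   the added [1] covers [S = 0]. *)
have c0 : 0 < e / 2 / (2 * k.+1%:R * (rnorm S + 1)).
  by rewrite divr_gt0// mulr_gt0// ltr_wpDl// rnorm_ge0.
have [n0 hn0] := inv_small c0; exists n0 => n /hn0 hn.
have hs := has_integral_lin (-1) (has_integral_mean n) (has_integral_indic F measurable_diag).
have mA : measurable (near_diag k `\` diag).
  by apply: measurableD; [exact: measurable_near_diag|exact: measurable_diag].
have q0 : 0 <= 2 * k.+1%:R / n.+1%:R :> R by rewrite divr_ge0// mulr_ge0.
have := @has_integral_bound _ _ _ _ _ _ _ _ dil2 _ _ _ set0 1 0 _ S hs mA measurable0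
   ler01 (lexx 0) q0 _ _ _.
rewrite scaleN1r addrC mul0r addr0 mul1r => h.
apply: le_trans (h _ _ _) _.
- move=> p [_ dp]; rewrite indicE_bool memNset// addr0 mulN1r rnormN; exact: mean_fun_le1.
- by move=> p _ [].
- move=> p nA _; have [dp|dp] := pselect (diag p).
    by rewrite indicE_bool mem_set// mean_fun_diag// mulr1 addNr rnorm0.
  rewrite indicE_bool memNset// addr0 mulN1r rnormN; apply: mean_fun_off => np.
  by apply: nA.
rewrite [leRHS](splitr e); apply: lerD => //.
move: hn; rewrite -/(_ / _) ltr_pdivlMr; last by rewrite mulr_gt0// ltr_wpDl// rnorm_ge0.
move=> /ltW; apply: le_trans.
rewrite mulrAC mulrC ler_wpM2l ?invr_ge0// ler_wpM2l ?mulr_ge0//.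
by rewrite lerDl.
Qed.

Lemma ergodic_mean_lim_at S u (e : R) : 0 < e ->
  exists n0, forall n, (n0 <= n)%N -> rnorm (F diag S u - ergodic_mean n S u) <= e * rnorm u.
Proof.
move=> e0; have [n0 h] := ergodic_mean_lim S e0; exists n0 => n /h hn.
apply: le_trans (hs_op_norm (F diag S - ergodic_mean n S) u) _.
by rewrite ler_wpM2r ?rnorm_ge0.
Qed.

(** Passing from a mean [M] to [T M Y] shifts the Cesaro sum by one term, so the two differ by
    [(T^(n+1) S Y^(n+1) - S) / (n+1)], of norm at most [2 * rnorm S / (n+1)]. *)
Lemma diag_fixed S u : T (F diag S (Y u)) = F diag S u.
Proof.
set D := F diag S.
apply/eqP; rewrite -subr_eq0; apply/eqP.
apply: (@rnorm_small _ _ _ (2 * rnorm u + 2 * (rnorm S * rnorm u))) => e e0.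
have [n0 h0] := ergodic_mean_lim S e0; have [n1 h1] := inv_small e0.
set n := (n0 + n1)%N.
have {}h0 : rnorm (D - ergodic_mean n S) <= e := h0 n (leq_addr _ _).
have {}h1 : n.+1%:R^-1 < e := h1 n (leq_addl _ _).
have TB v w : T (v - w) = T v - T w by rewrite -scaleN1r addrC (bounded_operatorZD _ _ _ bT)
    scaleN1r addrC.
pose M := ergodic_mean n S.
have -> : T (D (Y u)) - D u = T ((D - M) (Y u)) - (D - M) u + (T (M (Y u)) - M u).
  rewrite -[(D - M) (Y u)]/(D (Y u) - M (Y u)) -[(D - M) u]/(D u - M u) TB.
  have tri (a b c f : H) : a - c = a - b - (c - f) + (b - f).
    by rewrite opprB -addrA (addrC (f - c)) (addrA (b - f)) subrK (addrA (a - b)) subrK.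
  exact: tri.
have tel : T (M (Y u)) - M u = n.+1%:R^-1 *: (iter n.+1 T (S (iter n.+1 Y u)) - S u).
  rewrite !ergodic_meanE -!scaler_sumr.
  have -> (v : H) : T (n.+1%:R^-1 *: v) = n.+1%:R^-1 *: T v.
    by rewrite bounded_operatorZ.
  rewrite bounded_operator_sum// -scalerBr; congr (_ *: _).
  under eq_bigr do rewrite -iterS -iterSr.
  rewrite -sumrB; elim: n.+1 => [|m IH]; first by rewrite big_ord0 subrr.
  by rewrite big_ord_recr/= IH addrC addrA subrK.
have SY m v : rnorm (S (iter m Y v)) <= rnorm S * rnorm v.
  by apply: le_trans (hs_op_norm _ _) _; rewrite ler_wpM2l ?rnorm_ge0// Y_le.
have b1 : rnorm (T (M (Y u)) - M u) <= e * (2 * (rnorm S * rnorm u)).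
  rewrite tel rnorm_scale rnormV rnormn.
  apply: ler_pM; rewrite ?invr_ge0 ?rnorm_ge0 ?(ltW h1)//.
  apply: le_trans (rnormD _ _) _; rewrite rnormN.
  have := SY 0%N u; have := le_trans (T_le n.+1 _) (SY n.+1 u); rewrite /=; lra.
have b2 : rnorm (T ((D - M) (Y u))) <= e * rnorm u.
  apply: le_trans (T_le 1 _) _; apply: le_trans (hs_op_norm _ _) _.
  by apply: ler_pM; rewrite ?rnorm_ge0// (Y_le 1).
have b3 : rnorm ((D - M) u) <= e * rnorm u.
  by apply: le_trans (hs_op_norm _ _) _; rewrite ler_wpM2r ?rnorm_ge0.
apply: le_trans (rnormD _ _) _.
have := rnormD (T ((D - M) (Y u))) (- (D - M) u); rewrite rnormN; lra.
Qed.

(** Since [F] need not be multiplicative, idempotence comes from the means: a value [D] of [F diag]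
    satisfies [T^n D Y^n = D], so it is fixed by every mean, hence by their limit. *)
Lemma diag_idem S : F diag (F diag S) = F diag S.
Proof.
set D := F diag S.
have fixn n u : iter n T (D (iter n Y u)) = D u.
  elim: n u => // n IH u; rewrite iterS iterSr IH.
  exact: diag_fixed.
have MD n : ergodic_mean n D = D.
  apply: hs_ext => u; rewrite ergodic_meanE.
  under eq_bigr do rewrite fixn.
  by rewrite sumr_const card_ord -scaler_nat scalerA divff ?scale1r// pnatr_eq0.
apply/eqP; rewrite -subr_eq0; apply/eqP; apply: (@rnorm_small _ _ _ 1) => e e0.
have [n /(_ n (leqnn n))] := ergodic_mean_lim D e0.
by rewrite MD mulr1.
Qed.

(* The measure [<F(.) D, D>], [D = F(diag) S], is concentrated on [diag] since
   [F(diag) D = D]. *)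
Lemma diag_annihilates f I S : has_integral F f I -> (forall p, diag p -> f p = 0) ->
  I (F diag S) = 0.
Proof.
move=> hf f0; set D := F diag S; have [ssF _] := dF.
have mC := measurableC measurable_diag.
have m0 : mass F (~` diag) D = 0.
  apply: (addrI (mass F diag D)); rewrite -(massU ssF)//; last by rewrite setICr.
    rewrite setUCr (massT ssF) addr0 /mass diag_idem.
    by rewrite (rnorm_sq (H := hsType H)).
  exact: measurable_diag.
have [C C0 hC] := has_integral_fbound hf.
have := @has_integral_bound _ _ _ _ _ _ _ _ dil2 _ _ _ set0 C 0 0 D hf mC measurable0
   C0 (lexx 0) (lexx 0) _ _ _.
rewrite m0 sqrtr0 mulr0 !mul0r !addr0 => h.
apply: rnorm_eq0; apply/eqP; rewrite eq_le rnorm_ge0 andbT; apply: h => //.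
by move=> p /contrapT /f0 ->; rewrite rnorm0.
Qed.

(** The integrand [z p.1 - z p.2] vanishes on the diagonal, so its integral, the commutator with
    [T], kills the range of [F diag]. *)
Lemma diag_commT S u : T (F diag S u) = F diag S (T u).
Proof.
have [I [hI IE]] := has_integral_difference.
have := diag_annihilates S hI.
move=> /(_ _)/(congr1 (fun A : hsType H => A u)).
rewrite IE => h; apply/eqP; rewrite -subr_eq0; apply/eqP; apply: h.
by move=> p /= ->; rewrite subrr.
Qed.

Lemma diag_commY S u : Y (F diag S u) = F diag S (Y u).
Proof.
have [I [hI IE]] := has_integral_difference_conj.
have := diag_annihilates S hI.
move=> /(_ _)/(congr1 (fun A : hsType H => A u)).
rewrite IE => h; apply/eqP; rewrite -subr_eq0; apply/eqP; apply: h.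
by move=> p /= ->; rewrite subrr.
Qed.

(** Each mean already has this property: if [S''] commutes with [Y], then
    [T^k (S S'') Y^k = (T^k S Y^k) S'']. *)
Lemma diag_comp_right S S' S'' : (forall v, S'' (Y v) = Y (S'' v)) ->
  (forall v, S' v = S (S'' v)) -> forall u, F diag S' u = F diag S (S'' u).
Proof.
move=> cY SE u; apply/eqP; rewrite -subr_eq0; apply/eqP.
apply: (@rnorm_small _ _ _ (rnorm u + rnorm (S'' u))) => e e0.
have [n0 h0] := ergodic_mean_lim_at S' u e0.
have [n1 h1] := ergodic_mean_lim_at S (S'' u) e0.
have {}h0 := h0 (n0 + n1)%N (leq_addr _ _); have {}h1 := h1 (n0 + n1)%N (leq_addl _ _).
have ME n : ergodic_mean n S' u = ergodic_mean n S (S'' u).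
  rewrite !ergodic_meanE; apply: eq_bigr => k _; rewrite SE.
  by do 3 congr (_ _); elim: (k : nat) => // m IH; rewrite !iterS cY IH.
rewrite -(subrK (ergodic_mean (n0 + n1) S' u) (F diag S' u)) -addrA mulrDr.
apply: le_trans (rnormD _ _) _; rewrite lerD// ME rnormB//.
Qed.

Lemma diag_comp_left S S' S'' : (forall v, S'' (T v) = T (S'' v)) ->
  (forall v, S' v = S'' (S v)) -> forall u, F diag S' u = S'' (F diag S u).
Proof.
move=> cT SE u; apply/eqP; rewrite -subr_eq0; apply/eqP.
apply: (@rnorm_small _ _ _ (rnorm u + rnorm S'' * rnorm u)) => e e0.
have [n0 h0] := ergodic_mean_lim_at S' u e0.
have [n1 h1] := ergodic_mean_lim_at S u e0.
have {}h0 := h0 (n0 + n1)%N (leq_addr _ _); have {}h1 := h1 (n0 + n1)%N (leq_addl _ _).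
have bS := (hsP S'').1.
have ME n : ergodic_mean n S' u = S'' (ergodic_mean n S u).
  rewrite !ergodic_meanE (bounded_operator_sum _ _ bS); apply: eq_bigr => k _; rewrite SE.
  rewrite (bounded_operatorZ _ _ bS); congr (_ *: _).
  by elim: (k : nat) {2 4}(k : nat) => // m IH j; rewrite !iterS cT IH.
have SB v w : S'' (v - w) = S'' v - S'' w.
  by rewrite -scaleN1r addrC (bounded_operatorZD _ _ _ bS) scaleN1r addrC.
rewrite -(subrK (ergodic_mean (n0 + n1) S' u) (F diag S' u)) -addrA mulrDr.
apply: le_trans (rnormD _ _) _; rewrite lerD// ME -SB.
apply: le_trans (hs_op_norm _ _) _; rewrite mulrCA ler_wpM2l ?rnorm_ge0//.
by rewrite rnormB.
Qed.

Lemma diag_commutator (Q : H -> H) (C : hsType H) : bounded_operator Q ->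
  (forall u, C u = T (Q u) - Q (T u)) -> F diag C = 0.
Proof.
move=> bQ CE; set D := F diag C; apply: hs_eq0_onb => e oe.
pose B0 : hsType H := hs_of (rank_one_hs e).
pose S := F diag B0.
(* [Q] is only bounded; composing it with [S] gives an element of the domain of [F], and the
   commutator survives because [S] commutes with [T]. *)
pose Q' : hsType H := hs_of (hs_comp bQ (hsP S)).
pose C' : hsType H := hs_of (hs_comp (hsP C).1 (hsP S)).
pose D' : hsType H := hs_of (hs_comp (hsP D).1 (hsP B0)).
have selfF A B : inner (F diag A) B = inner A (F diag B) by exact: (dil_selfadj dil2 _ _
    measurable_diag).
have C'0 : F diag C' = 0.
  have [I [hI IE]] := has_integral_difference; have [J [hJ _]] := has_integral_difference_conj.
  have -> : C' = I Q'.
    apply: hs_ext => u; rewrite IE -[C' u]/(C (S u)) CE -[Q' u]/(Q (S u)).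
    by rewrite -[Q' (T u)]/(Q (S (T u))) diag_commT.
  (* [diag_annihilates] treats [I] after [F diag], while [F diag] after [I] is wanted here. Taking
     adjoints exchanges the two and replaces the integrand by its conjugate, which also vanishes on
     the diagonal. *)
  apply: inner_inj => B; rewrite selfF inner0l.
  have hJ' : has_integral F (fun p => (z p.1 - z p.2)^*) J.
    by move: hJ; congr has_integral; apply: funext => p; rewrite rmorphB.
  rewrite (has_integral_adj dil2 _ _ hI hJ') (diag_annihilates B hJ') ?inner0r//.
  by move=> p /= ->; rewrite subrr conjC0.
have DS u : D (S u) = 0.
  rewrite -(@diag_comp_right C C' S)// ?C'0// => v.
  by rewrite diag_commY.
have D'0 : F diag D' = 0.
  apply: hs_ext => u; rewrite (@diag_comp_left B0 D' D)// => v.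
  by rewrite diag_commT.
apply: (@hs_inner_single _ _ D') => //.
- move=> x ox /negbTE xe; rewrite -[D' x]/(D (inner x e *: e)).
  rewrite ((@onbP _ H).1 _ _ ox oe) xe scale0r.
  exact: (bounded_operator0 (hsP D).1).
- by rewrite -[D' e]/(D (inner e e *: e)) ((@onbP _ H).1 _ _ oe oe) eqxx scale1r.
(* [D] is its own image under [F diag], so symmetry moves [F diag] onto [D']. *)
- have -> : inner D' D = inner (F diag D') D by rewrite selfF (diag_idem C).
  by rewrite D'0 inner0l.
Qed.

(** On the diagonal the integrand is bounded by some [B], possibly large: it multiplies a mass made
    zero by [F diag C = 0]. *)
Lemma has_integral_off_diag f J (C : hsType H) n (M e : R) : F diag C = 0 -> has_integral F f J ->
  0 <= M -> 0 <= e ->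
  (forall p, near_diag n p -> ~ diag p -> rnorm (f p) <= M) ->
  (forall p, ~ near_diag n p -> rnorm (f p) <= e) ->
  rnorm (J C) <= M * Num.sqrt (mass F (near_diag n `\` diag) C) + e * rnorm C.
Proof.
move=> C0 hf M0 e0 h1 h2; have [B B0 hB] := has_integral_fbound hf.
have mA : measurable (near_diag n `\` diag).
  by apply: measurableD; [exact: measurable_near_diag|exact: measurable_diag].
have := @has_integral_bound _ _ _ _ _ _ _ _ dil2 _ _ _ _ M B e C hf mA measurable_diag M0 B0
    e0 _ _ _.
have -> : mass F diag C = 0 by rewrite /mass C0 inner0l.
rewrite sqrtr0 mulr0 addr0; apply=> [p [np dp]|p _ _|p nA dp].
- exact: h1.
- exact: hB.
- by apply: h2 => np; apply: nA.
Qed.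

(** Each power contributes the telescoping sum of [T^(i-1-j) C T^j], equal to [T^i Q - Q T^i]. The
    integrand is a polynomial in both variables, so on the diagonal it is the derivative of [p] and
    not [0]. *)
Lemma has_integral_divided_difference (p : {poly R[i]}) : exists I,
  has_integral F (fun x => \sum_(i < size p) p`_i * \sum_(j < i) 1 * (z x.1 ^+ (i.-1 - j) * z
      x.2 ^+ j)) I /\
  forall (Q : H -> H) (C : hsType H), (forall u, C u = T (Q u) - Q (T u)) -> bounded_operator Q ->
  forall u, I C u = poly_operator p T (Q u) - Q (poly_operator p T u).
Proof.
have h (ij : nat * nat) := cid (has_integral_monomial ij.1 ij.2).
pose mono i j := projT1 (h (i, j)).
have hm i j : has_integral F (fun p => z p.1 ^+ i * z p.2 ^+ j) (mono i j).
  by have [] := projT2 (h (i, j)).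
have mE i j S u : mono i j S u = iter i T (S (iter j T u)).
  by have [_] := projT2 (h (i, j)); apply.
pose J i (S : hsType H) : hsType H := \sum_(j < i) (1 : R[i]) *: mono (i.-1 - j)%N j S.
have hJ i : has_integral F (fun x => \sum_(j < i) 1 * (z x.1 ^+ (i.-1 - j) * z x.2 ^+ j)) (J i).
  exact: (@has_integral_sum _ _ _ _ F _ (index_enum 'I_i) (fun=> 1)
    (fun j x => z x.1 ^+ (i.-1 - j) * z x.2 ^+ j) (fun j => mono (i.-1 - j)%N j)
    (fun j => hm _ _)).
exists (fun S => \sum_(i < size p) p`_i *: J i S); split.
  exact: (@has_integral_sum _ _ _ _ F _ (index_enum 'I_(size p)) (fun i => p`_i)
    (fun i x => \sum_(j < i) 1 * (z x.1 ^+ (i.-1 - j) * z x.2 ^+ j)) (fun i => J i)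
    (fun i => hJ _)).
move=> Q C CE bQ u; rewrite hs_val_sum /poly_operator (bounded_operator_sum _ _ bQ) -sumrB.
apply: eq_bigr => i _; rewrite (bounded_operatorZ _ _ bQ) -scalerBr; congr (_ *: _).
rewrite /J hs_val_sum; elim: (i : nat) => [|n IH]; first by rewrite big_ord0 subrr.
rewrite big_ord_recr/= subnn scale1r mE /= CE.
(* Induction step: the sum for [n + 1] is [T] applied to the sum for [n], plus the last term
   [C T^n]. *)
have -> : \sum_(j < n) 1 *: mono (n - j)%N j C u = T (\sum_(j < n) 1 *: mono (n.-1 - j)%N j C u).
  rewrite (bounded_operator_sum _ _ bT); apply: eq_bigr => j _.
  rewrite (bounded_operatorZ _ _ bT) !mE; congr (_ *: _); rewrite -iterS; congr (iter _ _ _).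
  have aux (a b : nat) : (b < a)%N -> (a - b)%N = (a.-1 - b).+1.
    by case: a => // a; rewrite ltnS => ab; rewrite subSn.
  exact: aux.
have TB v v' : T (v - v') = T v - T v'.
  by rewrite -scaleN1r addrC (bounded_operatorZD _ _ _ bT) scaleN1r addrC.
rewrite IH TB.
by rewrite addrA subrK.
Qed.

End Double.

(** * Polynomial approximation in the disk algebra *)

Section ComplexDerivative.
Variable R : realType.
Implicit Types (f g : R[i] -> R[i]) (z u : R[i]).

(** First-order expansion instead of a difference quotient: [u = 0] is no exception, and [u] may be
    restricted to a real line for the mean value theorem. *)
Definition has_cderiv f z (c : R[i]) := forall e : R, 0 < e -> exists2 q : R, 0 < q &
  forall u, rnorm u < q -> rnorm (f (z + u) - f z - u * c) <= e * rnorm u.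

Lemma has_cderiv_cst k z : has_cderiv (fun=> k) z 0.
Proof.
move=> e e0; exists 1 => // u _; rewrite subrr mulr0 subrr rnorm0.
by rewrite mulr_ge0 ?rnorm_ge0// ltW.
Qed.

Lemma has_cderiv_id z : has_cderiv id z 1.
Proof.
move=> e e0; exists 1 => // u _; rewrite /= (addrC z) addrK mulr1 subrr rnorm0.
by rewrite mulr_ge0 ?rnorm_ge0// ltW.
Qed.

Lemma has_cderiv_bound f z c : has_cderiv f z c -> exists2 q : R, 0 < q &
  forall u, rnorm u < q -> rnorm (f (z + u) - f z) <= (rnorm c + 1) * rnorm u.
Proof.
move=> /(_ 1 ltr01) [q q0 h]; exists q => // u /h hu.
rewrite -(subrK (u * c) (f (z + u) - f z)); apply: le_trans (rnormD _ _) _.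
by rewrite rnormM; lra.
Qed.

Lemma has_cderivM f g z a b : has_cderiv f z a -> has_cderiv g z b ->
  has_cderiv (fun x => f x * g x) z (a * g z + f z * b).
Proof.
move=> hf hg e e0.
pose A := rnorm a + 1; pose B := rnorm (f z) + rnorm (g z) + 1.
have A0 : 0 < A by rewrite ltr_wpDl// rnorm_ge0.
have B0 : 0 < B by rewrite ltr_wpDl// addr_ge0// rnorm_ge0.
have C0 : 0 < rnorm b + 1 by rewrite ltr_wpDl// rnorm_ge0.
have e1 : 0 < e / (2 * B) by rewrite divr_gt0// mulr_gt0.
have [q1 q10 h1] := hf _ e1; have [q2 q20 h2] := hg _ e1.
have [q3 q30 h3] := has_cderiv_bound hf; have [q4 q40 h4] := has_cderiv_bound hg.
have q50 : 0 < e / (2 * (A * (rnorm b + 1))) by rewrite divr_gt0// mulr_gt0// mulr_gt0.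
exists (Num.min (Num.min q1 q2) (Num.min (Num.min q3 q4) (e / (2 * (A * (rnorm b + 1)))))).
  by rewrite !lt_min q10 q20 q30 q40 q50.
move=> u; rewrite !lt_min => /andP[/andP[/h1 k1 /h2 k2] /andP[/andP[/h3 k3 /h4 k4] k5]].
have -> : f (z + u) * g (z + u) - f z * g z - u * (a * g z + f z * b) =
  (f (z + u) - f z - u * a) * g z + (f z * (g (z + u) - g z - u * b) +
  (f (z + u) - f z) * (g (z + u) - g z)) by ring.
apply: le_trans (rnormD _ _) _; apply: le_trans (lerD (lexx _) (rnormD _ _)) _.
rewrite !rnormM.
have u0 := rnorm_ge0 u.
set eu := e / (2 * B) * rnorm u in k1 k2.
have t12 : rnorm (f (z + u) - f z - u * a) * rnorm (g z) +
    rnorm (f z) * rnorm (g (z + u) - g z - u * b) <= eu * B.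
  have := ler_wpM2r (rnorm_ge0 (g z)) k1; have := ler_wpM2l (rnorm_ge0 (f z)) k2.
  have : 0 <= eu by rewrite mulr_ge0// ltW.
  rewrite /B; lra.
have t3 : rnorm (f (z + u) - f z) * rnorm (g (z + u) - g z) <= (A * rnorm u) * ((rnorm b + 1)
    * rnorm u).
  by apply: ler_pM; rewrite ?rnorm_ge0.
have euB : eu * B = e / 2 * rnorm u by rewrite /eu; field; rewrite gt_eqF.
have k6 : A * rnorm u * ((rnorm b + 1) * rnorm u) <= e / 2 * rnorm u.
  rewrite mulrA; apply: ler_wpM2r => //.
  move: k5; rewrite ltr_pdivlMr; last by rewrite mulr_gt0// mulr_gt0.
  by move=> /ltW; lra.
rewrite euB in t12; lra.
Qed.

Lemma has_cderiv_eq f z a b : a = b -> has_cderiv f z a -> has_cderiv f z b.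
Proof. by move=> ->. Qed.

Lemma has_cderivX f z a n : has_cderiv f z a -> has_cderiv (fun x => f x ^+ n) z (n%:R * f z
    ^+ n.-1 * a).
Proof.
move=> hf; elim: n => [|n IH].
  rewrite !mul0r; have := has_cderiv_cst 1 z; congr has_cderiv; apply: funext => x; rewrite expr0//.
have := has_cderivM hf IH.
rewrite (_ : (fun x => f x * f x ^+ n) = (fun x => f x ^+ n.+1)); last first.
  by apply: funext => x; rewrite exprS.
apply: has_cderiv_eq; case: n {IH} => [|n] /=; first by rewrite !expr0; ring.
by rewrite exprS -[n.+2%:R]natr1; ring.
Qed.

Lemma has_cderivV z : z != 0 -> has_cderiv (fun x => x^-1) z (- (z ^+ 2)^-1).
Proof.
move=> z0; have rz : 0 < rnorm z.
  by rewrite lt_neqAle eq_sym rnorm_ge0 andbT; apply: contra_neq z0; exact: rnorm_eq0.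
move=> e e0; exists (Num.min (rnorm z / 2) (e * rnorm z ^+ 3 / 2)).
  by rewrite lt_min !divr_gt0// mulr_gt0// exprn_gt0.
move=> u; rewrite lt_min => /andP[k1 k2].
have zu : rnorm z / 2 <= rnorm (z + u).
  have := rnormD (z + u) (- u); rewrite addrK rnormN; lra.
have zu0 : z + u != 0.
  by apply/eqP => h; move: zu; rewrite h rnorm0; lra.
have -> : (z + u)^-1 - z^-1 - u * - (z ^+ 2)^-1 = u * u / (z ^+ 2 * (z + u)).
  by field; rewrite z0 zu0.
rewrite !rnormM rnormV rnormM rnormX.
rewrite mulrAC ler_wpM2r ?rnorm_ge0//.
rewrite ler_pdivrMr; last by rewrite mulr_gt0 ?exprn_gt0//; lra.
have h3 : rnorm z ^+ 2 * (rnorm z / 2) <= rnorm z ^+ 2 * rnorm (z + u).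
  by rewrite ler_wpM2l// exprn_ge0// ltW.
apply: le_trans (ltW k2) _; apply: le_trans (ler_wpM2l (ltW e0) h3).
by rewrite le_eqVlt; apply/orP; left; apply/eqP; field.
Qed.

Lemma real_der (f : R -> R) x c : (forall e : R, 0 < e -> exists2 q : R, 0 < q &
   forall h, `|h| < q -> `|f (x + h) - f x - h * c| <= e * `|h|) -> is_derive x 1 f c.
Proof.
move=> hf.
have cv : (fun h => h^-1 *: (f (h *: 1 + x) - f x)) @ 0^' --> c.
  apply/cvgrPdist_le => e e0; have [q q0 hq] := hf _ e0.
  rewrite near_withinE; apply/nbhs_ballP; exists q => //= h hb h0.
  have -> : c - h^-1 *: (f (h *: 1 + x) - f x) = - (h^-1 * (f (x + h) - f x - h * c)).
    rewrite (_ : h *: 1 + x = x + h) /GRing.scale/=; last by rewrite mulr1 addrC.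
    by field.
  rewrite normrN normrM normfV mulrC ler_pdivrMr ?normr_gt0// hq//.
  by move: hb; rewrite /ball/= sub0r normrN.
split; first by apply/cvg_ex; exists c.
exact: cvg_lim cv.
Qed.

(* The mean value theorem is applied to the real function
   [Re (al * (f (z + t u) - t u c))], [al] being the phase of the increment. *)
Lemma mean_value_inequality f (z u c : R[i]) (g : R -> R[i]) (e : R) :
  (forall t : R, 0 <= t <= 1 -> has_cderiv f (z + t%:C%C * u) (g t)) ->
  (forall t : R, 0 <= t <= 1 -> rnorm (g t - c) <= e) ->
  rnorm (f (z + u) - f z - u * c) <= e * rnorm u.
Proof.
move=> hf hg; set D := f (z + u) - f z - u * c.
have [->|D0] := eqVneq D 0.
  rewrite rnorm0 mulr_ge0 ?rnorm_ge0//; apply: le_trans (rnorm_ge0 _) (hg 0 _).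
  by rewrite lexx ler01.
have rD : 0 < rnorm D.
  by rewrite lt_neqAle eq_sym rnorm_ge0 andbT; apply: contra_neq D0; exact: rnorm_eq0.
pose al := D^* / (rnorm D)%:C%C.
have ral : rnorm al = 1.
  by rewrite rnormM rnormV rnorm_conj rnorm_real ger0_norm ?rnorm_ge0// divff// gt_eqF.
pose F (t : R) := complex.Re (al * (f (z + t%:C%C * u) - t%:C%C * (u * c))).
pose dF (t : R) := complex.Re (al * (u * (g t - c))).
have dFP (t : R) : 0 <= t <= 1 -> is_derive t 1 F (dF t).
  move=> t01; apply: real_der => q q0.
  have u1 : 0 < rnorm u + 1 by rewrite ltr_wpDl// rnorm_ge0.
  have qu : 0 < q / (rnorm u + 1) by rewrite divr_gt0.
  have [r r0 hr] := hf _ t01 _ qu.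
  exists (r / (rnorm u + 1)); first by rewrite divr_gt0.
  move=> h hh.
  have hu : rnorm (h%:C%C * u) < r.
    rewrite rnormM rnorm_real; move: hh; rewrite ltr_pdivlMr//; apply: le_lt_trans.
    by rewrite ler_wpM2l// lerDl.
  have := hr _ hu.
  rewrite rnormM rnorm_real => k.
  have -> : F (t + h) - F t - h * dF t = complex.Re (al * (f (z + t%:C%C * u + h%:C%C * u) -
     f (z + t%:C%C * u) - h%:C%C * u * g t)).
    have hRe (x : R[i]) : h * complex.Re x = complex.Re (h%:C%C * x).
      by case: x => x y /=; rewrite mul0r subr0.
    rewrite /F /dF hRe -!raddfB/=; congr complex.Re.
    rewrite rmorphD/= mulrDl addrA; ring.
  apply: le_trans (Re_le _) _; rewrite rnormM ral mul1r; apply: le_trans k _.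
  rewrite (_ : _ * _ = q * `|h| * (rnorm u / (rnorm u + 1))); last by ring.
  rewrite ler_piMr ?mulr_ge0 ?(ltW q0)// ler_pdivrMr// mul1r.
  by rewrite lerDl.
have [||t t01] := @MVT R F dF 0 1 ltr01.
- by move=> t; rewrite in_itv/= => /andP[t0 t1]; apply: dFP; rewrite !ltW.
- apply: derivable_within_continuous => t; rewrite in_itv/= => t01.
  by have [] := dFP _ t01.
rewrite subr0 mulr1 => FE.
have <- : F 1 - F 0 = rnorm D.
  have -> : F 1 - F 0 = complex.Re (al * D).
    rewrite /F -raddfB/= -mulrBr; congr (complex.Re (al * _)).
    by rewrite rmorph1 rmorph0 !mul1r !mul0r subr0 addr0 /D [RHS]addrAC.
  rewrite (_ : al * D = (rnorm D)%:C%C)//.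
  rewrite /al mulrAC (mulrC D^*) mul_conj_rnorm -fmorphV -rmorphM/= expr2 mulfK//.
  by rewrite gt_eqF.
rewrite FE /dF; apply: le_trans (ler_norm _) _; apply: le_trans (Re_le _) _.
rewrite rnormM ral mul1r rnormM mulrC ler_wpM2r ?rnorm_ge0//; apply: hg.
by move: t01; rewrite in_itv/= => /andP[t0 t1]; rewrite !ltW.
Qed.

Lemma derivable_has_cderiv f z : derivable f z 1 -> has_cderiv f z (derive1 f z).
Proof.
move=> hf.
have cv : (fun h : R[i] => h^-1 *: (f (h *: 1 + z) - f z)) @ 0^' --> (derive1 f z : R[i]).
  by rewrite derive1E; exact: hf.
move=> e e0; move/rnorm_cvgP : cv => /(_ e e0).
rewrite near_withinE => /nbhs_ballP[q /= q0 hq].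
have qE : (complex.Re q)%:C%C = q by rewrite RRe_real// gtr0_real.
exists (complex.Re q); first by rewrite -(ltcR 0) qE.
move=> u uq; have [->|u0] := eqVneq u 0.
  by rewrite addr0 subrr mul0r subrr rnorm0 mulr0.
have bu : ball 0 q u by rewrite -ball_normE/= sub0r normrN -rnormE -qE ltcR.
have /(_ u0) := hq u bu.
have -> : derive1 f z - u^-1 *: (f (u *: 1 + z) - f z) = - (u^-1 * (f (z + u) - f z - u *
    derive1 f z)).
  rewrite (_ : u *: 1 + z = z + u) ?/GRing.scale/=; last by rewrite mulr1 addrC.
  by field.
rewrite rnormN rnormM rnormV mulrC => /ltW; rewrite ler_pdivrMr//.
by rewrite lt_neqAle eq_sym rnorm_ge0 andbT; apply: contra_neq u0; exact: rnorm_eq0.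
Qed.

Lemma has_cderiv_cont f z c : has_cderiv f z c -> forall e : R, 0 < e -> exists2 q : R, 0 < q &
  forall w, rnorm (w - z) < q -> rnorm (f w - f z) <= e.
Proof.
move=> /has_cderiv_bound[q q0 hq] e e0.
have c1 : 0 < rnorm c + 1 by rewrite ltr_wpDl// rnorm_ge0.
exists (Num.min q (e / (rnorm c + 1))); first by rewrite lt_min q0 divr_gt0.
move=> w; rewrite lt_min => /andP[/hq]; rewrite (_ : z + (w - z) = w); last by rewrite addrC subrK.
move=> h; rewrite ltr_pdivlMr// => k.
by apply: le_trans h _; rewrite mulrC ltW.
Qed.

Definition cdisc (r : R) : set R[i] := [set z | rnorm z <= r].

Lemma cdisc_compact r : compact (cdisc r).
Proof.
pose sq := (fun p : R * R => (p.1%:C%C + p.2%:C%C * 'i%C : R[i])) @` (`[- r, r] `*` `[- r, r]).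
have csq : compact sq.
  apply: continuous_compact; last by apply: compact_setX; exact: segment_compact.
  apply: continuous_subspaceT => p; apply/rnorm_cvgP => e e0.
  exists (ball p.1 (e / 2), ball p.2 (e / 2)).
    by split; apply: nbhsx_ballx; rewrite divr_gt0.
  move=> w [] /=; rewrite /ball/= => h1 h2.
  have -> : (p.1)%:C%C + (p.2)%:C%C * 'i%C - ((w.1)%:C%C + (w.2)%:C%C * 'i%C) =
    (p.1 - w.1)%:C%C + (p.2 - w.2)%:C%C * 'i%C by rewrite !rmorphB/=; ring.
  apply: le_lt_trans (rnormD _ _) _; rewrite rnormM !rnorm_real.
  have -> : rnorm ('i%C : R[i]) = 1 by rewrite /rnorm complexiE normCi.
  by rewrite mulr1 [ltRHS](splitr e) ltrD.
apply: (subclosed_compact _ csq); last first.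
  move=> z rz; exists (complex.Re z, complex.Im z).
    split=> /=; rewrite in_itv/= -ler_norml.
      exact: le_trans (Re_le _) rz.
    exact: le_trans (Im_le _) rz.
  by case: z {rz} => a b /=; apply/eqP; rewrite eq_complex/= !mulr0 !mul0r !mulr1 subrr
      !addr0 add0r !eqxx.
move=> z cz; apply/ler_addgt0Pr => e e0.
have [] := cz (ball z e%:C%C); first by apply: nbhsx_ballx; rewrite (ltcR 0).
move=> w [rw]; rewrite -ball_normE/= -rnormE ltcR => k.
rewrite -(subrK w z) addrC; apply: le_trans (rnormD _ _) _.
by rewrite lerD// ltW.
Qed.

Lemma uniform_continuity g r : (forall z, cdisc r z -> exists c, has_cderiv g z c) ->
  forall e : R, 0 < e -> exists2 q : R, 0 < q & forall z w, cdisc r z -> cdisc r w ->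
    rnorm (w - z) < q -> rnorm (g w - g z) <= e.
Proof.
move=> hg e e0.
have := @cdisc_compact r; rewrite compact_near_coveringP => /(_ nat \oo
  (fun n z => forall w, rnorm (w - z) < n.+1%:R^-1 -> rnorm (g w - g z) <= e) _) [].
- move=> z rz; have [c hc] := hg _ rz.
  have e2 : 0 < e / 2 by rewrite divr_gt0.
  have [q q0 hq] := has_cderiv_cont hc e2.
  have q2 : 0 < q / 2 by rewrite divr_gt0.
  have [n0 hn0] := inv_small q2.
  exists (ball z (q / 2)%:C%C, [set n | (n0 <= n)%N]).
    by split; [apply: nbhsx_ballx; rewrite (ltcR 0)|exists n0].
  move=> [x n] [] /=; rewrite -ball_normE/= -rnormE ltcR => k1 /hn0 k0 w k2.
  rewrite -(subrK (g z) (g w)) -addrA; apply: le_trans (rnormD _ _) _.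
  rewrite (splitr e) lerD//.
    apply: hq; rewrite -(subrK x w) -addrA; apply: le_lt_trans (rnormD _ _) _.
    by rewrite (rnormB x); move: k0 k2; set a := n.+1%:R^-1; lra.
  rewrite rnormB; apply: hq; rewrite rnormB; lra.
move=> n _ /(_ n (leqnn n)) hn; exists n.+1%:R^-1; first by rewrite invr_gt0.
by move=> z w rz _; exact: hn.
Qed.

End ComplexDerivative.

(** * Roots of unity arbitrarily close to [1] *)

Section RootsOfUnity.
Variable R : realType.

(* The square root is [(1 + w) / |1 + w|]. *)
Lemma half_angle (w : R[i]) : rnorm w = 1 -> 0 <= complex.Re w -> w != 1 ->
  exists v : R[i], [/\ rnorm v = 1, 0 <= complex.Re v, v != 1, v ^+ 2 = w &
    2 * rnorm (v - 1) ^+ 2 <= rnorm (w - 1) ^+ 2].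
Proof.
move=> w1 rw wn1.
have ReD1 (x : R[i]) : complex.Re (x + 1) = complex.Re x + 1 by case: x.
have s0 : 1 <= rnorm (w + 1).
  apply: le_trans _ (le_trans (ler_norm _) (Re_le _)); rewrite ReD1; lra.
set s := rnorm (w + 1) in s0.
have sp : 0 < s by exact: lt_le_trans s0.
have sn : s%:C%C != 0 :> R[i] by rewrite (_ : 0 = 0%:C%C)// (inj_eq (@complexI R)) gt_eqF.
pose v : R[i] := (w + 1) / s%:C%C.
have ww : w * w^* = 1 by rewrite mul_conj_rnorm w1 expr1n.
have ss : (s ^+ 2)%:C%C = (w + 1) * (w^* + 1) :> R[i].
  by rewrite -mul_conj_rnorm rmorphD rmorph1.
have vv : v ^+ 2 = w.
  rewrite /v expr_div_n -rmorphXn/= ss.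
  have w10 : w + 1 != 0 by apply: contraTneq sp => h; rewrite /s h rnorm0 ltxx.
  have -> : (w + 1) ^+ 2 = w * ((w + 1) * (w^* + 1)).
    have -> : w * ((w + 1) * (w^* + 1)) = (w + 1) * (w * w^* + w) by ring.
    by rewrite ww; ring.
  rewrite mulfK// mulf_neq0//; apply: contra_neq w10 => h.
  have -> : w + 1 = (w^* + 1)^* by rewrite rmorphD/= conjCK rmorph1.
  by rewrite h conjC0.
have Rev : 0 <= complex.Re v.
  have -> : v = s^-1%:C%C * (w + 1) by rewrite /v mulrC fmorphV.
  case: (w) rw => a b /= a0; rewrite mul0r subr0 mulr_ge0 ?invr_ge0 ?ltW//; lra.
have v1 : rnorm v = 1 by rewrite /v rnormM rnormV rnorm_real gtr0_norm// divff// gt_eqF.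
exists v; split=> //; first by apply: contra_neq wn1 => v1'; rewrite -vv v1' expr1n.
have -> : w - 1 = (v - 1) * (v + 1) by rewrite -vv; ring.
rewrite rnormM exprMn mulrC ler_wpM2l ?sqr_ge0//.
have : (rnorm (v + 1) ^+ 2)%:C%C = (2 + 2 * complex.Re v)%:C%C :> R[i].
  rewrite -mul_conj_rnorm rmorphD rmorph1/=.
  have -> : (v + 1) * (v^* + 1) = v * v^* + 1 + (v + v^*) by ring.
  rewrite mul_conj_rnorm v1 expr1n addcJ rmorphD rmorphM/= !rmorph_nat.
  by rewrite -[1 + 1]/(2%:R).
by move=> /(@complexI R) ->; lra.
Qed.

(** Angle bisection starting from ['i], with exponents [2 ^ n.+2]. As [rnorm (w - 1) ^+ 2] at least
    halves, the invariant [n.+1%:R * rnorm (w - 1) ^+ 2 <= 2] persists, because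
    [n + 2 <= 2 (n + 1)]. *)
Lemma root_of_unity_near1 (e : R) : 0 < e -> exists (N : nat) (w : R[i]),
  [/\ (0 < N)%N, w ^+ N = 1, w != 1, rnorm w = 1 & rnorm (w - 1) < e].
Proof.
move=> e0.
have h n : exists w : R[i], [/\ rnorm w = 1, 0 <= complex.Re w, w != 1, w ^+ (2 ^ n.+2) = 1 &
   n.+1%:R * rnorm (w - 1) ^+ 2 <= 2].
  elim: n => [|n [w [w1 rw wn1 wN hw]]].
    exists 'i%C; split=> //=.
    - by rewrite /rnorm complexiE normCi.
    - by rewrite eq_complex/= negb_and oner_eq0 orbT.
    - by rewrite (_ : (2 ^ 2)%N = (2 * 2)%N)// exprM complexiE sqrCi sqrrN expr1n.
    rewrite mul1r /rnorm normc_def /= sqr_sqrtr; last by rewrite addr_ge0// sqr_ge0.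
    lra.
  have [v [v1 rv vn1 vv hv]] := half_angle w1 rw wn1.
  exists v; split=> //; first by rewrite expnS exprM vv.
  rewrite (_ : n.+2%:R = n.+1%:R + 1)// ?natr1//.
  have : 1 <= n.+1%:R :> R by rewrite ler1n.
  move: hw hv (sqr_ge0 (rnorm (v - 1))); set a := rnorm (w - 1) ^+ 2; set b := rnorm (v - 1) ^+ 2.
  move=> hw hv b0 n1; apply: le_trans hw; nra.
have e2 : 0 < e ^+ 2 / 2 by rewrite divr_gt0// exprn_gt0.
have [n /(_ n (leqnn n)) hn] := inv_small e2.
have [w [w1 rw wn1 wN hw]] := h n.
exists (2 ^ n.+2)%N, w; split=> //; first by rewrite expn_gt0.
rewrite -(@ltr_pXn2r _ 2)// ?nnegrE ?rnorm_ge0 ?ltW//.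
move: hw; rewrite mulrC -ler_pdivlMr// => /le_lt_trans; apply.
by rewrite -ltr_pdivlMl//  mulrC.
Qed.

End RootsOfUnity.

(** * Limits of bounded sequences along an ultrafilter *)

Section UltraLimit.
Variable R : realType.

Lemma ultra_fmap T S (x : T -> S) (F : set_system T) : UltraFilter F -> UltraFilter (x @ F).
Proof.
move=> UF; split=> [|G PG sG]; first exact: fmap_proper_filter.
apply/seteqP; split=> // A GA.
have [//|h] := in_ultra_setVsetC (x @^-1` A) UF.
have /sG GC : (x @ F) (~` A) by exact: h.
have /filter_ex[y []//] : G (A `&` ~` A) by exact: filterI.
Qed.

Lemma ultrafilter_oo : exists U : set_system nat, UltraFilter U /\ \oo `<=` U.
Proof. by have [U [UU h]] := @ultraFilterLemma _ (\oo : set_system nat) _; exists U. Qed.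

(** Along an ultrafilter every bounded sequence converges, and sums and products are respected. All
    the means below get their limits at once, without extracting subsequences for each [z], [a] and
    [b]. *)
Definition ulim (U : set_system nat) (x : nat -> R[i]) (l : R[i]) :=
  forall e : R, 0 < e -> U [set n | rnorm (l - x n) < e].

Variable U : set_system nat.
Hypothesis UU : UltraFilter U.
Let FU : ProperFilter U := @ultra_proper _ _ UU.

Lemma ulim_exists (x : nat -> R[i]) (M : R) : (forall n, rnorm (x n) <= M) ->
  exists l, ulim U x l.
Proof.
move=> hx; have := @cdisc_compact R M; rewrite compact_ultra => /(_ (x @ U) (ultra_fmap x UU)) [].
  have : U [set n | cdisc M (x n)] by apply: filterS filterT => n _; exact: hx.
  by [].
move=> l [_ hl]; exists l; exact/rnorm_cvgP.
Qed.

Lemma ulim_le x l (y : nat -> R[i]) m (C : R) : ulim U x l -> ulim U y m ->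
  U [set n | rnorm (x n - y n) <= C] -> rnorm (l - m) <= C.
Proof.
move=> hx hy h; apply: (@ler_small _ _ _ 2) => // e e0.
have [n [[k1 k2] k3]] := filter_ex (filterI (filterI (hx _ e0) (hy _ e0)) h).
rewrite /= in k1 k2 k3.
have -> : l - m = (l - x n) + ((x n - y n) - (m - y n)) by ring.
apply: le_trans (rnormD _ _) _; have := rnormD (x n - y n) (- (m - y n)).
rewrite rnormN; lra.
Qed.

Lemma ulim_unique x l m : ulim U x l -> ulim U x m -> l = m.
Proof.
move=> hl hm; apply/eqP; rewrite -subr_eq0; apply/eqP; apply: rnorm_eq0; apply/eqP.
rewrite eq_le rnorm_ge0 andbT; apply: (ulim_le hl hm).
by apply: filterS filterT => n _ /=; rewrite subrr rnorm0.
Qed.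

Lemma ulim_cst l : ulim U (fun=> l) l.
Proof. by move=> e e0; apply: filterS filterT => n _ /=; rewrite subrr rnorm0. Qed.

Lemma ulimD x l y m : ulim U x l -> ulim U y m -> ulim U (fun n => x n + y n) (l + m).
Proof.
move=> hx hy e e0; have e2 : 0 < e / 2 by rewrite divr_gt0.
apply: filterS (filterI (hx _ e2) (hy _ e2)) => n /= [k1 k2].
rewrite opprD addrACA; apply: le_lt_trans (rnormD _ _) _; lra.
Qed.

Lemma ulimM x l y m : ulim U x l -> ulim U y m -> ulim U (fun n => x n * y n) (l * m).
Proof.
move=> hx hy e e0.
have l0 := rnorm_ge0 l; have m0 := rnorm_ge0 m.
have c0 : 0 < rnorm l + rnorm m + 1 by rewrite ltr_wpDl// addr_ge0.
pose q := Num.min 1 (e / (rnorm l + rnorm m + 1)).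
have q0 : 0 < q by rewrite lt_min ltr01 divr_gt0.
have q1 : q <= 1 by rewrite ge_min lexx.
have qe : q * (rnorm l + rnorm m + 1) <= e by rewrite -ler_pdivlMr// ge_min lexx orbT.
apply: filterS (filterI (hx _ q0) (hy _ q0)) => n /= [k1 k2].
have -> : l * m - x n * y n = l * (m - y n) + ((l - x n) * m - (l - x n) * (m - y n)) by ring.
apply: le_lt_trans (rnormD _ _) _.
have := rnormD ((l - x n) * m) (- ((l - x n) * (m - y n))); rewrite rnormN !rnormM.
move: (rnorm_ge0 (l - x n)) (rnorm_ge0 (m - y n)) k1 k2.
set a := rnorm (l - x n); set b := rnorm (m - y n) => a0 b0 k1 k2.
have := rnorm_ge0 (l - x n).
have t1 : rnorm l * b <= rnorm l * q by rewrite ler_wpM2l// ltW.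
have t2 : a * rnorm m <= q * rnorm m by rewrite ler_wpM2r// ltW.
have t3 : a * b < q by apply: (@le_lt_trans _ _ (a * 1)); [rewrite ler_wpM2l// ltW//
    (lt_le_trans k2)|rewrite mulr1].
lra.
Qed.

Lemma ulim_sum I (r : seq I) (x : I -> nat -> R[i]) l : (forall i, ulim U (x i) (l i)) ->
  ulim U (fun n => \sum_(i <- r) x i n) (\sum_(i <- r) l i).
Proof.
move=> h; elim: r => [|i r IH].
  by under [X in ulim _ X]eq_fun do rewrite big_nil; rewrite big_nil; exact: ulim_cst.
by under [X in ulim _ X]eq_fun do rewrite big_cons; rewrite big_cons; exact: ulimD.
Qed.

Lemma ulimX x l k : ulim U x l -> ulim U (fun n => x n ^+ k) (l ^+ k).
Proof.
move=> h; elim: k => [|k IH].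
  by under [X in ulim _ X]eq_fun do rewrite expr0; rewrite expr0; exact: ulim_cst.
by under [X in ulim _ X]eq_fun do rewrite exprS; rewrite exprS; exact: ulimM.
Qed.

Lemma ulim_conj x l : ulim U x l -> ulim U (fun n => (x n)^*) l^*.
Proof.
by move=> h e /h; apply: filterS => n /=; rewrite -rmorphB rnorm_conj.
Qed.

Lemma ulim_ext x y l : (forall n, x n = y n) -> ulim U x l -> ulim U y l.
Proof. by move=> xy; have -> : y = x by apply: funext => n; rewrite xy. Qed.

End UltraLimit.

Section Averages.
Variable R : realType.
Implicit Types (F G : nat -> R[i]) (N : nat).

Definition avg N F : R[i] := N%:R^-1 * \sum_(k < N) F k.

Lemma avgD N F G : avg N (fun k => F k + G k) = avg N F + avg N G.
Proof. by rewrite /avg big_split mulrDr. Qed.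

Lemma avgZ N c F : avg N (fun k => c * F k) = c * avg N F.
Proof. by rewrite /avg -mulr_sumr mulrCA. Qed.

Lemma avgB N F G : avg N (fun k => F k - G k) = avg N F - avg N G.
Proof. by rewrite /avg sumrB mulrBr. Qed.

Lemma avg_sum N I (r : seq I) (F : I -> nat -> R[i]) :
  avg N (fun k => \sum_(i <- r) F i k) = \sum_(i <- r) avg N (F i).
Proof. by rewrite /avg exchange_big mulr_sumr. Qed.

Lemma eq_avg N F G : (forall k, F k = G k) -> avg N F = avg N G.
Proof. by move=> h; rewrite /avg; under eq_bigr do rewrite h. Qed.

Lemma avg_le N F (C : R) (K : nat -> R) : 0 <= C -> (forall k, 0 <= K k) ->
  (forall k, rnorm (F k) <= C * K k) ->
  rnorm (avg N F) <= C * rnorm (avg N (fun k => (K k)%:C%C)).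
Proof.
move=> C0 K0 h; rewrite /avg !rnormM mulrCA ler_wpM2l ?rnorm_ge0//.
apply: le_trans (rnorm_sum_le _ _) _.
rewrite -rmorph_sum rnorm_real ger0_norm ?sumr_ge0// mulr_sumr.
by apply: ler_sum => k _; exact: h.
Qed.

Lemma avg_cst N c : (0 < N)%N -> avg N (fun=> c) = c.
Proof.
move=> N0; rewrite /avg sumr_const card_ord -[c *+ N]mulr_natl mulKf//.
by rewrite pnatr_eq0 -lt0n.
Qed.

Lemma avg_le_cst N F (C : R) : (0 < N)%N -> 0 <= C -> (forall k, rnorm (F k) <= C) ->
  rnorm (avg N F) <= C.
Proof.
move=> N0 C0 h; have := @avg_le N F C (fun=> 1) C0.
rewrite avg_cst// rmorph1 rnorm1 mulr1; apply=> // k; rewrite ?mulr1 ?ler01//.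
Qed.

Lemma avg_shift N F : F N = F 0%N -> avg N (fun k => F k.+1) = avg N F.
Proof.
move=> FN; rewrite /avg; congr (_ * _); case: N FN => [|N] FN; first by rewrite !big_ord0.
by rewrite big_ord_recr/= FN [RHS]big_ord_recl/= addrC.
Qed.

End Averages.

(** * Fejer means over roots of unity and their polynomial limits *)

Section DiskApproximation.
Variables (R : realType) (f g : R[i] -> R[i]) (M : R).
Hypothesis M0 : 0 <= M.
Hypothesis hf : forall z, rnorm z < 1 -> has_cderiv f z (g z).
Hypothesis hg : forall z, rnorm z < 1 -> exists c, has_cderiv g z c.
Hypothesis gM : forall z, rnorm z < 1 -> rnorm (g z) <= M.

Lemma segment_rnorm (z u : R[i]) (t : R) : 0 <= t <= 1 ->
  rnorm (z + t%:C%C * u) <= Num.max (rnorm z) (rnorm (z + u)).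
Proof.
move=> /andP[t0 t1].
have -> : z + t%:C%C * u = (1 - t)%:C%C * z + t%:C%C * (z + u) by rewrite rmorphB rmorph1; ring.
apply: le_trans (rnormD _ _) _; rewrite !rnormM !rnorm_real !ger0_norm ?subr_ge0//.
set m := Num.max _ _.
have h1 : rnorm z <= m by rewrite le_max lexx.
have h2 : rnorm (z + u) <= m by rewrite le_max lexx orbT.
have := ler_wpM2l t0 h2; have t1' : 0 <= 1 - t by rewrite subr_ge0.
have := ler_wpM2l t1' h1; lra.
Qed.

Lemma disk_lipschitz z w : rnorm z < 1 -> rnorm w < 1 -> rnorm (f w - f z) <= M * rnorm (w - z).
Proof.
move=> z1 w1; have zw : z + (w - z) = w by rewrite addrC subrK.
have seg t : 0 <= t <= 1 -> rnorm (z + t%:C%C * (w - z)) < 1.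
  by move=> /(segment_rnorm z (w - z)) h; apply: le_lt_trans h _; rewrite zw gt_max z1.
have := @mean_value_inequality R f z (w - z) 0 (fun t => g (z + t%:C%C * (w - z))) M.
rewrite zw mulr0 subr0; apply=> t /seg h; first exact: hf.
by rewrite subr0; exact: gM.
Qed.

Lemma disk_bounded z : rnorm z < 1 -> rnorm (f z) <= rnorm (f 0) + M.
Proof.
move=> z1; have := @disk_lipschitz 0 z; rewrite rnorm0 ltr01 subr0 => /(_ isT z1) h.
rewrite -(subrK (f 0) (f z)) addrC; apply: le_trans (rnormD _ _) _; rewrite lerD2l.
by apply: le_trans h _; rewrite ler_piMr// ltW.
Qed.

(** Uniformity over the disk of radius [r] is the point: the means evaluate [f] at all the rotations
    of [z], for all [j]. *)
Lemma uniform_derivative (r e : R) : 0 <= r < 1 -> 0 < e -> exists2 q : R, 0 < q &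
  forall z u, rnorm z <= r -> rnorm u < q -> rnorm (f (z + u) - f z - u * g z) <= e * rnorm u.
Proof.
(* The intermediate radius leaves room for the segment from [z] to [z + u] in a compact disk where
   [g] is uniformly continuous. *)
move=> /andP[r0 r1] e0; set r' := (1 + r) / 2.
have rr : r < r' by rewrite /r'; lra.
have r'1 : r' < 1 by rewrite /r'; lra.
have [|q q0 hq] := @uniform_continuity R g r' _ e e0.
  by move=> z rz; apply: hg; exact: le_lt_trans rz r'1.
exists (Num.min q (r' - r)); first by rewrite lt_min q0 subr_gt0.
move=> z u rz; rewrite lt_min => /andP[uq ur].
have zu : rnorm (z + u) <= r' by apply: le_trans (rnormD _ _) _; lra.
have seg t : 0 <= t <= 1 -> rnorm (z + t%:C%C * u) <= r'.
  move=> /(segment_rnorm z u) h; apply: le_trans h _; rewrite ge_max zu andbT.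
  exact: le_trans rz (ltW rr).
apply: (@mean_value_inequality R f z u (g z) (fun t => g (z + t%:C%C * u))) => t t01.
  by apply: hf; exact: le_lt_trans (seg _ t01) r'1.
apply: hq; [exact: le_trans rz (ltW rr)|exact: seg|].
rewrite addrAC subrr add0r rnormM rnorm_real; apply: le_lt_trans uq.
by have /andP[t0 t1] := t01; rewrite ger0_norm// ler_piMl ?rnorm_ge0.
Qed.

Variables (U : set_system nat) (N : nat -> nat) (w : nat -> R[i]).
Hypothesis UU : UltraFilter U.
Hypothesis N0 : forall j, (0 < N j)%N.
Hypothesis wN : forall j, w j ^+ N j = 1.
Hypothesis wn1 : forall j, w j != 1.
Hypothesis w1 : forall j, rnorm (w j) = 1.
Hypothesis wlim : ulim U w 1.
Let FU : ProperFilter U := @ultra_proper _ _ UU.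

(** Since [w j] is unimodular, this is its power of exponent [a - b], written without negative
    exponents. The mean of [f (z * w j ^+ k)] against the powers of the twist is a discrete Fourier
    coefficient of [f], of index [b - a], on the circle through [z]. *)
Definition twist a b j : R[i] := w j ^+ a * (w j)^* ^+ b.

Definition twisted_mean a b z j := avg (N j) (fun k => f (z * w j ^+ k) * twist a b j ^+ k).
Definition twisted_der_mean a b z j :=
  avg (N j) (fun k => w j ^+ k * g (z * w j ^+ k) * twist a b j ^+ k).

Let ww j : w j * (w j)^* = 1.
Proof. by rewrite mul_conj_rnorm w1 expr1n. Qed.

Let wX j k : rnorm (w j ^+ k) = 1.
Proof. by rewrite rnormX w1 expr1n. Qed.

Let twist1 a b j k : rnorm (twist a b j ^+ k) = 1.
Proof. by rewrite /twist rnormX rnormM !rnormX rnorm_conj w1 !expr1n mulr1 expr1n. Qed.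

Let twistN a b j : twist a b j ^+ N j = 1.
Proof.
rewrite /twist exprMn -!exprM mulnC exprM wN expr1n mul1r mulnC exprM -rmorphXn/= wN.
by rewrite rmorph1 expr1n.
Qed.

Let twist_conj a b j : twist a b j * (twist a b j)^* = 1.
Proof. by rewrite mul_conj_rnorm -[twist a b j]expr1 twist1 expr1n. Qed.

Let zw z j k : rnorm (z * w j ^+ k) = rnorm z.
Proof. by rewrite rnormM wX mulr1. Qed.

Lemma twisted_mean_le a b z j : rnorm z < 1 -> rnorm (twisted_mean a b z j) <= rnorm (f 0) + M.
Proof.
move=> z1; apply: avg_le_cst => // [|k]; first by rewrite addr_ge0// rnorm_ge0.
by rewrite rnormM twist1 mulr1; apply: disk_bounded; rewrite zw.
Qed.

Lemma twisted_der_mean_le a b z j : rnorm z < 1 -> rnorm (twisted_der_mean a b z j) <= M.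
Proof.
move=> z1; apply: avg_le_cst => // k.
by rewrite !rnormM twist1 wX mulr1 mul1r; apply: gM; rewrite zw.
Qed.

(** For [rnorm z < 1] the limit exists and [xget] returns it; elsewhere the value may be the default
    [0], so the lemmas on this function stay in the open disk. *)
Definition twisted_lim a b z : R[i] := xget 0 [set l | ulim U (twisted_mean a b z) l].
Definition twisted_der_lim a b z : R[i] := xget 0 [set l | ulim U (twisted_der_mean a b z) l].

Lemma twisted_limP a b z : rnorm z < 1 -> ulim U (twisted_mean a b z) (twisted_lim a b z).
Proof.
move=> z1; have [l hl] := ulim_exists UU (fun j => twisted_mean_le a b j z1).
exact: (@xgetPex _ 0 [set l | ulim U (twisted_mean a b z) l] (ex_intro _ l hl)).
Qed.

Lemma twisted_der_limP a b z : rnorm z < 1 -> ulim U (twisted_der_mean a b z)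
    (twisted_der_lim a b z).
Proof.
move=> z1; have [l hl] := ulim_exists UU (fun j => twisted_der_mean_le a b j z1).
exact: (@xgetPex _ 0 [set l | ulim U (twisted_der_mean a b z) l] (ex_intro _ l hl)).
Qed.

(** The radius [q] is the same for all [j]. This allows passing to the limit with [u] fixed, and
    also taking [u] dependent on [j], as in [twisted_lim_ode]. *)
Lemma coef_derivative a b z (e : R) : rnorm z < 1 -> 0 < e -> exists2 q : R, 0 < q &
  forall u, rnorm u < q -> forall j,
    rnorm (twisted_mean a b (z + u) j - (twisted_mean a b z j + u * twisted_der_mean a b z
        j)) <= e * rnorm u.
Proof.
move=> z1 e0; have [|q q0 hq] := @uniform_derivative (rnorm z) e _ e0.
  by rewrite rnorm_ge0.
exists q => // u uq j.
rewrite opprD addrA -avgB -avgZ -avgB.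
apply: avg_le_cst => // [|k]; first by rewrite mulr_ge0 ?rnorm_ge0// ltW.
have := hq (z * w j ^+ k) (u * w j ^+ k); rewrite !zw => /(_ (lexx _) uq).
rewrite -mulrDl => h; apply: le_trans h; rewrite -[leRHS]mulr1 -(twist1 a b j k) -rnormM.
by rewrite le_eqVlt; apply/orP; left; apply/eqP; congr rnorm; ring.
Qed.

Lemma twisted_lim_der a b z : rnorm z < 1 -> has_cderiv (twisted_lim a b) z (twisted_der_lim a b z).
Proof.
move=> z1 e e0; have [q q0 hq] := coef_derivative a b z1 e0.
exists (Num.min q (1 - rnorm z)); first by rewrite lt_min q0 subr_gt0.
move=> u; rewrite lt_min => /andP[uq uz].
have zu : rnorm (z + u) < 1 by apply: le_lt_trans (rnormD _ _) _; lra.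
rewrite -addrA -opprD; apply: (ulim_le UU (twisted_limP a b zu)); last first.
  by apply: filterS filterT => j _; exact: hq.
apply: ulimD (twisted_limP _ _ z1) _; apply: ulimM (twisted_der_limP _ _ z1); exact: ulim_cst.
Qed.

(** The quotient of [(twist a b j)^* - 1] by [w j - 1], expanded into geometric sums so that no
    division occurs and the limit [b - a] can be read off. *)
Definition slope a b j : R[i] :=
  (w j)^* ^+ a * (\sum_(i < b) w j ^+ i - \sum_(i < a) w j ^+ i).

Lemma slopeE a b j : (twist a b j)^* - 1 = slope a b j * (w j - 1).
Proof.
rewrite /slope -mulrA (mulrC (_ - _)) mulrBr -!subrX1.
have -> : w j ^+ b - 1 - (w j ^+ a - 1) = w j ^+ b - w j ^+ a by ring.
rewrite /twist rmorphM !rmorphXn/= conjCK mulrBr; congr (_ - _).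
by rewrite -exprMn mulrC ww expr1n.
Qed.

Lemma slope_lim a b : ulim U (slope a b) (b%:R - a%:R).
Proof.
have s k : ulim U (fun j => \sum_(i < k) w j ^+ i) k%:R.
  have := ulim_sum UU (index_enum 'I_k) (fun i => ulimX UU i wlim).
  have -> : \sum_(i : 'I_k) (1 : R[i]) ^+ i = k%:R.
    by under eq_bigr do rewrite expr1n; rewrite sumr_const card_ord.
  by [].
have -> : b%:R - a%:R = 1^* ^+ a * (b%:R + -1 * a%:R) :> R[i].
  by rewrite rmorph1 expr1n mul1r mulN1r.
apply: (ulim_ext (x := fun j => (w j)^* ^+ a * (\sum_(i < b) w j ^+ i + -1 * \sum_(i < a) w j
    ^+ i))).
  by move=> j; rewrite mulN1r.
apply: ulimM; first by apply: ulimX; exact: ulim_conj.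
by apply: ulimD => //; apply: ulimM => //; exact: ulim_cst.
Qed.

(** Rotating [z] by [w j] shifts [k] by one, and the summands are periodic in [k] with period
    [N j]. *)
Lemma twisted_mean_rotate a b z j : twisted_mean a b (z * w j) j = (twist a b j)^* *
    twisted_mean a b z j.
Proof.
rewrite /twisted_mean -[in RHS]avg_shift; last by rewrite wN twistN !expr0.
rewrite -avgZ; apply: eq_avg => k.
have -> : z * w j * w j ^+ k = z * w j ^+ k.+1 by rewrite exprS mulrA.
rewrite [twist a b j ^+ k.+1]exprS; set F := f _; set q := twist a b j.
transitivity ((q * q^*) * (F * q ^+ k)); first by rewrite twist_conj mul1r.
by ring.
Qed.

(* Rotating by the root of unity [w] multiplies the mean by [(twist a b)^*]; hence
   its increment along [u = z (w - 1)] is both [z (w - 1)] times the derivative and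
   [slope * (w - 1)] times the mean. *)
Lemma twisted_lim_ode a b (z : R[i]) : rnorm z < 1 -> z * twisted_der_lim a b z = (b%:R -
    a%:R) * twisted_lim a b z.
Proof.
move=> z1; apply/esym/eqP; rewrite -subr_eq0; apply/eqP; apply: (@rnorm_small _ _ _ (rnorm
    z)) => e e0.
have [q q0 hq] := coef_derivative a b z1 e0.
apply: (ulim_le UU (x := fun j => slope a b j * twisted_mean a b z j) (y := fun j => z *
    twisted_der_mean a b z j)).
- by apply: ulimM (twisted_limP _ _ z1) => //; exact: slope_lim.
- by apply: ulimM (twisted_der_limP _ _ z1) => //; exact: ulim_cst.
have qz : 0 < q / (rnorm z + 1) by rewrite divr_gt0// ltr_wpDl// rnorm_ge0.
apply: filterS (wlim qz) => j /=; rewrite rnormB => k.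
have wj : 0 < rnorm (w j - 1).
  by rewrite lt_neqAle eq_sym rnorm_ge0 andbT; apply: contra_neq (wn1 j) => /rnorm_eq0/eqP;
      rewrite subr_eq0 => /eqP.
have uq : rnorm (z * (w j - 1)) < q.
  rewrite rnormM; move: k; rewrite ltr_pdivlMr ?ltr_wpDl ?rnorm_ge0// mulrC; apply: le_lt_trans.
  by rewrite ler_wpM2r ?rnorm_ge0// lerDl.
have := hq _ uq j; have -> : z + z * (w j - 1) = z * w j by ring.
rewrite twisted_mean_rotate.
have -> : (twist a b j)^* * twisted_mean a b z j - (twisted_mean a b z j + z * (w j - 1) *
    twisted_der_mean a b z j)
  = (w j - 1) * (slope a b j * twisted_mean a b z j - z * twisted_der_mean a b z j).
  have -> : (twist a b j)^* = slope a b j * (w j - 1) + 1 by rewrite -slopeE subrK.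
  by ring.
by rewrite !rnormM mulrA [leRHS]mulrC ler_pM2l.
Qed.

(** A negative index would force a pole: with [k = a - b], the differential equation makes [z ^+ k]
    times the limit constant, and this product vanishes at [0]. *)
Lemma twisted_lim_neg a b (z : R[i]) : (b < a)%N -> rnorm z < 1 -> twisted_lim a b z = 0.
Proof.
move=> ab z1; set k := (a - b)%N.
have kE : b%:R - a%:R = - k%:R :> R[i] by rewrite /k natrB ?(ltnW ab)// opprB.
have k0 : (0 < k)%N by rewrite subn_gt0.
have ode (x : R[i]) : rnorm x < 1 -> x * twisted_der_lim a b x = - k%:R * twisted_lim a b x
    by move=> /twisted_lim_ode ->; rewrite kE.
have [->|zn0] := eqVneq z 0.
  have := ode 0; rewrite rnorm0 ltr01 mul0r => /(_ isT)/esym/eqP.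
  by rewrite mulf_eq0 oppr_eq0 pnatr_eq0 (gtn_eqF k0)/= => /eqP.
pose F x := x ^+ k * twisted_lim a b x.
have dF x : rnorm x < 1 -> has_cderiv F x 0.
  move=> x1; have := has_cderivM (has_cderivX k (@has_cderiv_id R x)) (@twisted_lim_der a b x x1).
  apply: has_cderiv_eq; rewrite mulr1; case: (k) k0 (ode _ x1) => // n _ /= h.
  by rewrite (exprSr x) -[_ * x * _]mulrA h; ring.
have := @mean_value_inequality R F 0 z 0 (fun=> 0) 0; rewrite mulr0 !subr0 add0r mul0r.
move=> h; have {}h := h _ _; have : rnorm (F z - F 0) <= 0.
  apply: h => t t01; last by rewrite rnorm0.
  rewrite add0r; apply: dF.
  have := segment_rnorm 0 z t01; rewrite !add0r rnorm0 => /le_lt_trans; apply.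
  by rewrite gt_max z1 ltr01.
move=> h1; have : F z - F 0 = 0.
  by apply: rnorm_eq0; apply/eqP; rewrite eq_le h1 rnorm_ge0.
rewrite /F expr0n; case: (k) k0 => // n _; rewrite mul0r subr0 => /eqP.
by rewrite mulf_eq0 expf_eq0/= (negbTE zn0) => /eqP.
Qed.

Lemma twisted_lim_segment a b (z u : R[i]) : (a <= b)%N -> rnorm z < 1 -> rnorm (z + u) < 1 ->
  (forall t : R, 0 <= t <= 1 -> z + t%:C%C * u != 0) ->
  twisted_lim a b (z + u) * (z + u)^-1 ^+ (b - a) = twisted_lim a b z * z^-1 ^+ (b - a).
Proof.
move=> ab z1 zu1 h0; set n := (b - a)%N.
have nE : b%:R - a%:R = n%:R :> R[i] by rewrite /n natrB.
pose F x := twisted_lim a b x * x^-1 ^+ n.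
have dF x : rnorm x < 1 -> x != 0 -> has_cderiv F x 0.
  move=> x1 x0; have := has_cderivM (@twisted_lim_der a b x x1) (has_cderivX n (has_cderivV x0)).
  apply: has_cderiv_eq; have := @twisted_lim_ode a b x x1; rewrite nE; case: (n) => [|m] /= h.
    have /eqP := h; rewrite mul0r mulf_eq0 (negbTE x0)/= => /eqP ->.
    by ring.
  have -> : twisted_der_lim a b x = m.+1%:R * twisted_lim a b x / x by rewrite -h mulrAC
      divff// mul1r.
  by rewrite exprS; field.
have h := @mean_value_inequality R F z u 0 (fun=> 0) 0; rewrite mulr0 !subr0 mul0r in h.
apply/eqP; rewrite -subr_eq0; apply/eqP.
apply: rnorm_eq0; apply/eqP; rewrite eq_le rnorm_ge0 andbT; apply: h => t t01.
  apply: dF; last exact: h0.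
  apply: le_lt_trans (segment_rnorm z u t01) _; by rewrite gt_max z1.
by rewrite rnorm0.
Qed.

(* [twisted_lim z / z^(b-a)] is constant along segments avoiding [0]; if [z] cannot
   be reached from [z0] in this way, it can be reached through ['i z0]. *)
Lemma twisted_lim_nonneg a b : (a <= b)%N -> exists c : R[i], forall z, rnorm z < 1 ->
  twisted_lim a b z = c * z ^+ (b - a).
Proof.
move=> ab; set n := (b - a)%N; pose z0 : R[i] := 2^-1.
have z01 : rnorm z0 < 1 by rewrite /z0 rnormV rnormn invf_lt1// ltr1n.
have z00 : z0 != 0 by rewrite invr_neq0.
pose G z := twisted_lim a b z * z^-1 ^+ n.
have seg z v : rnorm z < 1 -> rnorm v < 1 ->
    (forall t : R, 0 <= t <= 1 -> z + t%:C%C * (v - z) != 0) -> G v = G z.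
  move=> z1 v1 h; have E : z + (v - z) = v by rewrite addrC subrK.
  by have := @twisted_lim_segment a b z (v - z) ab z1; rewrite E => /(_ v1 h).
have i0 : rnorm ('i%C : R[i]) = 1 by rewrite /rnorm complexiE normCi.
have Gc z : rnorm z < 1 -> z != 0 -> G z = G z0.
  move=> z1 zn0.
  have [h|/existsNP[t]] := pselect (forall t : R, 0 <= t <= 1 -> z0 + t%:C%C * (z - z0) != 0).
    exact: seg.
  move=> /not_implyP[t01 /negP]; rewrite negbK => /eqP zt.
  have c1 (x : R[i]) (s : R) : x != 0 -> x + s%:C%C * ('i%C * x - x) != 0.
    move=> x0; rewrite (_ : x + s%:C%C * ('i%C * x - x) = x * ((1 - s)%:C%C + s%:C%C *
        'i%C)); last first.
      by rewrite rmorphB rmorph1; ring.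
    rewrite mulf_neq0//; apply/eqP => /eqP; rewrite eq_complex/= !mulr0 !mul0r !subr0 !addr0
        add0r mulr1.
    by move=> /andP[/eqP + /eqP]; lra.
  have iz1 : rnorm ('i%C * z0) < 1 by rewrite rnormM i0 mul1r.
  rewrite -(seg z0 ('i%C * z0) z01 iz1) => [|s _]; last exact: c1.
  apply: seg => // s s01; apply/eqP => zs.
  have eqs (x : R[i]) (r : R) : x != 0 -> x + r%:C%C * (z - x) = 0 -> r != 0 /\
     z * r%:C%C = (r - 1)%:C%C * x.
    move=> x0 h; split.
      by apply: contra_neq x0 => r0; move: h; rewrite r0 rmorph0 mul0r addr0.
    apply/eqP; rewrite -subr_eq0 -h rmorphB rmorph1; apply/eqP; ring.
  have [tn0 h1] := eqs _ _ z00 zt.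
  have iz0 : 'i%C * z0 != 0 by rewrite mulf_neq0// complexiE neq0Ci.
  have [sn0 h2] := eqs _ _ iz0 zs.
  have : (t - 1)%:C%C * s%:C%C = (s - 1)%:C%C * t%:C%C * 'i%C :> R[i].
    by apply: (mulIf z00); rewrite mulrAC -h1 mulrAC h2; ring.
  rewrite -!rmorphM => /eqP; rewrite eq_complex/= !mulr0 !mul0r subr0 mulr1 addr0.
  move=> /andP[/eqP h3 _].
  have /eqP : (t - 1) * s = 0 by rewrite h3; ring.
  rewrite mulf_eq0 (negbTE sn0) orbF => /eqP t1.
  move: h1; rewrite t1 rmorph0 mul0r => /eqP; rewrite mulf_eq0 (negbTE zn0)/=.
  by rewrite (_ : 0 = 0%:C%C)// (inj_eq (@complexI R)) (negbTE tn0).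
exists (G z0) => z z1; have [->|zn0] := eqVneq z 0; last first.
  by rewrite -(Gc z)// /G -mulrA -exprMn mulVf// expr1n mulr1.
have [n0|n0] := posnP n; last first.
  have := @twisted_lim_ode a b 0; rewrite rnorm0 ltr01 mul0r => /(_ isT)/esym/eqP.
  rewrite -natrB// -/n mulf_eq0 pnatr_eq0 gtn_eqF//= => /eqP ->.
  by rewrite expr0n gtn_eqF// mulr0.
rewrite n0 expr0 mulr1; apply/eqP; rewrite -subr_eq0; apply/eqP.
have r01 : rnorm (0 : R[i]) < 1 by rewrite rnorm0.
have [q q0 hq] := has_cderiv_cont (@twisted_lim_der a b 0 r01) ltr01.
apply: (@rnorm_small _ _ _ 1) => e e0.
have [r r0 hr] := has_cderiv_cont (@twisted_lim_der a b 0 r01) e0.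
pose x := Num.min (r / 2) (1 / 2).
have x0 : 0 < x by rewrite lt_min !divr_gt0.
have xr : x < r by have : x <= r / 2 by [rewrite ge_min lexx]; lra.
have x1 : x < 1 by have : x <= 1 / 2 by [rewrite ge_min lexx orbT]; lra.
have rx : rnorm (x%:C%C : R[i]) = x by rewrite rnorm_real gtr0_norm.
have xn0 : x%:C%C != 0 :> R[i] by rewrite (_ : 0 = 0%:C%C)// (inj_eq (@complexI R)) gt_eqF.
have -> : G z0 = twisted_lim a b x%:C%C by rewrite -(Gc x%:C%C) ?rx// /G n0 expr0 mulr1.
by rewrite rnormB mulr1; apply: hr; rewrite subr0 rx.
Qed.

Lemma twisted_lim_poly a b : exists p : {poly R[i]}, forall z, rnorm z < 1 -> twisted_lim a b
    z = p.[z].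
Proof.
have [ab|ab] := leqP a b.
  have [c hc] := twisted_lim_nonneg ab; exists (c%:P * 'X^(b - a)) => z /hc ->.
  by rewrite !hornerE.
by exists 0 => z z1; rewrite horner0 twisted_lim_neg.
Qed.

(** Shifting [k] shows that [(twist a b j)^* - 1] times the mean is zero. Dividing by [w j - 1]
    before passing to the limit leaves the factor [slope], whose limit [b - a] is nonzero when [a]
    and [b] differ. *)
Lemma twist_avg_lim a b : ulim U (fun j => avg (N j) (fun k => twist a b j ^+ k)) (a == b)%:R.
Proof.
have [->|ab] := eqVneq a b.
  apply: (ulim_ext (x := fun=> 1)); last exact: ulim_cst.
  move=> j; rewrite -[LHS](avg_cst 1 (N0 j)); apply: eq_avg => k.
  by rewrite /twist -exprMn ww !expr1n.
have [l hl] : exists l, ulim U (fun j => avg (N j) (fun k => twist a b j ^+ k)) l.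
  apply: (@ulim_exists _ _ UU _ 1) => j; apply: avg_le_cst => // k.
  by rewrite twist1.
suff l0 : l = 0 by rewrite l0 in hl.
have sl := ulimM UU (slope_lim a b) hl.
have : (b%:R - a%:R) * l = 0.
  apply: (ulim_unique UU sl); apply: (ulim_ext (x := fun=> 0)); last exact: ulim_cst.
  move=> j; apply/esym.
  have : ((twist a b j)^* - 1) * avg (N j) (fun k => twist a b j ^+ k) = 0.
    rewrite mulrBl mul1r -{1}avg_shift; last by rewrite twistN expr0.
    rewrite -avgZ; apply/eqP; rewrite subr_eq0; apply/eqP; apply: eq_avg => k.
    by rewrite exprS mulrA (mulrC _^*) twist_conj mul1r.
  rewrite slopeE mulrAC => /eqP; rewrite mulf_eq0 subr_eq0 (negbTE (wn1 j)) orbF.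
  by move=> /eqP.
move/eqP; rewrite mulf_eq0 subr_eq0 eqr_nat eq_sym (negbTE ab)/= => /eqP.
by [].
Qed.

Section Fejer.
Variables (m : nat) (m0 : (0 < m)%N).

(** The Fejer kernel, nonnegative by its form; expanding the square gives the twists, hence finitely
    many monomials in the limit of the means. *)
Definition fejer (x : R[i]) : R := rnorm (\sum_(a < m) x ^+ a) ^+ 2 / m%:R.

Lemma fejer_ge0 x : 0 <= fejer x.
Proof. by rewrite divr_ge0// sqr_ge0. Qed.

Lemma fejerE j k : (fejer (w j ^+ k))%:C%C =
  m%:R^-1 * \sum_(a < m) \sum_(b < m) twist a b j ^+ k :> R[i].
Proof.
rewrite /fejer rmorphM/= -mul_conj_rnorm mulrC fmorphV rmorph_nat; congr (_ * _).
rewrite mulr_suml; apply: eq_bigr => a _; rewrite rmorph_sum mulr_sumr.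
apply: eq_bigr => b _; rewrite /= /twist exprMn !rmorphXn/= -!exprM.
by rewrite mulnC (mulnC k b).
Qed.

(* This replaces the usual second moment computation: [(x - 1) \sum_(a < m) x^a]
   is [x^m - 1]. *)
Lemma fejer_moment j k : rnorm (w j ^+ k - 1) ^+ 2 * fejer (w j ^+ k) <= 4 / m%:R.
Proof.
rewrite /fejer mulrA -exprMn -rnormM -subrX1 ler_wpM2r ?invr_ge0//.
have : rnorm ((w j ^+ k) ^+ m - 1) <= 2.
  by apply: le_trans (rnormD _ _) _; rewrite rnormN rnorm1 rnormX wX expr1n.
have := rnorm_ge0 ((w j ^+ k) ^+ m - 1); nra.
Qed.

Definition fejer_mean z j := avg (N j) (fun k => f (z * w j ^+ k) * (fejer (w j ^+ k))%:C%C).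
Definition fejer_mass j : R[i] := avg (N j) (fun k => (fejer (w j ^+ k))%:C%C).

Lemma fejer_mean_lim z : rnorm z < 1 ->
  ulim U (fejer_mean z) (m%:R^-1 * \sum_(a < m) \sum_(b < m) twisted_lim a b z).
Proof.
move=> z1; apply: (ulim_ext (x := fun j => m%:R^-1 * \sum_(a < m) \sum_(b < m) twisted_mean a
    b z j)).
  move=> j; rewrite /fejer_mean.
  under eq_bigr do rewrite -avg_sum.
  rewrite -avg_sum -avgZ; apply: eq_avg => k; rewrite fejerE mulrCA; congr (_ * _).
  by rewrite mulr_sumr; apply: eq_bigr => a _; rewrite mulr_sumr.
apply: ulimM; first exact: ulim_cst.
by apply: ulim_sum => a; apply: ulim_sum => b; exact: twisted_limP.
Qed.

Lemma fejer_mass_lim : ulim U fejer_mass 1.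
Proof.
have -> : 1 = m%:R^-1 * \sum_(a < m) \sum_(b < m) ((a : nat) == b)%:R :> R[i].
  under eq_bigr => a _.
    rewrite (bigD1 a)//= eqxx big1 ?addr0; last first.
      by move=> b ba; rewrite eq_sym -[_ == _]/(b == a) (negbTE ba).
    over.
  by rewrite sumr_const card_ord mulVf// pnatr_eq0 -lt0n.
apply: (ulim_ext (x := fun j => m%:R^-1 * \sum_(a < m) \sum_(b < m) avg (N j) (fun k => twist
    a b j ^+ k))).
  move=> j; rewrite /fejer_mass.
  under eq_bigr do rewrite -avg_sum.
  by rewrite -avg_sum -avgZ; apply: eq_avg => k; rewrite fejerE.
apply: ulimM; first exact: ulim_cst.
by apply: ulim_sum => a; apply: ulim_sum => b; exact: twist_avg_lim.
Qed.

Let mass_le e : 0 < e -> U [set j | rnorm (fejer_mass j) <= 1 + e].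
Proof.
move=> e0; apply: filterS (fejer_mass_lim e0) => j /= h.
rewrite -(subrK 1 (fejer_mass j)) addrC; apply: le_trans (rnormD _ _) _.
by rewrite rnorm1 lerD2l rnormB ltW.
Qed.

Lemma fejer_poly : exists p : {poly R[i]}, forall z, rnorm z < 1 -> ulim U (fejer_mean z) p.[z].
Proof.
have h (ab : nat * nat) : {p : {poly R[i]} | forall z, rnorm z < 1 -> twisted_lim ab.1 ab.2 z
    = p.[z]}.
  by apply: cid; exact: twisted_lim_poly.
exists (m%:R^-1 *: \sum_(a < m) \sum_(b < m) projT1 (h (a : nat, b : nat))) => z z1.
rewrite hornerZ horner_sum.
under eq_bigr => a _.
  rewrite horner_sum; under eq_bigr => b _ do rewrite -(projT2 (h (a : nat, b : nat)) z z1).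
  over.
exact: fejer_mean_lim.
Qed.

(** A nonnegative kernel of mass tending to [1] averages rotated copies of [f], which share the
    Lipschitz constant [M]; no constant is lost. *)
Lemma fejer_lipschitz z v p : rnorm z < 1 -> rnorm v < 1 ->
  ulim U (fejer_mean z) p -> forall q, ulim U (fejer_mean v) q -> rnorm (p - q) <= M * rnorm
      (z - v).
Proof.
move=> z1 v1 hp q hq; set C := M * rnorm (z - v).
have C0 : 0 <= C by rewrite mulr_ge0// rnorm_ge0.
apply: (@ler_small _ _ _ C) => // e e0.
apply: (ulim_le UU hp hq); apply: filterS (mass_le e0) => j /= h.
apply: (@le_trans _ _ (C * rnorm (fejer_mass j))); last first.
  by apply: le_trans (ler_wpM2l C0 h) _; rewrite mulrDr mulr1 mulrC (mulrC e).
rewrite /fejer_mean -avgB; apply: avg_le => // k; first exact: fejer_ge0.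
rewrite -mulrBl rnormM rnorm_real (ger0_norm (fejer_ge0 _)) ler_wpM2r ?fejer_ge0//.
by apply: le_trans (disk_lipschitz _ _) _; rewrite ?zw// -mulrBl zw.
Qed.

Lemma fejer_approx (eta : R) z p : 0 < eta -> 2 / eta ^+ 2 <= m%:R -> rnorm z < 1 ->
  ulim U (fejer_mean z) p -> rnorm (p - f z) <= 2 * M * eta.
Proof.
move=> eta0 hm z1 hp.
have m0' : 0 < m%:R :> R by rewrite ltr0n.
have hfz : ulim U (fun j => fejer_mass j * f z) (f z).
  by rewrite -[X in ulim _ _ X]mul1r; apply: ulimM fejer_mass_lim _ => //; exact: ulim_cst.
apply: (ulim_le UU hp hfz); apply: filterS (mass_le ltr01) => j /= h.
have -> : fejer_mean z j - fejer_mass j * f z =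
    avg (N j) (fun k => (f (z * w j ^+ k) - f z) * (fejer (w j ^+ k))%:C%C).
  rewrite /fejer_mass mulrC -avgZ -avgB; apply: eq_avg => k; ring.
(* Pointwise, [x <= eta / 2 + x^2 / (2 eta)] for [x = rnorm (w j ^+ k - 1)]; the second moment bound
   [4 / m%:R] then gives the constant term. With mass at most [2] and the hypothesis on [m], the
   average of [K] is at most [2 * eta]. *)
pose K k : R := eta / 2 * fejer (w j ^+ k) + 2 / (eta * m%:R).
have K0 k : 0 <= K k.
  apply: addr_ge0; first by rewrite mulr_ge0 ?fejer_ge0// divr_ge0// ltW.
  by rewrite divr_ge0// mulr_ge0// ltW.
apply: le_trans (@avg_le _ _ _ M K M0 K0 _) _ => [k|].
  rewrite rnormM rnorm_real (ger0_norm (fejer_ge0 _)).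
  have lip : rnorm (f (z * w j ^+ k) - f z) <= M * rnorm (w j ^+ k - 1).
    apply: le_trans (disk_lipschitz _ _) _; rewrite ?zw// ler_wpM2l//.
    rewrite -[X in rnorm (_ - X)]mulr1 -mulrBr rnormM ler_piMl ?rnorm_ge0//.
    exact: ltW.
  apply: le_trans (ler_wpM2r (fejer_ge0 _) lip) _; rewrite -mulrA ler_wpM2l//.
  have := fejer_moment j k; have := fejer_ge0 (w j ^+ k); rewrite /K.
  set x := rnorm _; set y := fejer _ => y0 xy.
  have : 2 * eta * (x * y) <= eta ^+ 2 * y + x ^+ 2 * y.
    have := mulr_ge0 (sqr_ge0 (eta - x)) y0; nra.
  move=> k1.
  have k2 : 2 * eta * (x * y) <= 2 * eta * (eta / 2 * y + 2 / (eta * m%:R)).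
    have -> : 2 * eta * (eta / 2 * y + 2 / (eta * m%:R)) = eta ^+ 2 * y + 4 / m%:R.
      by field; rewrite !gt_eqF.
    lra.
  by move: k2; rewrite ler_pM2l// mulr_gt0.
rewrite -mulrA mulrCA ler_wpM2l//.
have -> : avg (N j) (fun k => (K k)%:C%C) = (eta / 2)%:C%C * fejer_mass j + (2 / (eta * m%:R))%:C%C.
  rewrite -(avg_cst (2 / (eta * m%:R))%:C%C (N0 j)) -avgZ -avgD; apply: eq_avg => k.
  by rewrite /K rmorphD rmorphM.
apply: le_trans (rnormD _ _) _; rewrite rnormM !rnorm_real.
have e2 : 0 <= eta / 2 by rewrite divr_ge0// ltW.
have e3 : 0 <= 2 / (eta * m%:R) by rewrite divr_ge0// mulr_ge0 ?ltW.
rewrite !ger0_norm//.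
have k1 : 2 / (eta * m%:R) <= eta.
  rewrite ler_pdivrMr ?mulr_gt0// mulrA -expr2.
  by move: hm; rewrite ler_pdivrMr ?exprn_gt0// mulrC.
have := ler_wpM2l e2 h; lra.
Qed.

End Fejer.

End DiskApproximation.

(** * From the open disk to the closed disk *)

Section DiskAlgebra.
Variables (R : realType) (phi : R[i] -> R[i]).
Hypothesis phi_analytic : analytic_in_disk phi.
Hypothesis dphi_Hinfty : Hinfty (derive1 phi).

Lemma unit_diskE (z : R[i]) : unit_disk z <-> rnorm z < 1.
Proof. by rewrite /unit_disk /= -rnormE (ltcR _ 1). Qed.

Lemma bounded_derivative : exists2 M : R, 0 <= M &
  forall z, rnorm z < 1 -> rnorm (derive1 phi z) <= M.
Proof.
have [_ [C hC]] := dphi_Hinfty.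
have C0 : 0 <= C by apply: le_trans (hC 0 _); rewrite // unit_diskE rnorm0.
exists (rnorm C) => [|z z1]; first exact: rnorm_ge0.
by rewrite -lecR !rnormE (ger0_norm C0); apply: hC; rewrite unit_diskE.
Qed.

Lemma phi_der z : rnorm z < 1 -> has_cderiv phi z (derive1 phi z).
Proof. by move=> z1; apply: derivable_has_cderiv; apply: phi_analytic; rewrite unit_diskE. Qed.

Lemma dphi_der z : rnorm z < 1 -> exists c, has_cderiv (derive1 phi) z c.
Proof.
move=> z1; exists (derive1 (derive1 phi) z); apply: derivable_has_cderiv.
by have [h _] := dphi_Hinfty; apply: h; rewrite unit_diskE.
Qed.

Lemma open_disk_polynomial (M eta : R) : 0 <= M ->
  (forall z, rnorm z < 1 -> rnorm (derive1 phi z) <= M) -> 0 < eta ->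
  exists p : {poly R[i]},
    (forall z, rnorm z < 1 -> rnorm (p.[z] - phi z) <= eta) /\
    (forall z v, rnorm z < 1 -> rnorm v < 1 -> rnorm (p.[z] - p.[v]) <= M * rnorm (z - v)).
Proof.
move=> M0 hM eta0.
have hroot j : {Nw : nat * R[i] | [/\ (0 < Nw.1)%N, Nw.2 ^+ Nw.1 = 1, Nw.2 != 1,
    rnorm Nw.2 = 1 & rnorm (Nw.2 - 1) < j.+1%:R^-1]}.
  apply: cid; have [|N [w h]] := @root_of_unity_near1 R j.+1%:R^-1; first by rewrite invr_gt0.
  by exists (N, w).
pose N j := (projT1 (hroot j)).1; pose w j := (projT1 (hroot j)).2.
have N0 j : (0 < N j)%N by have [] := projT2 (hroot j).
have wN j : w j ^+ N j = 1 by have [] := projT2 (hroot j).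
have wn1 j : w j != 1 by have [] := projT2 (hroot j).
have w1 j : rnorm (w j) = 1 by have [] := projT2 (hroot j).
have wd j : rnorm (w j - 1) < j.+1%:R^-1 by have [] := projT2 (hroot j).
have [U [UU Uoo]] := ultrafilter_oo.
have wlim : ulim U w 1.
  move=> e e0; apply: Uoo; have [n0 hn0] := inv_small e0.
  by exists n0 => // n /= /hn0; apply: lt_trans; rewrite rnormB.
(* [fejer_approx] costs a factor [2 * M]; [M + 1] replaces [M] to avoid dividing by [0]. *)
pose eta' := eta / (2 * (M + 1)).
have M1 : 0 < M + 1 by rewrite ltr_wpDl.
have eta'0 : 0 < eta' by rewrite divr_gt0// mulr_gt0.
have etaE : 2 * (M + 1) * eta' = eta by rewrite /eta'; field; rewrite gt_eqF.
have [m hm] := inv_small (divr_gt0 (exprn_gt0 2 eta'0) (ltr0n R 2)).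
have {}hm : 2 / eta' ^+ 2 <= m.+1%:R.
  have := hm m (leqnn m); rewrite invf_plt ?posrE// ?divr_gt0 ?exprn_gt0// invf_div.
  exact: ltW.
have m0 : (0 < m.+1)%N by [].
have [p hp] := fejer_poly M0 phi_der dphi_der hM UU N0 wN wn1 w1 wlim m.+1.
exists p; split=> [z z1|z v z1 v1].
  have := fejer_approx M0 phi_der hM UU N0 wN wn1 w1 wlim m0 eta'0 hm z1 (hp z z1).
  by move=> h; apply: le_trans h _; rewrite -etaE ler_wpM2r ?(ltW eta'0)//; lra.
exact: (fejer_lipschitz M0 phi_der hM UU N0 wN wn1 w1 wlim m0 z1 v1 (hp z z1) (hp v v1)).
Qed.

Lemma disk_interior_point (z : R[i]) (e : R) : rnorm z <= 1 -> 0 < e ->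
  exists2 x : R[i], rnorm x < 1 & rnorm (x - z) < e.
Proof.
move=> z1 e0; pose t := Num.min (1 / 2) (e / 2).
have t0 : 0 < t by rewrite lt_min !divr_gt0.
have t1 : t <= 1 / 2 by rewrite ge_min lexx.
have te : t <= e / 2 by rewrite ge_min lexx orbT.
have z0 := rnorm_ge0 z.
exists ((1 - t)%:C%C * z); rewrite -1?[X in _ - X]mul1r -1?mulrBl rnormM.
  rewrite rnorm_real ger0_norm; nra.
by rewrite -[X in _ - X](rmorph1 (real_complex R)) -rmorphB rnorm_real ler0_norm; nra.
Qed.

(* The library does not provide completeness of [R[i]]: the limit is found along an
   ultrafilter, the values of [phi] staying in a compact disk. *)
Lemma disk_closure_approx (z : R[i]) (e : R) : rnorm z <= 1 -> 0 < e ->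
  exists x : R[i], [/\ rnorm x < 1, rnorm (x - z) < e &
    rnorm (disk_closure phi z - phi x) < e].
Proof.
move=> z1 e0; set F := within (@unit_disk R) (nbhs z).
have FF0 : Filter F by exact: within_filter.
have FF : ProperFilter F.
  apply: Build_ProperFilter_ex => P /nbhs_ballP[r /= r0 hr].
  have rE : (complex.Re r)%:C%C = r by rewrite RRe_real// gtr0_real.
  have r0' : 0 < complex.Re r by rewrite -(ltcR 0) rE.
  have [x x1 xz] := disk_interior_point z1 r0'.
  exists x; apply: hr; last by rewrite unit_diskE.
  by rewrite -ball_normE/= -rnormE rnormB -rE ltcR.
have near_z (q : R) : 0 < q -> F [set x | rnorm x < 1 /\ rnorm (x - z) < q].
  move=> q0; apply/nbhs_ballP; exists q%:C%C; first by rewrite /= (ltcR 0).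
  move=> x; rewrite -ball_normE/= -rnormE ltcR rnormB => xz.
  by rewrite unit_diskE.
have [M M0 hM] := bounded_derivative.
have M1 : 0 < M + 1 by rewrite ltr_wpDl.
have cv : cvg (phi @ F).
  have [U [UU FleU]] := ultraFilterLemma FF.
  have PU : ProperFilter U := @ultra_proper _ _ UU.
  have [l [_ hl]] : cdisc (rnorm (phi 0) + M) `&` [set l | phi @ U --> l] !=set0.
    have := @cdisc_compact R (rnorm (phi 0) + M); rewrite compact_ultra.
    move=> /(_ _ (ultra_fmap phi UU)); apply.
    apply: FleU; apply: filterS (near_z _ ltr01) => x [x1 _].
    exact: disk_bounded M0 phi_der hM x x1.
  apply/cvg_ex; exists l; apply/rnorm_cvgP => q q0.
  have q2 : 0 < q / 2 by rewrite divr_gt0.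
  have r0 : 0 < q / 2 / (2 * (M + 1)) by rewrite divr_gt0// mulr_gt0.
  move/rnorm_cvgP : hl => /(_ _ q2) hl.
  have [x [[x1 xz] lx]] := filter_ex (filterI (FleU _ (near_z _ r0)) hl).
  apply: filterS (near_z _ r0) => y [y1 yz].
  have xy : rnorm (x - y) <= 2 * (q / 2 / (2 * (M + 1))).
    rewrite -(subrK z x) -addrA; apply: le_trans (rnormD _ _) _.
    by rewrite (rnormB z); lra.
  have k1 := disk_lipschitz phi_der hM y1 x1.
  have k2 : M * rnorm (x - y) <= q / 2.
    apply: (@le_trans _ _ ((M + 1) * (2 * (q / 2 / (2 * (M + 1)))))).
      by apply: ler_pM; rewrite ?rnorm_ge0// lerDl.
    by rewrite le_eqVlt; apply/orP; left; apply/eqP; field; rewrite gt_eqF.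
  rewrite -(subrK (phi x) l) -addrA; apply: le_lt_trans (rnormD _ _) _.
  rewrite [ltRHS](splitr q); apply: ltr_leD => //; exact: le_trans k1 k2.
move/rnorm_cvgP : cv => /(_ e e0) hl.
have [x [[x1 xz] hx]] := filter_ex (filterI (near_z _ e0) hl).
by exists x.
Qed.

Lemma horner_der (p : {poly R[i]}) z : exists c, has_cderiv (horner p) z c.
Proof.
elim/poly_ind: p => [|p c [b hb]].
  by exists 0; have := has_cderiv_cst 0 z; congr has_cderiv; apply: funext => x; rewrite horner0.
exists (b * z + p.[z] * 1).
have -> : horner (p * 'X + c%:P) = fun x => p.[x] * x + c.
  by apply: funext => x; rewrite !hornerE.
move=> e e0; have [q q0 hq] := has_cderivM hb (@has_cderiv_id R z) e0.
exists q => // u /hq; rewrite opprD addrACA subrr addr0; exact.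
Qed.

Lemma sub_sub2 (a b c d : R[i]) : a - b = (a - c) + ((c - d) - (b - d)).
Proof. by ring. Qed.

(** The constant [M] is the same for [phi] and for all the polynomials, whatever [eta]: near the
    diagonal the final estimate relies on it. The bounds pass to the closed disk by approximating
    points from inside. *)
Lemma closed_disk_approximation : exists2 M : R, 0 <= M &
  (forall z v, rnorm z <= 1 -> rnorm v <= 1 ->
     rnorm (disk_closure phi z - disk_closure phi v) <= M * rnorm (z - v)) /\
  forall eta : R, 0 < eta -> exists p : {poly R[i]},
    (forall z, rnorm z <= 1 -> rnorm (disk_closure phi z - p.[z]) <= eta) /\
    (forall z v, rnorm z <= 1 -> rnorm v <= 1 -> rnorm (p.[z] - p.[v]) <= M * rnorm (z - v)).
Proof.
have [M M0 hM] := bounded_derivative; exists M => //; split.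
  move=> z v z1 v1; apply: (@ler_small _ _ _ (2 + 2 * M)); first by rewrite addr_ge0// mulr_ge0.
  move=> e e0; have [x [x1 xz hx]] := disk_closure_approx z1 e0.
  have [y [y1 yv hy]] := disk_closure_approx v1 e0.
  rewrite (sub_sub2 _ _ (phi x) (phi y)).
  apply: le_trans (rnormD _ _) _; apply: le_trans (lerD (lexx _) (rnormD _ _)) _.
  rewrite rnormN; have := disk_lipschitz phi_der hM y1 x1.
  have : rnorm (x - y) <= rnorm (z - v) + 2 * e.
    have -> : x - y = (x - z) + ((z - v) - (y - v)) by ring.
    apply: le_trans (rnormD _ _) _; have := rnormD (z - v) (- (y - v)); rewrite rnormN; lra.
  move=> /(ler_wpM2l M0); lra.
move=> eta eta0; have [p [hp lp]] := open_disk_polynomial M0 hM eta0; exists p; split.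
  move=> z z1; apply: (@ler_small _ _ _ 2) => // e e0.
  have [c hc] := horner_der p z; have [q q0 hq] := has_cderiv_cont hc e0.
  have qe : 0 < Num.min q e by rewrite lt_min q0.
  have [x [x1]] := disk_closure_approx z1 qe.
  rewrite !lt_min => /andP[/hq px _] /andP[_ hx].
  rewrite (sub_sub2 _ _ (phi x) p.[x]).
  apply: le_trans (rnormD _ _) _; apply: le_trans (lerD (lexx _) (rnormD _ _)) _.
  rewrite rnormN [in X in _ + (X + _)]rnormB [in X in _ + (_ + X)]rnormB.
  have := hp _ x1; lra.
move=> z v z1 v1; apply: (@ler_small _ _ _ (2 + 2 * M)); first by rewrite addr_ge0// mulr_ge0.
move=> e e0.
have [c hc] := horner_der p z; have [q q0 hq] := has_cderiv_cont hc e0.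
have [c' hc'] := horner_der p v; have [q' q'0 hq'] := has_cderiv_cont hc' e0.
have qe : 0 < Num.min q e by rewrite lt_min q0.
have q'e : 0 < Num.min q' e by rewrite lt_min q'0.
have [x x1] := disk_interior_point z1 qe; rewrite lt_min => /andP[/hq px xz].
have [y y1] := disk_interior_point v1 q'e; rewrite lt_min => /andP[/hq' py yv].
rewrite (sub_sub2 _ _ p.[x] p.[y]).
apply: le_trans (rnormD _ _) _; apply: le_trans (lerD (lexx _) (rnormD _ _)) _.
rewrite rnormN (rnormB p.[z]) (rnormB p.[v]); have := lp _ _ x1 y1.
have : rnorm (x - y) <= rnorm (z - v) + 2 * e.
  have -> : x - y = (x - z) + ((z - v) - (y - v)) by ring.
  apply: le_trans (rnormD _ _) _; have := rnormD (z - v) (- (y - v)); rewrite rnormN; lra.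
move=> /(ler_wpM2l M0); lra.
Qed.

End DiskAlgebra.

(** * The commutator formula *)

Section FunctionalCalculus.
Context (R : realType) (d : measure_display) (X : measurableType d).
Context (H K : hilbertType R[i]) (V : H -> K).
Variables (E : set X -> H -> H) (G : set X -> K -> K).
Hypothesis dil : spectral_dilation E V G.
Variables (z : X -> R[i]) (T : H -> H).
Hypothesis z1 : forall x, rnorm (z x) = 1.
Hypothesis hT : forall n, has_integral E (fun x => z x ^+ n) (iter n T).

Lemma has_integral_poly (p : {poly R[i]}) : has_integral E (fun x => p.[z x]) (poly_operator p T).
Proof.
have := @has_integral_sum _ _ _ _ E _ (index_enum 'I_(size p)) (fun i => p`_i)
  (fun i x => z x ^+ i) (fun i => iter i T) (fun i => hT _).
by congr has_integral; apply: funext => x; rewrite horner_coef.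
Qed.

(** The two operators are integrals of [p] and [q] over values of [z], which lie on the circle, so
    the inequality is the norm bound for an integral. *)
Lemma von_neumann (p q : {poly R[i]}) (c : R) u : 0 <= c ->
  (forall x, rnorm x <= 1 -> rnorm (p.[x] - q.[x]) <= c) ->
  rnorm (poly_operator p T u - poly_operator q T u) <= c * rnorm u.
Proof.
move=> c0 h; have := has_integral_le dil u (has_integral_lin (-1) (has_integral_poly q)
    (has_integral_poly p)) c0.
rewrite scaleN1r addrC; apply=> x; rewrite mulN1r addrC; apply: h.
by rewrite z1.
Qed.

(** [disk_calculus] is a choice among the operators satisfying [is_disk_calculus]; this makes every
    good polynomial usable, not only those that come with the choice. The factor [3] is [c] for such
    a polynomial [q], plus [2 * c] between [q] and [p]. *)
Lemma disk_calculusP (phi : R[i] -> R[i]) :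
  (forall eta : R, 0 < eta -> exists p : {poly R[i]},
    forall x, rnorm x <= 1 -> rnorm (disk_closure phi x - p.[x]) <= eta) ->
  forall (p : {poly R[i]}) (c : R) u, 0 < c ->
    (forall x, rnorm x <= 1 -> rnorm (disk_closure phi x - p.[x]) <= c) ->
    rnorm (disk_calculus phi T u - poly_operator p T u) <= 3 * c * rnorm u.
Proof.
move=> happ.
have sub (p q : {poly R[i]}) (a b : R) x : rnorm (disk_closure phi x - p.[x]) <= a ->
    rnorm (disk_closure phi x - q.[x]) <= b -> rnorm (p.[x] - q.[x]) <= a + b.
  move=> ha hb; rewrite -(subrK (disk_closure phi x) p.[x]) -addrA.
  by apply: le_trans (rnormD _ _) _; rewrite lerD// rnormB.
have [A hA] : exists A, is_disk_calculus phi T A.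
  have h n := cid (happ n.+1%:R^-1 (ltac:(by rewrite invr_gt0) : 0 < n.+1%:R^-1)).
  pose q n := projT1 (h n).
  have hq n x : rnorm x <= 1 -> rnorm (disk_closure phi x - (q n).[x]) <= n.+1%:R^-1.
    exact: (projT2 (h n) x).
  have [|A hA] := @op_limit _ H H (fun n => poly_operator (q n) T).
    move=> n m u; apply: von_neumann => [|x x1]; first by rewrite addr_ge0// invr_ge0.
    by apply: sub; exact: hq.
  exists A => e e0.
  have eE : (complex.Re e)%:C%C = e by rewrite RRe_real// gtr0_real.
  have e0' : 0 < complex.Re e by rewrite -(ltcR 0) eE.
  have [n /(_ n (leqnn n)) hn] := inv_small e0'.
  exists (q n); split=> [x x1|u].
    rewrite -rnormE -eE lecR; apply: le_trans (ltW hn); apply: hq.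
    by rewrite -lecR rnormE.
  rewrite -!rnormE -eE -rmorphM lecR; apply: le_trans (hA n u) _.
  by rewrite ler_wpM2r ?rnorm_ge0// ltW.
have : is_disk_calculus phi T (disk_calculus phi T).
  exact: (@xgetPex _ (fun=> 0) [set A | is_disk_calculus phi T A] (ex_intro _ A hA)).
move=> {}hA p c u c0 hp.
have [|q [hq1 hq2]] := hA c%:C%C; first by rewrite (ltcR 0).
have k1 : rnorm (disk_calculus phi T u - poly_operator q T u) <= c * rnorm u.
  by rewrite -lecR rmorphM/= !rnormE.
have k2 : rnorm (poly_operator q T u - poly_operator p T u) <= (c + c) * rnorm u.
  apply: von_neumann => [|x x1]; first by rewrite addr_ge0// ltW.
  apply: sub; last exact: hp.
  by rewrite -lecR rnormE; apply: hq1; rewrite -rnormE lecR.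
rewrite -(subrK (poly_operator q T u) (disk_calculus phi T u)) -addrA.
apply: le_trans (rnormD _ _) _; lra.
Qed.

End FunctionalCalculus.

Lemma polynomial_difference (R : realType) (p : {poly R[i]}) (a b : R[i]) :
  (a - b) * (\sum_(i < size p) p`_i * \sum_(j < i) 1 * (a ^+ (i.-1 - j) * b ^+ j)) =
  p.[a] - p.[b].
Proof.
rewrite !horner_coef -sumrB mulr_sumr; apply: eq_bigr => i _.
rewrite mulrCA -mulrBr subrXX; do 2 congr (_ * _).
by apply: eq_bigr => j _; rewrite mul1r; congr (_ ^+ _ * _); case: (i : nat) => // n; rewrite subSS.
Qed.

Theorem theorem4p6 (R : realType) (phi : R[i] -> R[i])
    (phi_analytic : analytic_in_disk phi)
    (dphi_Hinfty : Hinfty (derive1 phi))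
    (H : hilbertType R[i]) (T Q : H -> H)
    (T_contraction : contraction_operator T) (Q_bounded : bounded_operator Q)
    (TQ_hs : hilbert_schmidt (fun u => T (Q u) - Q (T u)))
    (E : set (circle R) -> H -> H) (E_T : semispectral_measure_of T E)
    (L : hsType H)
    (L_doi : double_operator_integral E E (divided_difference phi)
               (hs_of TQ_hs) L) :
  (fun u => disk_calculus phi T (Q u) - Q (disk_calculus phi T u)) = L.
Proof.
have [bT _] := T_contraction.
have [K [V [U [G [[isoV _ powU] spG sU cE]]]]] := E_T.
have dil : spectral_dilation E V G by split.
pose z : circle R -> R[i] := @circle_val R.
have z1 x : rnorm (z x) = 1.
  by apply: (@complexI R); rewrite rnormE; have := set_valP x.
have hT n : has_integral E (fun x => z x ^+ n) (iter n T).
  exact: (has_integral_compression dil (has_integral_pow spG n z1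
      (spectral_integral_has_integral sU)) (powU n)).
have [Y hY] : exists Y, has_integral E (fun x => (z x)^*) Y.
  by apply: (has_integral_conj dil (I := T)); have := hT 1%N; congr has_integral; apply:
      funext => x; rewrite expr1.
have [F [I [dF [L' [W [G2 [J [dil2 sJ cJ]]]]] LE]]] := L_doi.
have hI := has_integral_compression dil2 (spectral_integral_has_integral sJ) cJ.
set C := hs_of TQ_hs in LE.
have CE u : C u = T (Q u) - Q (T u) by [].
have [M hM] := has_integral_ratio dil dil2 dF z1 hT hY.
have FC0 := diag_commutator dil dil2 dF z1 hT hY bT hM Q_bounded CE.
have [B B0 [lipphi happ]] := closed_disk_approximation phi_analytic dphi_Hinfty.
have calc := disk_calculusP dil z1 hT (phi := phi).
have [N N0 hN] := bounded_rnorm Q_bounded.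
apply: funext => u; apply/eqP; rewrite -subr_eq0; apply/eqP.
(* The first two terms pay for replacing [phi(T)] by [p(T)] in each half of the commutator, at
   [3 * e] each; the last one bounds [D], the difference of the two double integrals at [C]. *)
apply: (@rnorm_small _ _ _ (3 * rnorm (Q u) + N * (3 * rnorm u) + (2 * B + 2 * rnorm C) * rnorm u)).
move=> e e0; have [n hn] := mass_near_diag dil dil2 dF z1 hT C e0.
(* Off the band the distance of the two points exceeds [n.+1%:R^-1], so an error [2 * eta] on the
   numerators becomes [2 * e] on the quotients. *)
pose eta := e / n.+1%:R.
have n0 : 0 < n.+1%:R :> R by [].
have eta0 : 0 < eta by rewrite divr_gt0.
have etae : eta <= e by rewrite ler_pdivrMr// ler_peMr ?(ltW e0)// ler1n.
have [p [hp lp]] := happ _ eta0.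
have [P [hP PE]] := has_integral_divided_difference dil dil2 dF z1 hT bT p.
have {}PE := PE Q C CE Q_bounded.
have hIP := has_integral_lin (-1) hP hI.
have zle x : rnorm (z x) <= 1 by rewrite z1.
pose Psi (x : circle R * circle R) : R[i] :=
  \sum_(i < size p) p`_i * \sum_(j < i) 1 * (z x.1 ^+ (i.-1 - j) * z x.2 ^+ j).
have PsiE x : (z x.1 - z x.2) * Psi x = p.[z x.1] - p.[z x.2] by exact: polynomial_difference.
have DE x : ~ diag z x -> (z x.1 - z x.2) * divided_difference phi x =
    disk_closure phi (z x.1) - disk_closure phi (z x.2).
  move=> /eqP nx; rewrite /divided_difference -/z (negbTE nx) mulrC divfK//.
  by rewrite subr_eq0.
have pos x : ~ diag z x -> 0 < rnorm (z x.1 - z x.2).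
  move=> nx; rewrite lt_neqAle eq_sym rnorm_ge0 andbT; apply/eqP => /rnorm_eq0/eqP.
  by rewrite subr_eq0 => /eqP.
have e2 : 0 <= 2 * e by rewrite mulr_ge0// ltW.
have B2 : 0 <= 2 * B by rewrite mulr_ge0.
have := has_integral_off_diag (n := n) dil dil2 dF z1 hT FC0 hIP B2 e2.
move=> /(_ _ _).
(* Multiplying by [z x.1 - z x.2] turns both quotients into increments, controlled by the common
   Lipschitz constant [B]; the bound is therefore independent of [eta]. *)
have bound1 x : near_diag z n x -> ~ diag z x ->
    rnorm (-1 * Psi x + divided_difference phi x) <= 2 * B.
  move=> _ nx; apply: le_trans (rnormD _ _) _; rewrite mulN1r rnormN.
  have b1 : rnorm (Psi x) <= B.
    rewrite -(ler_pM2l (pos x nx)) -rnormM PsiE mulrC; exact: lp.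
  have b2 : rnorm (divided_difference phi x) <= B.
    rewrite -(ler_pM2l (pos x nx)) -rnormM DE// mulrC; exact: lipphi.
  lra.
have bound2 x : ~ near_diag z n x -> rnorm (-1 * Psi x + divided_difference phi x) <= 2 * e.
  move=> /negP; rewrite -ltNge => nx.
  have ndx : ~ diag z x.
    by move=> dx; move: nx; rewrite (dx : z x.1 = z x.2) subrr rnorm0 invr_lt0 ltNge ltW.
  rewrite -(ler_pM2l (pos x ndx)) -rnormM mulrDr DE// mulrCA PsiE mulN1r.
  have k1 : rnorm (- (p.[z x.1] - p.[z x.2]) +
      (disk_closure phi (z x.1) - disk_closure phi (z x.2))) <= 2 * eta.
    have swap (a b c d : R[i]) : - (a - b) + (c - d) = (c - a) - (d - b) by ring.
    rewrite swap; apply: le_trans (rnormD _ _) _; rewrite rnormN.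
    have := hp _ (zle x.1); have := hp _ (zle x.2); lra.
  apply: le_trans k1 _; rewrite [leRHS]mulrCA ler_wpM2l// /eta mulrC.
  by rewrite ler_wpM2r ?(ltW e0)// ltW.
move=> /(_ bound1 bound2); set D : hsType H := -1 *: P C + I C => hD.
have {}hD : rnorm D <= e * (2 * B + 2 * rnorm C).
  apply: le_trans hD _; have := ler_wpM2l B2 hn; lra.
have DuE : D u = I C u - (poly_operator p T (Q u) - Q (poly_operator p T u)).
  by rewrite -PE -[LHS]/(-1 *: P C u + I C u) scaleN1r addrC.
have cal v : rnorm (disk_calculus phi T v - poly_operator p T v) <= 3 * e * rnorm v.
  apply: le_trans (calc _ p eta v eta0 _) _ => [c c0|x x1|].
  - by have [q [hq _]] := happ c c0; exists q.
  - exact: hp.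
  - by rewrite ler_wpM2r ?rnorm_ge0// ler_wpM2l.
set A := disk_calculus phi T in cal *; set PT := poly_operator p T in cal DuE *.
have QB v v' : Q (v - v') = Q v - Q v'.
  by rewrite -scaleN1r addrC (bounded_operatorZD _ _ _ Q_bounded) scaleN1r addrC.
have -> : A (Q u) - Q (A u) - L u = (A (Q u) - PT (Q u)) - Q (A u - PT u) - D u.
  rewrite QB DuE LE; set a := A _; set b := Q (A u); set c := I C u; set x := PT _; set y := Q _.
  have -> : a - x - (b - y) = a - b - (x - y) by rewrite !opprD !opprK addrACA.
  by rewrite (opprB c) [RHS]addrA subrK.
apply: le_trans (rnormD _ _) _; apply: le_trans (lerD (rnormD _ _) (lexx _)) _.
rewrite !rnormN.
have c1 := cal (Q u).
have c2 : rnorm (Q (A u - PT u)) <= N * (3 * e * rnorm u).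
  by apply: le_trans (hN _) _; rewrite ler_wpM2l.
have c3 : rnorm (D u) <= e * (2 * B + 2 * rnorm C) * rnorm u.
  by apply: le_trans (hs_op_norm _ _) _; rewrite ler_wpM2r ?rnorm_ge0.
lra.
Qed.
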